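(* For $\alpha\in(0,\pi/2)$ (respectively $\alpha\in(-\pi/2,0)$), consider the mean-field self-consistency condition $$\mu\,\mathbb{M}(k,r)=e^{i\alpha}r$$ in the unknowns $k\in\mathbb{R}$, $r\ge0$, with parameter $\mu>0$. It undergoes a global supercritical pitchfork bifurcation in $\mu$ at the bifurcation point $\mu_\alpha=2\sec\alpha$. For $\mu\le\mu_\alpha$, the trivial solution $r=0$ is the unique solution, while for $\mu>\mu_\alpha$, an additional solution $(\mu,k_\alpha(\mu),r_\alpha(\mu))$ emanates from the bifurcation point $(\mu_\alpha,k_\alpha(\mu_\alpha),r_\alpha(\mu_\alpha))=(2\sec\alpha,\tan\alpha,0)$. This bifurcation diagram is global in the sense that the curve consisting of nontrivial solutions, $$\Gamma_\alpha=\{(k_\alpha(\mu),r_\alpha(\mu)) : \mu>\mu_\alpha\},$$ can also be parametrized by means of an increasing bijection $K_\alpha:(0,\infty)\to(\tan\alpha,\infty)$ (respectively a decreasing bijection $K_\alpha:(0,\infty)\to(-\infty,\tan\alpha)$): $$\Gamma_\alpha=\{(K_\alpha(r),r) : r>0\},$$ exhausting all possible nontrivial solutions. Furthermore, for $\alpha\in(0,\pi/2)$, $$\lim_{\mu\to\mu_\alpha^+}k_\alpha(\mu)=\tan\alpha,$$ $$\lim_{\alpha\to\pi/2^-}k_\alpha(\mu)=\infty,$$ $$\lim_{\mu\to\infty}k_\alpha(\mu)=\infty,$$ $$\lim_{\alpha\to\pi/2^-}r_\alpha(\mu)=\infty,$$ $$\lim_{\mu\to\infty}r_\alpha(\mu)=\infty.$$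 For $\alpha=\pm\pi/2$, the trivial solution is unique for all $\mu>0$.
   Context: $I_\nu(r)=\sum_{p=0}^\infty\frac{1}{p!\,\Gamma(\nu+p+1)}\left(\frac r2\right)^{\nu+2p}$ is the modified Bessel function of the first kind of complex order $\nu$. The mean resultant map is $$\mathbb{M}(k,r)=\frac{I_{1-ik}(r)}{I_{-ik}(r)},\qquad k\in\mathbb{R},\ r>0,$$ extended continuously to $r=0$ by $\mathbb{M}(k,0)=0$. A solution of the self-consistency condition with $r=0$ is called trivial, and a solution with $r>0$ is called nontrivial.
   Formalization: At fixed μ the limits α→π/2⁻ are undefined, since μ_α=2 sec α→∞ ends the branch; they are stated only along α with μ_α<μ (vacuous), and also for μ=m(α) varying with α: m(α)>μ_α for k_α, and m(α)≥c·μ_α with a fixed c>1 for r_α. *)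

(* Defs.v *)
From Stdlib Require Import Reals Factorial.
From Coquelicot Require Import Coquelicot.

Open Scope R_scope.

Definition Cexp (z : C) : C := (exp (Re z) * cos (Im z), exp (Re z) * sin (Im z)).

(* [x ^ z] for a positive base [x], principal branch. *)
Definition Cpower (x : R) (z : C) : C := Cexp (z * RtoC (ln x)).

Definition CLim_seq (u : nat -> C) : C :=
  (real (Lim_seq (fun n => Re (u n))), real (Lim_seq (fun n => Im (u n)))).

Definition CSeries (a : nat -> C) : C :=
  (Series (fun n => Re (a n)), Series (fun n => Im (a n))).

(* [z (z + 1) ... (z + n - 1)] *)
Fixpoint Crising (z : C) (n : nat) : C :=
  match n with
  | O => RtoC 1
  | S m => (Crising z m * (z + RtoC (INR m)))%C
  end.

(* Euler-Gauss limit [n! n^z / (z (z + 1) ... (z + n))], valid for every complex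
   [z] outside the poles.  At a pole the denominator vanishes for all large [n]
   and Coquelicot's [/ 0 = 0] gives [Gamma z = 0], hence [1 / Gamma z = 0],
   the usual convention in the Bessel series. *)
Definition Gamma (z : C) : C :=
  CLim_seq (fun n =>
    (RtoC (INR (fact n)) * Cpower (INR n) z / Crising z (S n))%C).

(* Modified Bessel function of the first kind, complex order, [0 < r]. *)
Definition BesselI (nu : C) (r : R) : C :=
  CSeries (fun p =>
    (RtoC 1 / (RtoC (INR (fact p)) * Gamma (nu + RtoC (INR p) + RtoC 1))
     * Cpower (r / 2) (nu + RtoC (2 * INR p)))%C).

Definition mean_resultant (k r : R) : C :=
  if Req_EM_T r 0 then RtoC 0
  else (BesselI (RtoC 1 - Ci * RtoC k) r / BesselI (- (Ci * RtoC k)) r)%C.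

Definition self_consistent (alpha mu k r : R) : Prop :=
  0 <= r /\
  (RtoC mu * mean_resultant k r)%C = (Cexp (Ci * RtoC alpha) * RtoC r)%C.

Definition mu_crit (alpha : R) : R := 2 / cos alpha.

(* [sol mu k r] is a solution set with amplitude [r >= 0].  The amplitude [r = 0]
   is a solution for every [mu > 0] and the only one up to [mu0]; past [mu0]
   there is exactly one solution with [0 < r], namely [(kb mu, rb mu)], and this
   branch issues continuously from [(mu0, k0, 0)]. *)
Definition supercritical_pitchfork
    (sol : R -> R -> R -> Prop) (mu0 k0 : R) (kb rb : R -> R) : Prop :=
  (forall mu k, 0 < mu -> sol mu k 0) /\
  (forall mu k r, 0 < mu <= mu0 -> sol mu k r -> r = 0) /\
  (forall mu, mu0 < mu ->
     0 < rb mu /\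
     forall k r, 0 < r -> (sol mu k r <-> k = kb mu /\ r = rb mu)) /\
  kb mu0 = k0 /\ rb mu0 = 0 /\
  continuous_on (fun mu => mu0 <= mu) kb /\
  continuous_on (fun mu => mu0 <= mu) rb.

Definition nontrivial_curve (mu0 : R) (kb rb : R -> R) (k r : R) : Prop :=
  exists mu, mu0 < mu /\ k = kb mu /\ r = rb mu.

(* The curve of nontrivial solutions is the graph of [K] over [r > 0], and
   contains every nontrivial solution. *)
Definition global_curve
    (sol : R -> R -> R -> Prop) (mu0 : R) (kb rb K : R -> R) : Prop :=
  (forall k r, nontrivial_curve mu0 kb rb k r <-> 0 < r /\ k = K r) /\
  (forall mu k r, 0 < mu -> 0 < r -> sol mu k r -> nontrivial_curve mu0 kb rb k r).

Definition bijection_on (A B : R -> Prop) (f : R -> R) : Prop :=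
  (forall x, A x -> B (f x)) /\
  (forall x y, A x -> A y -> f x = f y -> x = y) /\
  (forall z, B z -> exists x, A x /\ f x = z).

Definition increasing_on (A : R -> Prop) (f : R -> R) : Prop :=
  forall x y, A x -> A y -> x < y -> f x < f y.

Definition decreasing_on (A : R -> Prop) (f : R -> R) : Prop :=
  forall x y, A x -> A y -> x < y -> f y < f x.

(* Main.v *)
Require Import Defs.
From Stdlib Require Import Reals Arith Lra Lia Psatz ClassicalEpsilon.
From Coquelicot Require Import Coquelicot.

Open Scope R_scope.

(** Multiplying [I_{1-ik}(r) / I_{-ik}(r)] by [I_{ik}(r) / I_{ik}(r)] turns the
    mean resultant into a quotient of series with explicit terms: by the
    Chu-Vandermonde identity the coefficients in the variable [x = r^2 / 4] are, up
    to a common factor, [c_n = binom(2n, n) / prod_{j<=n} (j^2 + k^2)] in the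
    denominator and [(n + ik) c_n / r], [n >= 1], in the numerator.  If [E] is the
    expectation over [n >= 1] for the weights [c_n x^n], the argument of [M(k, r)]
    is [atan (k / E n)], and [r / (2 Re M)] is the quotient of
    [E (n (n^2 + k^2) / (2 n - 1))] by [E n].
    With [T = tan alpha], the self-consistency condition is therefore the pair
    [k = T E n] and [mu = r cos alpha / Re M].

    The mean [E n] increases with [x], decreases with [k^2], and runs from 1 to
    infinity (monotone likelihood ratio, [expect_likelihood_ratio]).  So for each
    [r] the first equation has exactly one solution [k = K(r)], and [K] is an
    increasing bijection.

    The crux is that [mu] increases along this curve ([stiff_increasing]).  On the
    curve [k^2 = T^2 (E n)^2], and substituting this makes [mu] a functional of
    the weights alone, namely [spread + T^2 drift] up to a factor.  Two points of
    the curve are compared through a third weight, having the parameter [k'] of the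
    second point and the mean of the first one.  At equal means the weight with
    the larger [k^2] is larger in the convex order ([expect_convex_order]), which
    increases the expectations of the convex functions [y^2] and [1 / y] of
    [y = 2 n - 1], the only ones that occur besides the mean.  Moving
    [x] at a fixed [k'] increases [spread], a size-biased expectation of an
    increasing function, and does not decrease [drift], whose derivative is
    nonnegative because [E ((y - 1) (y - t)^2 / y) >= 0] for a good [t].

    Hence [mu] is an increasing bijection of [r] from [0, oo) onto
    [2 sec alpha, oo), continuous by dominated convergence, and the whole
    bifurcation diagram follows by inverting it.  When [alpha] tends to [PI / 2] at
    bounded [r], [k > tan alpha] concentrates the weights on [n = 1] and forces
    [mu cos alpha] to 2; so [r] is unbounded if [mu] stays away from the
    bifurcation value in ratio.  The Gamma factors cancel from the quotient once
    the Gauss products for [1 - ik] are known to converge to a nonzero limit.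
    Negative [alpha] reduce to positive ones by complex conjugation. *)

(** * Moments of rapidly decreasing weights *)

(** The weights below decrease faster than any geometric sequence, so exponential
    growth can be allowed for the functions whose moments are taken; unlike a
    degree bound it is stable under products without any bookkeeping. *)
Definition tame (f : nat -> R) : Prop :=
  exists C q, 0 <= C /\ 1 <= q /\ forall n, Rabs (f n) <= C * q ^ n.

Lemma tame_const c : tame (fun _ => c).
Proof.
exists (Rabs c), 1; repeat split; [apply Rabs_pos | lra | intros n].
rewrite pow1; lra.
Qed.

Lemma pow_ge_1 q n : 1 <= q -> 1 <= q ^ n.
Proof. exact (fun Hq => pow_R1_Rle q n Hq). Qed.

Lemma tame_INR : tame INR.
Proof.
exists 1, 2; repeat split; try lra; intros n.
rewrite Rabs_pos_eq by apply pos_INR.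
induction n as [|n IH]; [simpl; lra|].
rewrite S_INR; simpl. assert (H := pow_ge_1 2 n). lra.
Qed.

Lemma tame_plus f g : tame f -> tame g -> tame (fun n => f n + g n).
Proof.
intros (C & q & HC & Hq & Hf) (D & s & HD & Hs & Hg).
exists (C + D), (q * s); repeat split; [lra | nra | intros n].
rewrite Rpow_mult_distr.
assert (Hqn := pow_ge_1 q n Hq). assert (Hsn := pow_ge_1 s n Hs).
assert (H := Rabs_triang (f n) (g n)).
specialize (Hf n); specialize (Hg n).
assert (C * q ^ n <= C * (q ^ n * s ^ n)) by (apply Rmult_le_compat_l; nra).
assert (D * s ^ n <= D * (q ^ n * s ^ n)) by (apply Rmult_le_compat_l; nra).
nra.
Qed.

Lemma tame_mult f g : tame f -> tame g -> tame (fun n => f n * g n).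
Proof.
intros (C & q & HC & Hq & Hf) (D & s & HD & Hs & Hg).
exists (C * D), (q * s); repeat split; [nra | nra | intros n].
rewrite Rpow_mult_distr, Rabs_mult.
replace (C * D * (q ^ n * s ^ n)) with ((C * q ^ n) * (D * s ^ n)) by ring.
apply Rmult_le_compat; auto using Rabs_pos.
Qed.

Lemma tame_opp f : tame f -> tame (fun n => - f n).
Proof.
intros (C & q & HC & Hq & Hf); exists C, q; repeat split; auto.
intros n; rewrite Rabs_Ropp; auto.
Qed.

Lemma tame_minus f g : tame f -> tame g -> tame (fun n => f n - g n).
Proof. intros Hf Hg; apply (tame_plus f (fun n => - g n) Hf (tame_opp g Hg)). Qed.

Lemma tame_pow f d : tame f -> tame (fun n => f n ^ d).
Proof.
intros Hf; induction d as [|d IH]; simpl; [apply tame_const|].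
now apply tame_mult.
Qed.

Lemma tame_bounded f M : (forall n, Rabs (f n) <= M) -> tame f.
Proof.
intros H; exists M, 1; repeat split; [|lra|].
- apply Rle_trans with (2 := H 0%nat), Rabs_pos.
- intros n; rewrite pow1, Rmult_1_r; apply H.
Qed.

(** Indices start at 0 whereas the weights of interest live on [n >= 1]; the index
    [n] stands for [n + 1], and [odd n] for the variable [y] attached to it. *)
Definition odd (n : nat) : R := 2 * INR n + 1.

Lemma odd_ge_1 n : 1 <= odd n.
Proof. unfold odd; assert (H := pos_INR n); lra. Qed.

Lemma tame_odd : tame odd.
Proof.
apply tame_plus; [apply tame_mult; [apply tame_const | apply tame_INR] | apply tame_const].
Qed.

Lemma tame_inv_odd : tame (fun n => / odd n).
Proof.
apply tame_bounded with 1; intros n; assert (H := odd_ge_1 n).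
rewrite Rabs_pos_eq by (apply Rlt_le, Rinv_0_lt_compat; lra).
rewrite <- Rinv_1; apply Rinv_le_contravar; lra.
Qed.

Ltac tame :=
  repeat first
    [ apply tame_const | apply tame_INR | apply tame_odd | apply tame_inv_odd
    | assumption
    | apply tame_plus | apply tame_minus | apply tame_opp
    | apply tame_mult | apply tame_pow ].

Definition summing (w : nat -> R) : Prop :=
  forall f, tame f -> ex_series (fun n => f n * w n).

Definition weight (w : nat -> R) : Prop := (forall n, 0 < w n) /\ summing w.

Definition moment (w f : nat -> R) : R := Series (fun n => f n * w n).

Definition expect (w f : nat -> R) : R := moment w f / moment w (fun _ => 1).

Lemma moment_ext w f g : (forall n, f n = g n) -> moment w f = moment w g.
Proof. intros H; apply Series_ext; intros n; now rewrite H. Qed.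

Lemma moment_plus w f g : summing w -> tame f -> tame g ->
  moment w (fun n => f n + g n) = moment w f + moment w g.
Proof.
intros Hw Hf Hg; unfold moment; rewrite <- Series_plus by auto.
apply Series_ext; intros n; ring.
Qed.

Lemma moment_scal w c f : moment w (fun n => c * f n) = c * moment w f.
Proof.
unfold moment; rewrite <- Series_scal_l; apply Series_ext; intros n; ring.
Qed.

Lemma moment_minus w f g : summing w -> tame f -> tame g ->
  moment w (fun n => f n - g n) = moment w f - moment w g.
Proof.
intros Hw Hf Hg.
rewrite (moment_ext w _ (fun n => f n + (-1) * g n)) by (intros; ring).
rewrite moment_plus, moment_scal; auto; [ring | tame].
Qed.

Lemma moment_const w c : moment w (fun _ => c) = c * moment w (fun _ => 1).
Proof. rewrite <- moment_scal; apply moment_ext; intros; ring. Qed.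

Lemma Series_ge_term u n : ex_series u -> (forall i, 0 <= u i) -> u n <= Series u.
Proof.
intros Hu Hpos.
apply Rle_trans with (sum_f_R0 u n).
- destruct n; simpl; [lra|].
  assert (H := cond_pos_sum u n Hpos); lra.
- apply sum_incr; [|exact Hpos].
  apply is_lim_seq_Reals.
  apply is_lim_seq_ext with (sum_n u); [intros; apply sum_n_Reals|].
  exact (Series_correct u Hu).
Qed.

Lemma Series_pos u n :
  ex_series u -> (forall i, 0 <= u i) -> 0 < u n -> 0 < Series u.
Proof. intros Hu Hpos Hn; assert (H := Series_ge_term u n Hu Hpos); lra. Qed.

Lemma Series_nonneg u : ex_series u -> (forall i, 0 <= u i) -> 0 <= Series u.
Proof.
intros Hu Hpos; apply Rle_trans with (u 0%nat); auto.
now apply Series_ge_term.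
Qed.

Lemma moment_pos w f : weight w -> tame f ->
  (forall n, 0 <= f n) -> (exists n, 0 < f n) -> 0 < moment w f.
Proof.
intros [Hw Hs] Hf H0 [n Hn]; apply Series_pos with n; auto.
- intros i; specialize (Hw i); specialize (H0 i); nra.
- now apply Rmult_lt_0_compat.
Qed.

Lemma moment_nonneg w f : weight w -> tame f -> (forall n, 0 <= f n) ->
  0 <= moment w f.
Proof.
intros [Hw Hs] Hf H0; apply Series_nonneg; auto.
intros i; specialize (Hw i); specialize (H0 i); nra.
Qed.

Lemma mass_pos w : weight w -> 0 < moment w (fun _ => 1).
Proof.
intros Hw; apply moment_pos; auto; [tame | intros; lra | exists 0%nat; lra].
Qed.

Lemma expect_center w f : weight w -> tame f ->
  moment w (fun n => f n - expect w f) = 0.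
Proof.
intros Hw Hf; assert (H := mass_pos w Hw).
rewrite moment_minus; [| apply Hw | tame | tame].
rewrite moment_const; unfold expect; field; lra.
Qed.

Lemma expect_lt w f c : weight w -> tame f ->
  0 < moment w (fun n => f n - c) -> c < expect w f.
Proof.
intros Hw Hf; rewrite moment_minus; [| apply Hw | tame | tame].
rewrite moment_const; intros H.
assert (H1 := mass_pos w Hw).
unfold expect; apply Rmult_lt_reg_r with (1 := H1).
unfold Rdiv; rewrite Rmult_assoc, Rinv_l; lra.
Qed.

Lemma expect_le w f g : weight w -> tame f -> tame g ->
  (forall n, f n <= g n) -> expect w f <= expect w g.
Proof.
intros Hw Hf Hg H; unfold expect.
apply Rmult_le_compat_r.
- apply Rlt_le, Rinv_0_lt_compat, mass_pos, Hw.
- apply Rminus_le.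
  assert (0 <= moment w (fun n => g n - f n)).
  { apply moment_nonneg; auto; [tame | intros n; specialize (H n); lra]. }
  rewrite moment_minus in H0; auto; [lra | apply Hw].
Qed.

Lemma expect_const w c : weight w -> expect w (fun _ => c) = c.
Proof.
intros Hw; assert (H := mass_pos w Hw); unfold expect.
rewrite moment_const; field; lra.
Qed.

Lemma least (P : nat -> Prop) :
  (exists n, P n) -> exists n, P n /\ forall i, (i < n)%nat -> ~ P i.
Proof.
intros [n Hn]; revert Hn; induction n as [n IH] using lt_wf_ind; intros Hn.
destruct (classic (exists i, (i < n)%nat /\ P i)) as [[i [Hi HP]]|H].
- now apply (IH i).
- exists n; split; auto; intros i Hi HP; apply H; now exists i.
Qed.

Lemma increasing_seq_lt (u : nat -> R) : (forall n, u n < u (S n)) ->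
  forall i j, (i < j)%nat -> u i < u j.
Proof.
intros H i j Hij; induction Hij as [|j Hij IH]; [apply H|].
apply Rlt_trans with (1 := IH), H.
Qed.

(** Monotone likelihood ratio comparison.  If [m] is the first mean and [n0]
    the first index with [f n0 >= m], both [f - m] and [w' / w - w' n0 / w n0]
    change sign at [n0], so that their product has a constant sign; and
    subtracting a constant from the ratio costs nothing since [f - m] has zero
    mean for [w]. *)
Lemma expect_likelihood_ratio w w' f :
  weight w -> weight w' -> tame f ->
  (forall n, f n < f (S n)) ->
  (forall n, w' n / w n < w' (S n) / w (S n)) ->
  expect w f < expect w' f.
Proof.
intros Hw Hw' Tf Hf Hl.
set (m := expect w f).
assert (Hc := expect_center w f Hw Tf); fold m in Hc.
assert (Hex : exists n, m <= f n).
{ apply NNPP; intros Hn.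
  assert (H : 0 < moment w (fun n => m - f n)).
  { assert (forall n, f n < m).
    { intros n; apply Rnot_le_lt; intros H; apply Hn; now exists n. }
    apply moment_pos; auto; [tame | intros n; specialize (H n); lra |].
    exists 0%nat; specialize (H 0%nat); lra. }
  rewrite (moment_ext w _ (fun n => (-1) * (f n - m))) in H by (intros; ring).
  rewrite moment_scal in H; lra. }
destruct (least _ Hex) as [n0 [Hn0 Hmin]].
assert (Hmin' : forall i, (i < n0)%nat -> f i < m).
{ intros i Hi; apply Rnot_le_lt; exact (Hmin i Hi). }
set (l := fun n => w' n / w n).
assert (Hfs := increasing_seq_lt f Hf).
assert (Hls := increasing_seq_lt l Hl).
destruct Hw as [Hwp Hws]; destruct Hw' as [Hwp' Hws'].
assert (Heq : forall n, w' n = w n * l n).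
{ intros n; unfold l; field; apply Rgt_not_eq, Hwp. }
apply expect_lt; [split; auto | auto |].
assert (Hm : moment w' (fun n => f n - m) =
   Series (fun n => (f n - m) * w' n + - l n0 * ((f n - m) * w n))).
{ rewrite Series_plus, Series_scal_l.
  - unfold moment in Hc |- *; rewrite Hc; ring.
  - apply Hws'; tame.
  - apply (ex_series_scal_l (K := R_AbsRing) (V := R_NormedModule)).
    apply Hws; tame. }
rewrite Hm.
assert (Hterm : forall n, (f n - m) * w' n + - l n0 * ((f n - m) * w n)
   = w n * ((f n - m) * (l n - l n0))) by (intros n; rewrite Heq; ring).
apply Series_pos with (S n0).
- apply (ex_series_plus (K := R_AbsRing) (V := R_NormedModule)).
  + apply Hws'; tame.
  + apply (ex_series_scal_l (K := R_AbsRing) (V := R_NormedModule)).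
    apply Hws; tame.
- intros n; rewrite Hterm; apply Rmult_le_pos; [apply Rlt_le, Hwp|].
  destruct (lt_eq_lt_dec n n0) as [[H| ->]|H].
  + specialize (Hmin' n H); specialize (Hls n n0 H); nra.
  + nra.
  + specialize (Hfs n0 n H); specialize (Hls n0 n H); nra.
- rewrite Hterm; apply Rmult_lt_0_compat; [apply Hwp|].
  specialize (Hf n0); specialize (Hl n0); fold (l n0) (l (S n0)) in Hl.
  apply Rmult_lt_0_compat; lra.
Qed.

(** Some rise occurs between [i] and [n], and the sequence increases from there on. *)
Lemma valley_stays_above (l : nat -> R) (L : R) (i n : nat) :
  (forall p, l p < l (S p) -> l (S p) < l (S (S p))) ->
  (i < n)%nat -> l i < L -> L <= l n -> forall j, (n <= j)%nat -> L <= l j.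
Proof.
intros Hv Hin Hi Hn.
assert (Hup : exists p, (p < n)%nat /\ l p < l (S p)).
{ apply NNPP; intros H.
  assert (forall q, (i <= q <= n)%nat -> l q <= l i).
  { induction q as [|q IH]; intros Hq.
    - replace i with 0%nat by lia; lra.
    - destruct (Nat.eq_dec (S q) i) as [->|Hne]; [lra|].
      apply Rle_trans with (l q); [|apply IH; lia].
      apply Rnot_lt_le; intros Hlt; apply H; exists q; split; [lia|auto]. }
  specialize (H0 n ltac:(lia)); lra. }
destruct Hup as [p [Hp Hlt]].
assert (Hinc : forall q, (p <= q)%nat -> l q < l (S q)).
{ intros q Hq; induction Hq as [|q Hq IH]; auto. }
intros j Hj; induction Hj as [|j Hj IH]; auto.
specialize (Hinc j ltac:(lia)); lra.
Qed.

(** Convexity in the form used by the chord argument below, which compares values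
    at three arbitrary indices. *)
Definition convex_seq (f : nat -> R) : Prop :=
  forall i j k, (i < j)%nat -> (j < k)%nat ->
  (INR k - INR i) * f j <= (INR k - INR j) * f i + (INR j - INR i) * f k.

(** Convex order.  Let [L] be the quotient of the total masses.  As [w' / w]
    first decreases and then increases, [w' / w - L] is negative exactly on an
    interval [s <= n < t].  The chord of [f] through [s] and [t] lies above [f]
    between these points and below [f] elsewhere, so that [w' - L w] and
    [f - chord] have the same sign everywhere; and the two weights give the
    same value to the affine chord. *)
Lemma expect_convex_order w w' f :
  weight w -> weight w' -> tame f -> convex_seq f ->
  (forall n, w' n / w n < w' (S n) / w (S n) ->
     w' (S n) / w (S n) < w' (S (S n)) / w (S (S n))) ->
  expect w' INR = expect w INR ->
  expect w f <= expect w' f.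
Proof.
intros Hw Hw' Tf Cf Hv Hmean.
assert (M := mass_pos w Hw). assert (M' := mass_pos w' Hw').
set (l := fun n => w' n / w n).
set (L := moment w' (fun _ => 1) / moment w (fun _ => 1)).
set (d := fun n => w n * (l n - L)).
assert (Hd : forall n, d n = w' n - L * w n).
{ intros n; unfold d, l; field; apply Rgt_not_eq, (proj1 Hw). }
assert (Ed : forall g, tame g -> ex_series (fun n => g n * d n)).
{ intros g Tg.
  apply ex_series_ext with (fun n => g n * w' n + - L * (g n * w n)).
  { intros n; rewrite Hd; change plus with Rplus; simpl; ring. }
  apply (ex_series_plus (K := R_AbsRing) (V := R_NormedModule)).
  - apply Hw'; tame.
  - apply (ex_series_scal_l (K := R_AbsRing) (V := R_NormedModule)).
    apply Hw; tame. }
assert (Md : forall g, tame g -> moment d g = moment w' g - L * moment w g).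
{ intros g Tg; unfold moment.
  rewrite (Series_ext _ (fun n => g n * w' n + - L * (g n * w n))).
  2:{ intros n; rewrite Hd; ring. }
  rewrite Series_plus, Series_scal_l; [ring | apply Hw'; tame |].
  apply (ex_series_scal_l (K := R_AbsRing) (V := R_NormedModule)).
  apply Hw; tame. }
assert (Mexp : forall g, tame g ->
  moment d g = moment w' (fun _ => 1) * (expect w' g - expect w g)).
{ intros g Tg; rewrite Md by auto; unfold L, expect; field; lra. }
assert (D0 : moment d (fun _ => 1) = 0).
{ rewrite Mexp by tame; rewrite !expect_const by auto; ring. }
assert (D1 : moment d INR = 0).
{ rewrite Mexp by tame; rewrite Hmean; ring. }
assert (Goal' : 0 <= moment d f).
2:{ rewrite Mexp in Goal' by auto.
    apply Rnot_lt_le; intros Hlt; nra. }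
assert (dpos : forall n, L <= l n -> 0 <= d n).
{ intros n Hn; unfold d; assert (H := proj1 Hw n); nra. }
assert (dneg : forall n, l n < L -> d n < 0).
{ intros n Hn; unfold d; assert (H := proj1 Hw n); nra. }
destruct (classic (exists n, l n < L)) as [Hs|Hs].
(* Otherwise the nonnegative terms of the total of [d], which is 0, all vanish. *)
2:{ assert (Hall : forall n, 0 <= d n).
    { intros n; apply dpos, Rnot_lt_le; intros H; apply Hs; now exists n. }
    assert (Hz : forall n, d n = 0).
    { intros n; apply Rle_antisym; auto.
      rewrite <- D0; unfold moment.
      rewrite <- (Rmult_1_l (d n)).
      apply (Series_ge_term (fun n => 1 * d n) n).
      - apply Ed; tame.
      - intros i; specialize (Hall i); lra. }
    unfold moment; apply Series_nonneg; [apply Ed; tame|].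
    intros i; rewrite Hz; lra. }
destruct (least _ Hs) as [s [Hsl Hsmin]].
assert (Hbelow : forall n, (n < s)%nat -> L <= l n).
{ intros n Hn; apply Rnot_lt_le; exact (Hsmin n Hn). }
(* If [d] stayed negative after [s], the weight [w'] would have a smaller mean. *)
assert (Ht : exists t, (s < t)%nat /\ L <= l t).
{ apply NNPP; intros Hn.
  assert (Hab : forall n, (s <= n)%nat -> l n < L).
  { intros n Hsn; destruct (Nat.eq_dec n s) as [->|Hne]; auto.
    apply Rnot_le_lt; intros H; apply Hn; exists n; split; [lia|auto]. }
  assert (0 < - moment d (fun n => INR n - INR s)).
  { replace (- moment d (fun n => INR n - INR s))
      with (moment d (fun n => (-1) * (INR n - INR s)))
      by (rewrite moment_scal; ring).
    apply Series_pos with (S s).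
    - apply Ed; tame.
    - intros i; destruct (le_lt_dec s i) as [Hi|Hi].
      + assert (H := le_INR _ _ Hi); assert (H' := dneg i (Hab i Hi)); nra.
      + assert (H := lt_INR _ _ Hi); assert (H' := dpos i (Hbelow i Hi)); nra.
    - rewrite S_INR; assert (H' := dneg _ (Hab (S s) ltac:(lia))); nra. }
  rewrite moment_minus in H; [| intros g Tg; now apply Ed | tame | tame].
  rewrite moment_const, D0, D1 in H; lra. }
destruct (least _ Ht) as [t [[Hst Htl] Htmin]].
assert (Hmid : forall n, (s <= n)%nat -> (n < t)%nat -> l n < L).
{ intros n H1 H2; destruct (Nat.eq_dec n s) as [->|Hne]; auto.
  apply Rnot_le_lt; intros H; apply (Htmin n H2); split; [lia|auto]. }
assert (Habove : forall n, (t <= n)%nat -> L <= l n).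
{ apply (valley_stays_above l L s t); auto. }
set (gap := fun n => (INR t - INR s) * f n
   - ((INR t - INR n) * f s + (INR n - INR s) * f t)).
assert (Hst' := lt_INR _ _ Hst).
assert (Hgap : 0 <= moment d gap).
{ apply Series_nonneg; [apply Ed; unfold gap; tame|].
  intros n; destruct (le_lt_dec s n) as [H1|H1].
  - destruct (le_lt_dec t n) as [H2|H2].
    + apply Rmult_le_pos; [|apply dpos, Habove; auto].
      unfold gap; destruct (Nat.eq_dec n t) as [->|Hne]; [lra|].
      assert (H := Cf s t n Hst ltac:(lia)); lra.
    + assert (H3 := dneg n (Hmid n H1 H2)).
      assert (gap n <= 0); [|nra].
      unfold gap; destruct (Nat.eq_dec n s) as [->|Hne]; [lra|].
      assert (H := Cf s n t ltac:(lia) H2); lra.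
  - apply Rmult_le_pos; [|apply dpos, Hbelow; auto].
    assert (H := Cf n s t H1 Hst); unfold gap; lra. }
assert (Heq : moment d gap = (INR t - INR s) * moment d f).
{ rewrite (moment_ext d gap (fun n => (INR t - INR s) * f n
     - ((f t - f s) * INR n + (INR t * f s - INR s * f t)))).
  2:{ intros n; unfold gap; ring. }
  rewrite moment_minus; [| intros g Tg; now apply Ed | tame | tame].
  rewrite moment_scal, moment_plus; [| intros g Tg; now apply Ed | tame | tame].
  rewrite moment_scal, moment_const, D0, D1; ring. }
rewrite Heq in Hgap; apply Rnot_lt_le; intros Hlt; nra.
Qed.

(** * Dominated convergence for series *)

Lemma Series_tail_small (M : nat -> R) eps : ex_series M -> 0 < eps ->
  exists N, (0 < N)%nat /\ Series (fun k => M (N + k)%nat) < eps.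
Proof.
intros HM Heps.
assert (H : is_lim_seq (sum_n M) (Series M)) by exact (Series_correct M HM).
apply is_lim_seq_spec in H; destruct (H (mkposreal eps Heps)) as [N HN].
exists (S N); split; [lia|].
specialize (HN N (le_n N)); simpl in HN.
rewrite (Series_incr_n M (S N) (Nat.lt_0_succ N) HM) in HN.
rewrite <- sum_n_Reals in HN; simpl pred in HN.
apply Rabs_def2 in HN; lra.
Qed.

(** Continuity of moments in all parameters at once, as well as their limits along
    any filter, come from this form of dominated convergence. *)
Lemma Series_dominated {T : Type} (F : (T -> Prop) -> Prop) {FF : Filter F}
  (u : T -> nat -> R) (l M : nat -> R) :
  (forall n, filterlim (fun t => u t n) F (locally (l n))) ->
  (forall n, Rabs (l n) <= M n) ->
  F (fun t => forall n, Rabs (u t n) <= M n) -> ex_series M ->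
  filterlim (fun t => Series (u t)) F (locally (Series l)).
Proof.
intros Hlim Hl Hu HM.
assert (HexA : forall v, (forall n, Rabs (v n) <= M n) ->
  ex_series (fun n => Rabs (v n))).
{ intros v Hv; apply (ex_series_le (K := R_AbsRing) (V := R_CompleteNormedModule)) with M; auto.
  intros n; change norm with Rabs; simpl; rewrite Rabs_Rabsolu; auto. }
assert (Htail : forall v N, (forall n, Rabs (v n) <= M n) ->
  Rabs (Series (fun k => v (N + k)%nat)) <= Series (fun k => M (N + k)%nat)).
{ intros v N Hv.
  eapply Rle_trans; [apply Series_Rabs|].
  - apply (ex_series_incr_n (fun n => Rabs (v n)) N), HexA, Hv.
  - apply Series_le; [intros n; split; [apply Rabs_pos|auto]|].
    now apply ex_series_incr_n. }
apply filterlim_locally; intros eps.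
destruct (Series_tail_small M (eps / 3)) as [N [HN0 HN]]; [auto| |].
{ apply Rdiv_lt_0_compat; [apply cond_pos|lra]. }
assert (Hsum : filterlim (fun t => sum_f_R0 (u t) (pred N)) F
  (locally (sum_f_R0 l (pred N)))).
{ clear - FF Hlim; induction (pred N) as [|n IH]; simpl; auto.
  apply (filterlim_comp_2 (G := locally (sum_f_R0 l n)) (H := locally (l (S n)))
     (fun t => sum_f_R0 (u t) n) (fun t => u t (S n)) Rplus); auto.
  apply (filterlim_plus (K := R_AbsRing) (V := R_NormedModule)). }
assert (He3 : 0 < eps / 3) by (apply Rdiv_lt_0_compat; [apply cond_pos|lra]).
assert (Hs := proj1 (filterlim_locally _ _) Hsum (mkposreal _ He3)).
generalize (filter_and _ _ Hs Hu); apply filter_imp; intros t [Ht1 Ht2].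
change (Rabs (Series (u t) - Series l) < eps).
change (Rabs (sum_f_R0 (u t) (pred N) - sum_f_R0 l (pred N)) < eps / 3) in Ht1.
rewrite (Series_incr_n (u t) N), (Series_incr_n l N); auto;
  try (apply ex_series_Rabs, HexA; auto).
assert (H1 := Htail (u t) N Ht2); assert (H2 := Htail l N Hl).
apply Rabs_def2 in Ht1.
apply Rabs_le_between in H1; apply Rabs_le_between in H2.
apply Rabs_def1; lra.
Qed.

(** * The weights *)

Fixpoint quad_prod (kap : R) (n : nat) : R :=
  match n with
  | O => 1
  | S m => quad_prod kap m * ((INR m + 1) ^ 2 + kap)
  end.

(** Up to a common factor, [1 + sum_n coef (k ^ 2) n * x ^ (n + 1)] is the product
    [I_{ik}(r) I_{-ik}(r)] at [x = r ^ 2 / 4].  The constant term 1 is left out, so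
    that index [n] carries the coefficient of degree [n + 1]. *)
Definition coef (kap : R) (n : nat) : R :=
  INR (fact (2 * n + 2)) / (INR (fact (n + 1)) ^ 2 * quad_prod kap (n + 1)).

Definition wt (kap x : R) (n : nat) : R := coef kap n * x ^ n.

Lemma quad_pos n kap : 0 <= kap -> 0 < (INR n + 1) ^ 2 + kap.
Proof. intros Hk; assert (H := pos_INR n); nra. Qed.

Lemma quad_prod_pos kap n : 0 <= kap -> 0 < quad_prod kap n.
Proof.
intros Hk; induction n as [|n IH]; simpl quad_prod; [lra|].
apply Rmult_lt_0_compat; [auto | now apply quad_pos].
Qed.

Lemma fact_pos n : 0 < INR (fact n).
Proof. apply lt_0_INR, lt_O_fact. Qed.

Lemma coef_pos kap n : 0 <= kap -> 0 < coef kap n.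
Proof.
intros Hk; unfold coef; apply Rdiv_lt_0_compat; [apply fact_pos|].
apply Rmult_lt_0_compat; [apply pow_lt, fact_pos | now apply quad_prod_pos].
Qed.

Lemma fact_S_INR n : INR (fact (S n)) = (INR n + 1) * INR (fact n).
Proof. rewrite fact_simpl, mult_INR, S_INR; ring. Qed.

Definition step (kap : R) (n : nat) : R :=
  2 * (2 * INR n + 3) / ((INR n + 2) * ((INR n + 2) ^ 2 + kap)).

Lemma coef_S kap n : 0 <= kap -> coef kap (S n) = coef kap n * step kap n.
Proof.
intros Hk; unfold coef, step.
replace (2 * S n + 2)%nat with (S (S (2 * n + 2))) by lia.
replace (S n + 1)%nat with (S (n + 1)) by lia.
simpl quad_prod; rewrite !fact_S_INR, S_INR, !plus_INR, mult_INR; simpl (INR 1); simpl (INR 2).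
assert (H := quad_prod_pos kap (n + 1) Hk).
assert (H1 := fact_pos (n + 1)).
assert (H2 := pos_INR n).
field; repeat split; nra.
Qed.

Lemma coef_0 kap : 0 <= kap -> coef kap 0 = 2 / (1 + kap).
Proof. intros Hk; unfold coef; simpl; field; lra. Qed.

Lemma step_pos kap n : 0 <= kap -> 0 < step kap n.
Proof.
intros Hk; unfold step; assert (H := pos_INR n).
apply Rdiv_lt_0_compat; [lra | apply Rmult_lt_0_compat; nra].
Qed.

Lemma step_decr kap kap' n : 0 <= kap -> kap < kap' -> step kap' n < step kap n.
Proof.
intros Hk Hk'; unfold step, Rdiv; assert (H := pos_INR n).
apply Rmult_lt_compat_l; [lra|].
apply Rinv_lt_contravar.
- repeat apply Rmult_lt_0_compat; nra.
- apply Rmult_lt_compat_l; lra.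
Qed.

Lemma coef_decr kap kap' n : 0 <= kap -> kap <= kap' -> coef kap' n <= coef kap n.
Proof.
intros Hk [Hk'| ->]; [|lra].
induction n as [|n IH].
- rewrite !coef_0 by lra; unfold Rdiv; apply Rmult_le_compat_l; [lra|].
  apply Rinv_le_contravar; lra.
- rewrite !coef_S by lra; apply Rmult_le_compat; auto.
  + apply Rlt_le, coef_pos; lra.
  + apply Rlt_le, step_pos; lra.
  + apply Rlt_le, step_decr; lra.
Qed.

Lemma step_lim kap : 0 <= kap -> is_lim_seq (step kap) 0.
Proof.
intros Hk.
apply is_lim_seq_le_le with (u := fun _ => 0) (w := fun n => 4 * / (INR n + 1)).
- intros n; split; [now apply Rlt_le, step_pos|].
  assert (H := pos_INR n).
  unfold step; apply Rmult_le_reg_r with ((INR n + 1) * ((INR n + 2) * ((INR n + 2) ^ 2 + kap))).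
  { repeat apply Rmult_lt_0_compat; nra. }
  field_simplify; [nra | lra | split; nra].
- apply is_lim_seq_const.
- replace (Finite 0) with (Rbar_mult 4 0) by (simpl; f_equal; ring).
  apply is_lim_seq_scal_l.
  apply is_lim_seq_ext with (fun n => / INR (S n)); [intros; now rewrite S_INR|].
  replace (Finite 0) with (Rbar_inv p_infty) by reflexivity.
  apply is_lim_seq_inv; [|discriminate].
  apply -> is_lim_seq_incr_1; apply is_lim_seq_INR.
Qed.

Lemma ex_series_wt kap x : 0 <= kap -> ex_series (fun n => Rabs (wt kap x n)).
Proof.
intros Hk; destruct (Req_dec x 0) as [->|Hx].
- apply (ex_series_incr_1 (K := R_AbsRing) (V := R_NormedModule)).
  exists 0; apply is_series_ext with (fun _ => 0).
  + intros n; unfold wt; rewrite pow_i by lia; now rewrite Rmult_0_r, Rabs_R0.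
  + assert (H : is_lim_seq (sum_n (fun _ : nat => 0)) 0); [|exact H].
    apply is_lim_seq_ext with (fun _ => 0); [|apply is_lim_seq_const].
    intros n; rewrite sum_n_const; ring.
- apply ex_series_DAlembert with 0; [lra | |].
  + intros n; unfold wt; apply Rmult_integral_contrapositive_currified.
    * apply Rgt_not_eq, coef_pos, Hk.
    * now apply pow_nonzero.
  + apply is_lim_seq_ext with (fun n => step kap n * Rabs x).
    * intros n; unfold wt; rewrite coef_S by auto.
      assert (H := coef_pos kap n Hk); assert (H' := step_pos kap n Hk).
      replace (coef kap n * step kap n * x ^ S n / (coef kap n * x ^ n))
        with (step kap n * x).
      { now rewrite Rabs_mult, (Rabs_pos_eq (step kap n)) by lra. }
      simpl; field; split; [now apply pow_nonzero | lra].
    * replace (Finite 0) with (Rbar_mult 0 (Rabs x)) by (simpl; f_equal; ring).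
      apply is_lim_seq_scal_r, step_lim, Hk.
Qed.

Lemma wt_Rabs_summable kap x f : 0 <= kap -> tame f ->
  ex_series (fun n => Rabs (f n) * Rabs (wt kap x n)).
Proof.
intros Hk (C & q & HC & Hq & Hf).
apply (ex_series_le (K := R_AbsRing) (V := R_CompleteNormedModule))
  with (fun n => C * Rabs (wt kap (q * x) n)).
- intros n; change norm with Rabs; simpl.
  rewrite Rabs_mult, !Rabs_Rabsolu; unfold wt; rewrite Rpow_mult_distr, !Rabs_mult.
  specialize (Hf n); rewrite (Rabs_pos_eq (q ^ n)) by (apply pow_le; lra).
  replace (C * (Rabs (coef kap n) * (q ^ n * Rabs (x ^ n))))
    with ((C * q ^ n) * (Rabs (coef kap n) * Rabs (x ^ n))) by ring.
  apply Rmult_le_compat_r; auto.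
  apply Rmult_le_pos; apply Rabs_pos.
- apply (ex_series_scal_l (K := R_AbsRing) (V := R_NormedModule)).
  now apply ex_series_wt.
Qed.

Lemma wt_summing kap x : 0 <= kap -> summing (wt kap x).
Proof.
intros Hk f Hf; apply ex_series_Rabs.
apply ex_series_ext with (fun n => Rabs (f n) * Rabs (wt kap x n)).
- intros n; now rewrite Rabs_mult.
- now apply wt_Rabs_summable.
Qed.

Lemma wt_weight kap x : 0 <= kap -> 0 < x -> weight (wt kap x).
Proof.
intros Hk Hx; split; [|now apply wt_summing].
intros n; apply Rmult_lt_0_compat; [now apply coef_pos | now apply pow_lt].
Qed.

Lemma weight_mult w g : weight w -> tame g -> (forall n, 0 < g n) ->
  weight (fun n => g n * w n).
Proof.
intros [Hw Hs] Tg Hg; split.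
- intros n; now apply Rmult_lt_0_compat.
- intros f Tf; apply ex_series_ext with (fun n => (f n * g n) * w n).
  + intros n; change (f n * g n * w n = f n * (g n * w n)); ring.
  + apply Hs; tame.
Qed.

Lemma moment_at_0 kap f : moment (wt kap 0) f = f 0%nat * coef kap 0.
Proof.
unfold moment, wt; rewrite (Series_ext _ (fun n => (f n * coef kap n) * 0 ^ n)).
2:{ intros; ring. }
apply (PSeries_0 (fun n => f n * coef kap n)).
Qed.

Lemma expect_at_0 kap f : 0 <= kap -> expect (wt kap 0) f = f 0%nat.
Proof.
intros Hk; unfold expect; rewrite !moment_at_0.
assert (H := coef_pos kap 0 Hk); field; lra.
Qed.

Lemma coef_filterlim {T : Type} (F : (T -> Prop) -> Prop) {FF : Filter F}
  (kap : T -> R) (kap0 : R) n :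
  F (fun t => 0 <= kap t) -> 0 <= kap0 -> filterlim kap F (locally kap0) ->
  filterlim (fun t => coef (kap t) n) F (locally (coef kap0 n)).
Proof.
intros Hp H0 Hlim.
apply (filterlim_comp _ _ _ kap (fun k => coef k n) F (locally kap0) _ Hlim).
change (continuous (fun k => coef k n) kap0).
apply (ex_derive_continuous (K := R_AbsRing) (V := R_NormedModule)).
assert (Hq : forall m, ex_derive (fun k => quad_prod k m) kap0).
{ induction m as [|m IH]; simpl quad_prod; [apply ex_derive_const|].
  apply (ex_derive_mult (fun k => quad_prod k m) (fun k => (INR m + 1) ^ 2 + k)); auto.
  auto_derive; auto. }
unfold coef.
apply (ex_derive_div (fun _ => INR (fact (2 * n + 2)))
  (fun k => INR (fact (n + 1)) ^ 2 * quad_prod k (n + 1))).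
- apply ex_derive_const.
- apply (ex_derive_mult (fun _ => INR (fact (n + 1)) ^ 2)).
  + apply ex_derive_const.
  + apply Hq.
- apply Rgt_not_eq, Rmult_lt_0_compat;
    [apply pow_lt, fact_pos | now apply quad_prod_pos].
Qed.

Lemma filterlim_Rmult {T : Type} (F : (T -> Prop) -> Prop) {FF : Filter F}
  (f g : T -> R) a b :
  filterlim f F (locally a) -> filterlim g F (locally b) ->
  filterlim (fun t => f t * g t) F (locally (a * b)).
Proof.
intros Hf Hg.
apply (filterlim_comp_2 (G := locally a) (H := locally b) f g Rmult); auto.
apply (filterlim_mult (K := R_AbsRing)).
Qed.

Lemma moment_filterlim {T : Type} (F : (T -> Prop) -> Prop) {FF : Filter F}
  (kap x : T -> R) (kap0 x0 : R) f :
  tame f -> F (fun t => 0 <= kap t) -> 0 <= kap0 ->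
  filterlim kap F (locally kap0) -> filterlim x F (locally x0) ->
  filterlim (fun t => moment (wt (kap t) (x t)) f) F
    (locally (moment (wt kap0 x0) f)).
Proof.
intros Tf Hp H0 Hk Hx.
apply Series_dominated with
  (M := fun n => Rabs (f n) * Rabs (wt 0 (Rabs x0 + 1) n)); auto.
- intros n; apply (filterlim_Rmult F (fun _ => f n)); [apply filterlim_const|].
  apply (filterlim_Rmult F (fun t => coef (kap t) n)); [now apply coef_filterlim|].
  clear - FF Hx; induction n as [|n IH]; simpl; [apply filterlim_const|].
  now apply filterlim_Rmult.
- intros n; rewrite Rabs_mult; apply Rmult_le_compat_l; [apply Rabs_pos|].
  unfold wt; rewrite !Rabs_mult, <- !RPow_abs.
  rewrite !(Rabs_pos_eq (coef _ n)) by (apply Rlt_le, coef_pos; lra).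
  apply Rmult_le_compat; try (apply Rlt_le, coef_pos; lra).
  + apply pow_le, Rabs_pos.
  + apply coef_decr; lra.
  + apply pow_incr; split; [apply Rabs_pos|].
    rewrite (Rabs_pos_eq (Rabs x0 + 1)); [lra|]. assert (H := Rabs_pos x0); lra.
- assert (Hb := proj1 (filterlim_locally _ _) Hx (mkposreal 1 Rlt_0_1)).
  generalize (filter_and _ _ Hp Hb); apply filter_imp; intros t [Ht1 Ht2] n.
  change (Rabs (x t - x0) < 1) in Ht2.
  rewrite Rabs_mult; apply Rmult_le_compat_l; [apply Rabs_pos|].
  unfold wt; rewrite !Rabs_mult, <- !RPow_abs.
  rewrite !(Rabs_pos_eq (coef _ n)) by (apply Rlt_le, coef_pos; lra).
  apply Rmult_le_compat; try (apply Rlt_le, coef_pos; lra).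
  + apply pow_le, Rabs_pos.
  + apply coef_decr; lra.
  + apply pow_incr; split; [apply Rabs_pos|].
    assert (H := Rabs_pos x0); rewrite (Rabs_pos_eq (Rabs x0 + 1)) by lra.
    assert (H2 := Rabs_triang (x t - x0) x0).
    replace (x t - x0 + x0) with (x t) in H2 by ring; lra.
- now apply wt_Rabs_summable; [lra|].
Qed.

Lemma moment_derive kap x f : 0 <= kap -> tame f -> x <> 0 ->
  is_derive (fun x => moment (wt kap x) f) x
    (moment (wt kap x) (fun n => INR n * f n) / x).
Proof.
intros Hk Tf Hx.
set (a := fun n => f n * coef kap n).
assert (Hser : forall z, ex_series (fun n => a n * z ^ n)).
{ intros z; apply ex_series_ext with (fun n => f n * wt kap z n).
  - intros n; unfold a, wt; change ((f n * (coef kap n * z ^ n)) = f n * coef kap n * z ^ n); ring.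
  - now apply wt_summing. }
assert (HR : Rbar_lt (Rabs x) (CV_radius a)).
{ apply Rbar_lt_le_trans with (Finite (Rabs (Rabs x + 1))).
  - simpl; assert (H := Rabs_pos x); rewrite (Rabs_pos_eq (Rabs x + 1)); lra.
  - apply Rbar_not_lt_le; intros H; apply (CV_disk_outside _ _ H).
    apply (ex_series_lim_0 _ (Hser (Rabs x + 1))). }
apply (is_derive_ext (PSeries a)).
{ intros z; unfold PSeries, moment; apply Series_ext; intros n; unfold a, wt; ring. }
replace (moment (wt kap x) (fun n => INR n * f n) / x) with (PSeries (PS_derive a) x).
{ now apply is_derive_PSeries. }
apply Rmult_eq_reg_l with x; auto.
rewrite <- PSeries_incr_1.
replace (x * (moment (wt kap x) (fun n => INR n * f n) / x))
  with (moment (wt kap x) (fun n => INR n * f n)) by (field; auto).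
apply Series_ext; intros [|n]; unfold PS_incr_1, PS_derive, a, wt; simpl;
  [change (0 * 1 = 0 * f 0%nat * (coef kap 0 * 1)); ring | ring].
Qed.

Lemma wt_ratio_x kap x x' n : 0 <= kap -> 0 < x ->
  wt kap x' n / wt kap x n = (x' / x) ^ n.
Proof.
intros Hk Hx; unfold wt, Rdiv; rewrite Rpow_mult_distr, pow_inv.
assert (H := coef_pos kap n Hk); assert (H' := pow_lt x n Hx); field; lra.
Qed.

(** Increasing [x] tilts the weights towards large indices.  The factor [g]
    covers both the plain and the size-biased expectation. *)
Lemma expect_increasing_x kap g f x x' :
  0 <= kap -> tame g -> (forall n, 0 < g n) -> tame f ->
  (forall n, f n < f (S n)) -> 0 <= x -> x < x' ->
  expect (fun n => g n * wt kap x n) f < expect (fun n => g n * wt kap x' n) f.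
Proof.
intros Hk Tg Hg Tf Hf [Hx|<-] Hx'.
- apply expect_likelihood_ratio; auto; try (apply weight_mult; auto; apply wt_weight; lra).
  intros n; assert (H1 := Hg n); assert (H2 := Hg (S n)).
  assert (Hw := wt_weight kap x Hk Hx).
  assert (H3 := proj1 Hw n); assert (H4 := proj1 Hw (S n)).
  replace (g n * wt kap x' n / (g n * wt kap x n)) with (wt kap x' n / wt kap x n)
    by (field; lra).
  replace (g (S n) * wt kap x' (S n) / (g (S n) * wt kap x (S n)))
    with (wt kap x' (S n) / wt kap x (S n)) by (field; lra).
  rewrite !wt_ratio_x by auto.
  assert (1 < x' / x).
  { apply Rmult_lt_reg_r with x; auto; unfold Rdiv; rewrite Rmult_assoc, Rinv_l; lra. }
  assert (0 < (x' / x) ^ n) by (apply pow_lt; lra).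
  simpl; nra.
- assert (Hw := weight_mult _ _ (wt_weight kap x' Hk Hx') Tg Hg).
  assert (E0 : expect (fun n => g n * wt kap 0 n) f = f 0%nat).
  { unfold expect, moment.
    rewrite (Series_ext (fun n => f n * (g n * wt kap 0 n))
      (fun n => (f n * g n) * wt kap 0 n)) by (intros; ring).
    rewrite (Series_ext (fun n => 1 * (g n * wt kap 0 n))
      (fun n => g n * wt kap 0 n)) by (intros; ring).
    change (moment (wt kap 0) (fun n => f n * g n) / moment (wt kap 0) g = f 0%nat).
    rewrite !moment_at_0; assert (H := coef_pos kap 0 Hk); specialize (Hg 0%nat).
    field; lra. }
  rewrite E0; apply expect_lt; auto.
  assert (Hfs := increasing_seq_lt f Hf).
  apply moment_pos; auto; [tame | | exists 1%nat; specialize (Hf 0%nat); lra].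
  intros [|n]; [lra|]; specialize (Hfs 0%nat (S n) ltac:(lia)); lra.
Qed.

Lemma expect_mult_1 w f : expect (fun n => 1 * w n) f = expect w f.
Proof.
unfold expect, moment.
rewrite (Series_ext (fun n => f n * (1 * w n)) (fun n => f n * w n)) by (intros; ring).
now rewrite (Series_ext (fun n => 1 * (1 * w n)) (fun n => 1 * w n)) by (intros; ring).
Qed.

Definition mean (kap x : R) : R := expect (wt kap x) (fun n => INR n + 1).

Lemma mean_increasing_x kap x x' : 0 <= kap -> 0 <= x -> x < x' ->
  mean kap x < mean kap x'.
Proof.
intros Hk Hx Hx'; unfold mean.
rewrite <- (expect_mult_1 (wt kap x)), <- (expect_mult_1 (wt kap x')).
apply expect_increasing_x; auto; [tame | intros; lra | tame | intros n; rewrite S_INR; lra].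
Qed.

Lemma mean_at_0 kap : 0 <= kap -> mean kap 0 = 1.
Proof. intros Hk; unfold mean; rewrite expect_at_0 by auto; simpl; ring. Qed.

Lemma mean_ge_1 kap x : 0 <= kap -> 0 <= x -> 1 <= mean kap x.
Proof.
intros Hk [Hx|<-]; [|rewrite mean_at_0; lra].
rewrite <- (mean_at_0 kap Hk); apply Rlt_le, mean_increasing_x; lra.
Qed.

(** The quotient of the coefficients of index [n] for two values of [kap] is a
    product of [n + 1] factors below 1, hence decreasing in [n]. *)
Lemma mean_decreasing_kap kap kap' x : 0 <= kap -> kap < kap' -> 0 < x ->
  mean kap' x < mean kap x.
Proof.
intros Hk Hk' Hx; unfold mean.
apply expect_likelihood_ratio; try (apply wt_weight; lra); [tame | intros n; rewrite S_INR; lra |].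
intros n; unfold wt.
assert (Hc := coef_pos kap n Hk). assert (Hc' := coef_pos kap' n ltac:(lra)).
assert (Hs := step_pos kap' n ltac:(lra)).
assert (Hp := pow_lt x n Hx).
assert (Hd := step_decr kap kap' n Hk Hk').
rewrite !coef_S by lra; simpl.
replace (coef kap n * step kap n * (x * x ^ n) / (coef kap' n * step kap' n * (x * x ^ n)))
  with ((coef kap n / coef kap' n) * (step kap n / step kap' n)) by (field; repeat split; lra).
replace (coef kap n * x ^ n / (coef kap' n * x ^ n)) with (coef kap n / coef kap' n)
  by (field; split; lra).
assert (0 < coef kap n / coef kap' n) by (apply Rdiv_lt_0_compat; lra).
assert (1 < step kap n / step kap' n).
{ apply Rmult_lt_reg_r with (step kap' n); auto.
  unfold Rdiv; rewrite Rmult_assoc, Rinv_l; lra. }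
nra.
Qed.

Lemma mean_nonincreasing_kap kap kap' x : 0 <= kap -> kap <= kap' -> 0 <= x ->
  mean kap' x <= mean kap x.
Proof.
intros Hk [Hk'| ->] [Hx|<-]; try lra.
- apply Rlt_le, mean_decreasing_kap; lra.
- rewrite !mean_at_0; lra.
Qed.

Lemma moment_1_pos kap x : 0 <= kap -> 0 <= x -> 0 < moment (wt kap x) (fun _ => 1).
Proof.
intros Hk [Hx|<-]; [apply mass_pos, wt_weight; auto|].
rewrite moment_at_0; assert (H := coef_pos kap 0 Hk); lra.
Qed.

Lemma expect_filterlim {T : Type} (F : (T -> Prop) -> Prop) {FF : Filter F}
  (kap x : T -> R) (kap0 x0 : R) f :
  tame f -> F (fun t => 0 <= kap t) -> 0 <= kap0 -> 0 <= x0 ->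
  filterlim kap F (locally kap0) -> filterlim x F (locally x0) ->
  filterlim (fun t => expect (wt (kap t) (x t)) f) F
    (locally (expect (wt kap0 x0) f)).
Proof.
intros Tf Hp H0 Hx0 Hk Hx; unfold expect, Rdiv.
apply filterlim_Rmult; auto; [now apply moment_filterlim|].
assert (H := moment_1_pos kap0 x0 H0 Hx0).
apply (filterlim_comp _ _ _ _ Rinv _ (locally (moment (wt kap0 x0) (fun _ => 1)))).
- apply moment_filterlim; auto; tame.
- apply (continuous_Rinv (moment (wt kap0 x0) (fun _ => 1))); lra.
Qed.

(** If the mean stayed below [N], the weight [x ^ (N + 1)] would have to be
    compensated by powers of [x] of exponent less than [N]. *)
Lemma mean_unbounded kap (B : R) : 0 <= kap -> exists x, 0 < x /\ B < mean kap x.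
Proof.
intros Hk.
destruct (archimed_cor1 (/ (Rabs B + 1))) as [N0 [HN0 HN0']].
{ apply Rinv_0_lt_compat; assert (H := Rabs_pos B); lra. }
assert (HB : B < INR N0).
{ assert (HP := lt_0_INR _ HN0').
  apply Rinv_lt_cancel in HN0; auto.
  assert (H := Rle_abs B); lra. }
set (N := N0).
set (S1 := moment (wt kap 1) (fun _ => 1)).
assert (HS1 := moment_1_pos kap 1 Hk Rle_0_1); fold S1 in HS1.
assert (Hc := coef_pos kap (S N) Hk).
assert (HNp := lt_0_INR _ HN0'); fold N in HNp.
(* For this [x] the term of index [N + 1] exceeds the sum of all the negative
   ones, which is at most [INR N * x ^ N * S1] in absolute value. *)
set (x := 1 + INR N * S1 / coef kap (S N)).
assert (Hx1 : 1 < x).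
{ unfold x; assert (0 < INR N * S1 / coef kap (S N)); [|lra].
  apply Rdiv_lt_0_compat; [nra|auto]. }
exists x; split; [lra|].
apply Rlt_trans with (INR N); [exact HB|].
assert (Hw := wt_weight kap x Hk ltac:(lra)).
apply expect_lt; auto; [tame|].
set (h := fun n => (INR n + 1 - INR N) * wt kap x n + INR N * x ^ N * (1 * wt kap 1 n)).
assert (Hex1 : ex_series (fun n => (INR n + 1 - INR N) * wt kap x n))
  by (apply Hw; tame).
assert (Hex2 : ex_series (fun n => INR N * x ^ N * (1 * wt kap 1 n))).
{ apply (ex_series_scal_l (K := R_AbsRing) (V := R_NormedModule)).
  apply (wt_summing kap 1 Hk); tame. }
assert (Hser : Series h = moment (wt kap x) (fun n => INR n + 1 - INR N)
   + INR N * x ^ N * S1).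
{ unfold h; rewrite Series_plus, Series_scal_l; auto. }
assert (Hge : h (S N) <= Series h).
{ apply (Series_ge_term h (S N)).
  - now apply (ex_series_plus (K := R_AbsRing) (V := R_NormedModule)).
  - intros n; unfold h, wt.
    assert (Hcn := coef_pos kap n Hk).
    assert (Hxn := pow_lt x n ltac:(lra)). assert (HxN := pow_lt x N ltac:(lra)).
    rewrite pow1.
    destruct (le_lt_dec N n) as [Hle|Hlt].
    + apply le_INR in Hle.
      apply Rplus_le_le_0_compat.
      * apply Rmult_le_pos; [lra|nra].
      * apply Rmult_le_pos; [apply Rmult_le_pos; lra | lra].
    + assert (x ^ n <= x ^ N) by (apply Rle_pow; [lra|lia]).
      assert (Hn := pos_INR n).
      replace ((INR n + 1 - INR N) * (coef kap n * x ^ n) + INR N * x ^ N * (1 * (coef kap n * 1)))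
        with (coef kap n * ((INR n + 1) * x ^ n + INR N * (x ^ N - x ^ n))) by ring.
      apply Rmult_le_pos; [lra|].
      apply Rplus_le_le_0_compat; apply Rmult_le_pos; lra. }
assert (Hlow : INR N * x ^ N * S1 < h (S N)).
{ unfold h, wt.
  assert (HxN := pow_lt x N ltac:(lra)).
  rewrite pow1, S_INR; simpl pow.
  replace (INR N + 1 + 1 - INR N) with 2 by ring.
  assert (coef kap (S N) * x = coef kap (S N) + INR N * S1) by (unfold x; field; lra).
  replace (2 * (coef kap (S N) * (x * x ^ N))) with (2 * x ^ N * (coef kap (S N) * x)) by ring.
  rewrite H.
  assert (0 < INR N * S1) by nra.
  assert (0 < x ^ N * coef kap (S N)) by nra.
  assert (0 < x ^ N * (INR N * S1)) by nra.
  assert (0 < INR N * (x ^ N * coef kap (S N))) by nra.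
  rewrite Rmult_plus_distr_l.
  replace (INR N * x ^ N * (1 * (coef kap (S N) * 1)))
    with (INR N * (x ^ N * coef kap (S N))) by ring.
  replace (INR N * x ^ N * S1) with (x ^ N * (INR N * S1)) by ring.
  lra. }
rewrite Hser in Hge; lra.
Qed.

(** * Monotonicity along the curve of constant argument *)

(** Up to the same common factor, twice [I_{ik}(r) I_{-ik}(r)], constant term
    included: the factor in front of [coef kap n] turns it into twice the coefficient
    of degree [n]. *)
Definition stiff_num (kap x : R) : R :=
  moment (wt kap x) (fun n => (INR n + 1) * ((INR n + 1) ^ 2 + kap) / odd n).

(** The quotient [r / (2 Re M(k, r))], for [kap = k ^ 2] and [x = r ^ 2 / 4]. *)
Definition stiff (kap x : R) : R :=
  stiff_num kap x / moment (wt kap x) (fun n => INR n + 1).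

(** On the curve where the mean is proportional to [k], four times [stiff] is the
    sum of [spread] and [T ^ 2 * drift]; these only depend on the expectations of
    [y], [y ^ 2] and [1 / y]. *)
Definition spread (w : nat -> R) : R :=
  (expect w (fun n => odd n ^ 2) + 3 * expect w odd + 3 + expect w (fun n => / odd n))
  / (expect w odd + 1).

Definition drift (w : nat -> R) : R :=
  (expect w odd + 1) * (1 + expect w (fun n => / odd n)).

Lemma odd_pos n : 0 < odd n.
Proof. assert (H := odd_ge_1 n); lra. Qed.

Lemma INR_odd n : INR n = (odd n - 1) / 2.
Proof. unfold odd; field. Qed.

Lemma moment_succ kap x : 0 <= kap ->
  moment (wt kap x) (fun n => INR n + 1)
  = (moment (wt kap x) odd + moment (wt kap x) (fun _ => 1)) / 2.
Proof.
intros Hk; assert (Hs := wt_summing kap x Hk).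
rewrite (moment_ext _ _ (fun n => / 2 * (odd n + 1))).
2:{ intros n; rewrite INR_odd; field. }
rewrite moment_scal, moment_plus; auto; [field | tame | tame].
Qed.

Lemma mean_odd kap x : 0 <= kap -> 0 <= x ->
  mean kap x = (expect (wt kap x) odd + 1) / 2.
Proof.
intros Hk Hx; unfold mean, expect; rewrite moment_succ by auto.
assert (H := moment_1_pos kap x Hk Hx); field; lra.
Qed.

Lemma stiff_expect kap x : 0 <= kap -> 0 <= x ->
  stiff kap x = spread (wt kap x) / 4
    + kap * (1 + expect (wt kap x) (fun n => / odd n)) / (expect (wt kap x) odd + 1).
Proof.
intros Hk Hx; assert (Hs := wt_summing kap x Hk).
assert (H := moment_1_pos kap x Hk Hx).
assert (Hm := mean_odd kap x Hk Hx). assert (Hm1 := mean_ge_1 kap x Hk Hx).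
unfold stiff, stiff_num, spread; rewrite moment_succ by auto.
rewrite (moment_ext _ _ (fun n => / 8 * (odd n ^ 2 + 3 * odd n + 3 * 1 + / odd n)
   + kap / 2 * (1 + / odd n))).
2:{ intros n; rewrite INR_odd; assert (Ho := odd_pos n); field; lra. }
rewrite moment_plus, !moment_scal, !moment_plus, !moment_scal; auto; try tame.
unfold expect in *.
set (S0 := moment (wt kap x) (fun _ => 1)) in *.
set (S1 := moment (wt kap x) odd) in *.
assert (0 < S1 + S0).
{ replace (S1 + S0) with ((S1 / S0 + 1) * S0) by (field; lra).
  apply Rmult_lt_0_compat; lra. }
field; repeat split; lra.
Qed.

(** On the curve [k ^ 2] is [T ^ 2] times the square of the mean, so that no
    parameter is left besides the weight itself. *)
Lemma stiff_on_curve T k x : 0 <= x -> k = T * mean (k ^ 2) x ->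
  stiff (k ^ 2) x = spread (wt (k ^ 2) x) / 4 + T ^ 2 * drift (wt (k ^ 2) x) / 4.
Proof.
intros Hx Hk; assert (Hk2 := pow2_ge_0 k).
rewrite stiff_expect by auto.
assert (Hm := mean_odd (k ^ 2) x Hk2 Hx). assert (Hm1 := mean_ge_1 (k ^ 2) x Hk2 Hx).
unfold drift. rewrite Hm in Hk, Hm1.
set (m := expect (wt (k ^ 2) x) odd) in *.
replace (k ^ 2 * (1 + expect (wt (k ^ 2) x) (fun n => / odd n)))
  with ((T * ((m + 1) / 2)) ^ 2 * (1 + expect (wt (k ^ 2) x) (fun n => / odd n)))
  by (rewrite <- Hk; reflexivity).
field; lra.
Qed.

(** As a size-biased expectation of a function increasing with the index, [spread]
    is monotone in [x]. *)
Lemma spread_size_biased kap x : 0 <= kap -> 0 <= x ->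
  spread (wt kap x) =
  expect (fun n => (INR n + 1) * wt kap x n) (fun n => odd n + 2 + / odd n).
Proof.
intros Hk Hx; assert (Hs := wt_summing kap x Hk).
assert (H := moment_1_pos kap x Hk Hx).
assert (Hm := mean_odd kap x Hk Hx). assert (Hm1 := mean_ge_1 kap x Hk Hx).
unfold spread, expect, moment in *.
rewrite (Series_ext (fun n => (odd n + 2 + / odd n) * ((INR n + 1) * wt kap x n))
  (fun n => (/ 2 * (odd n ^ 2 + 3 * odd n + 3 * 1 + / odd n)) * wt kap x n)).
2:{ intros n; rewrite INR_odd; assert (Ho := odd_pos n); field; lra. }
rewrite (Series_ext (fun n => 1 * ((INR n + 1) * wt kap x n))
  (fun n => (INR n + 1) * wt kap x n)) by (intros; ring).
fold (moment (wt kap x) (fun n => / 2 * (odd n ^ 2 + 3 * odd n + 3 * 1 + / odd n))).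
fold (moment (wt kap x) (fun n => INR n + 1)).
fold (moment (wt kap x) (fun n => odd n ^ 2)).
fold (moment (wt kap x) (fun n => / odd n)).
fold (moment (wt kap x) odd).
fold (moment (wt kap x) odd) in Hm.
fold (moment (wt kap x) (fun _ => 1)).
fold (moment (wt kap x) (fun _ => 1)) in Hm, H.
rewrite moment_succ, !moment_scal, !moment_plus, !moment_scal; auto; try tame.
set (S0 := moment (wt kap x) (fun _ => 1)) in *.
set (S1 := moment (wt kap x) odd) in *.
assert (0 < S1 + S0).
{ replace (S1 + S0) with ((S1 / S0 + 1) * S0) by (field; lra).
  apply Rmult_lt_0_compat; lra. }
field; repeat split; lra.
Qed.

Lemma spread_increasing_x kap x x' : 0 <= kap -> 0 <= x -> x < x' ->
  spread (wt kap x) < spread (wt kap x').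
Proof.
intros Hk Hx Hx'; rewrite !spread_size_biased by lra.
apply expect_increasing_x; auto; [tame | | tame |].
- intros n; assert (H := pos_INR n); lra.
- intros n; assert (H := odd_ge_1 n).
  assert (E : odd (S n) = odd n + 2) by (unfold odd; rewrite S_INR; ring).
  rewrite E; apply Rlt_0_minus.
  replace (odd n + 2 + 2 + / (odd n + 2) - (odd n + 2 + / odd n))
    with (2 * ((odd n ^ 2 + 2 * odd n - 1) / (odd n * (odd n + 2)))) by (field; lra).
  apply Rmult_lt_0_compat; [lra|].
  apply Rdiv_lt_0_compat; nra.
Qed.

(** With [m], [s], [e] the expectations of [y = 2 n - 1], [y ^ 2], [1 / y], the
    derivative of [(m + 1) (1 + e)] is proportional to
    [(s - m ^ 2) (1 + e) + (1 + m) (1 - m e)].  The lower bound for [s] is the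
    expectation of [(y - 1) (y - t) ^ 2 / y >= 0] at the best [t].  The conclusion
    is the same quantity in the form in which the differentiation produces it. *)
Lemma drift_derivative_sign m s e : e < 1 -> 0 < e ->
  (forall t, (2 * t + 1) * m - (t ^ 2 + 2 * t) + t ^ 2 * e <= s) ->
  0 <= (s - 1) * (1 + e) + (m + 1) * (m - e) - 2 * (m + 1) * (1 + e) * (m - 1).
Proof.
intros He He0 H; specialize (H ((m - 1) / (1 - e))).
set (b := (2 * ((m - 1) / (1 - e)) + 1) * m
   - (((m - 1) / (1 - e)) ^ 2 + 2 * ((m - 1) / (1 - e)))
   + ((m - 1) / (1 - e)) ^ 2 * e) in *.
assert (E : (b - 1) * (1 + e) + (m + 1) * (m - e) - 2 * (m + 1) * (1 + e) * (m - 1)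
   = 2 * (m * e - 1) ^ 2 / (1 - e)) by (unfold b; field; lra).
assert (0 <= 2 * (m * e - 1) ^ 2 / (1 - e)).
{ apply Rmult_le_pos; [assert (H1 := pow2_ge_0 (m * e - 1)); lra|].
  apply Rlt_le, Rinv_0_lt_compat; lra. }
assert ((b - 1) * (1 + e) <= (s - 1) * (1 + e)) by (apply Rmult_le_compat_r; lra).
lra.
Qed.

Lemma moment_derive_odd kap x f : 0 <= kap -> tame f -> x <> 0 ->
  is_derive (fun x => moment (wt kap x) f) x
    ((moment (wt kap x) (fun n => odd n * f n) - moment (wt kap x) f) / (2 * x)).
Proof.
intros Hk Tf Hx; assert (H := moment_derive kap x f Hk Tf Hx).
rewrite (moment_ext _ (fun n => INR n * f n) (fun n => / 2 * (odd n * f n - f n))) in H.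
2:{ intros n; rewrite INR_odd; field. }
rewrite moment_scal, moment_minus in H; [| now apply wt_summing | tame | tame].
replace ((moment (wt kap x) (fun n => odd n * f n) - moment (wt kap x) f) / (2 * x))
  with (/ 2 * (moment (wt kap x) (fun n => odd n * f n) - moment (wt kap x) f) / x)
  by (field; auto).
exact H.
Qed.

Lemma moment_continuous kap x f : 0 <= kap -> tame f ->
  continuous (fun x => moment (wt kap x) f) x.
Proof.
intros Hk Tf; apply (moment_filterlim (locally x) (fun _ => kap) (fun x => x)); auto.
- now apply filter_forall.
- apply filterlim_const.
- apply filterlim_id.
Qed.

Lemma drift_nondecreasing_x kap x x' : 0 <= kap -> 0 <= x -> x < x' ->
  drift (wt kap x) <= drift (wt kap x').
Proof.
intros Hk Hx Hx'.
set (S2 := fun x => moment (wt kap x) (fun n => odd n ^ 2)).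
set (S1 := fun x => moment (wt kap x) odd).
set (S0 := fun x => moment (wt kap x) (fun _ => 1)).
set (Se := fun x => moment (wt kap x) (fun n => / odd n)).
set (g := fun x => (S1 x + S0 x) * (S0 x + Se x) / S0 x ^ 2).
assert (P0 : forall z, 0 <= z -> 0 < S0 z) by (intros; now apply moment_1_pos).
assert (Hg : forall z, 0 <= z -> drift (wt kap z) = g z).
{ intros z Hz; assert (H := P0 z Hz); unfold drift, g, expect, S1, Se.
  fold (S0 z); field; lra. }
rewrite !Hg by lra.
set (dg := fun x => ((S2 x - S0 x) * (S0 x + Se x) * S0 x
   + (S1 x + S0 x) * (S1 x - Se x) * S0 x
   - 2 * (S1 x + S0 x) * (S0 x + Se x) * (S1 x - S0 x)) / S0 x ^ 3 / (2 * x)).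
destruct (MVT_gen g x x' dg) as [c [Hc Heq]].
- intros z Hz; rewrite Rmin_left, Rmax_right in Hz by lra.
  assert (Hp := P0 z ltac:(lra)).
  assert (D1 := moment_derive_odd kap z odd Hk tame_odd ltac:(lra)).
  assert (D0 := moment_derive_odd kap z (fun _ => 1) Hk (tame_const 1) ltac:(lra)).
  assert (De := moment_derive_odd kap z (fun n => / odd n) Hk tame_inv_odd ltac:(lra)).
  rewrite (moment_ext _ (fun n => odd n * odd n) (fun n => odd n ^ 2)) in D1 by (intros; ring).
  rewrite (moment_ext _ (fun n => odd n * 1) odd) in D0 by (intros; ring).
  rewrite (moment_ext _ (fun n => odd n * / odd n) (fun _ => 1)) in De
    by (intros n; assert (H := odd_pos n); field; lra).
  fold (S2 z) (S1 z) (S0 z) (Se z) in *.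
  change (is_derive S1 z ((S2 z - S1 z) / (2 * z))) in D1.
  change (is_derive S0 z ((S1 z - S0 z) / (2 * z))) in D0.
  change (is_derive Se z ((S0 z - Se z) / (2 * z))) in De.
  unfold g.
  auto_derive.
  + repeat split; try (eexists; eassumption).
    intros H; rewrite Rmult_1_r in H; nra.
  + apply is_derive_unique in D1, D0, De.
    change (Derive (fun x => S1 x) z = (S2 z - S1 z) / (2 * z)) in D1.
    change (Derive (fun x => S0 x) z = (S1 z - S0 z) / (2 * z)) in D0.
    change (Derive (fun x => Se x) z = (S0 z - Se z) / (2 * z)) in De.
    rewrite D1, D0, De.
    unfold dg; field; lra.
- intros z Hz; rewrite Rmin_left, Rmax_right in Hz by lra.
  assert (Hp := P0 z ltac:(lra)).
  assert (C1 : continuous S1 z) by (apply moment_continuous; auto; tame).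
  assert (C0 : continuous S0 z) by (apply moment_continuous; auto; tame).
  assert (Ce : continuous Se z) by (apply moment_continuous; auto; tame).
  apply continuity_pt_filterlim; unfold g, Rdiv.
  change (continuous (fun x => (S1 x + S0 x) * (S0 x + Se x) * / S0 x ^ 2) z).
  apply (continuous_mult (K := R_AbsRing)).
  + apply (continuous_mult (K := R_AbsRing)); apply (continuous_plus (V := R_NormedModule)); auto.
  + apply continuous_comp.
    * apply (continuous_mult (K := R_AbsRing)); auto.
      apply (continuous_mult (K := R_AbsRing)); auto.
      apply continuous_const.
    * apply continuous_Rinv; nra.
- rewrite Rmin_left, Rmax_right in Hc by lra.
  assert (Hpos : 0 <= dg c); [|nra].
  destruct (Req_dec c 0) as [->|Hc0].
  { unfold dg, Rdiv; rewrite Rmult_0_r, Rinv_0, Rmult_0_r; lra. }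
  assert (Hcp : 0 < c) by lra.
  assert (Hw := wt_weight kap c Hk Hcp).
  assert (Hp := P0 c ltac:(lra)).
  set (m := S1 c / S0 c). set (s := S2 c / S0 c). set (e := Se c / S0 c).
  replace (dg c) with (((s - 1) * (1 + e) + (m + 1) * (m - e)
    - 2 * (m + 1) * (1 + e) * (m - 1)) / (2 * c)).
  2:{ unfold dg, m, s, e; field; lra. }
  apply Rmult_le_pos; [|apply Rlt_le, Rinv_0_lt_compat; lra].
  apply drift_derivative_sign.
  + apply Rmult_lt_reg_r with (S0 c); auto.
    unfold e, Rdiv; rewrite Rmult_assoc, Rinv_l by lra.
    assert (H : 0 < moment (wt kap c) (fun n => 1 - / odd n)).
    { apply moment_pos; auto; [tame | | exists 1%nat].
      - intros n; assert (H := odd_ge_1 n).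
        assert (/ odd n <= / 1) by (apply Rinv_le_contravar; lra).
        rewrite Rinv_1 in H0; lra.
      - unfold odd; simpl; lra. }
    rewrite moment_minus in H; [| apply Hw | tame | tame].
    unfold S0, Se; lra.
  + apply Rdiv_lt_0_compat; auto.
    apply moment_pos; auto; [tame | |exists 0%nat];
    intros; [apply Rlt_le|]; apply Rinv_0_lt_compat, odd_pos.
  + intros t.
    assert (H : 0 <= moment (wt kap c) (fun n => (odd n - 1) * (odd n - t) ^ 2 * / odd n)).
    { apply moment_nonneg; auto; [tame|].
      intros n; assert (H := odd_ge_1 n); assert (H1 := pow2_ge_0 (odd n - t)).
      assert (0 < / odd n) by (apply Rinv_0_lt_compat; lra).
      apply Rmult_le_pos; [apply Rmult_le_pos; lra | lra]. }
    rewrite (moment_ext _ _ (fun n => (odd n ^ 2 - (2 * t + 1) * odd n)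
      + ((t ^ 2 + 2 * t) * 1 - t ^ 2 * / odd n))) in H.
    2:{ intros n; assert (Ho := odd_pos n); field; lra. }
    rewrite moment_plus, !moment_minus, !moment_scal in H; try (apply Hw); try tame.
    fold (S2 c) (S0 c) in H.
    change (moment (wt kap c) odd) with (S1 c) in H.
    change (moment (wt kap c) (fun n => / odd n)) with (Se c) in H.
    apply Rmult_le_reg_r with (S0 c); auto.
    replace (((2 * t + 1) * m - (t ^ 2 + 2 * t) + t ^ 2 * e) * S0 c)
      with ((2 * t + 1) * S1 c - (t ^ 2 + 2 * t) * S0 c + t ^ 2 * Se c)
      by (unfold m, e; field; lra).
    replace (s * S0 c) with (S2 c) by (unfold s; field; lra).
    change (moment (wt kap c) (fun _ => 1)) with (S0 c) in H.
    change (moment (wt kap c) (fun n => odd n ^ 2)) with (S2 c) in H.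
    lra.
Qed.

Lemma convex_odd_square : convex_seq (fun n => odd n ^ 2).
Proof.
intros i j k Hij Hjk; apply lt_INR in Hij; apply lt_INR in Hjk.
apply Rminus_le_0.
replace (_ - _) with (4 * ((INR k - INR j) * (INR j - INR i) * (INR k - INR i)))
  by (unfold odd; ring).
repeat apply Rmult_le_pos; lra.
Qed.

Lemma convex_inv_odd : convex_seq (fun n => / odd n).
Proof.
intros i j k Hij Hjk; apply lt_INR in Hij; apply lt_INR in Hjk.
assert (Hi := odd_pos i). assert (Hj := odd_pos j). assert (Hk := odd_pos k).
apply Rminus_le_0.
replace (_ - _) with (4 * ((INR k - INR j) * (INR j - INR i) * (INR k - INR i))
   / (odd i * odd j * odd k)).
- apply Rmult_le_pos; [repeat apply Rmult_le_pos; lra|].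
  apply Rlt_le, Rinv_0_lt_compat; repeat apply Rmult_lt_0_compat; auto.
- unfold odd in *; field; repeat split; lra.
Qed.

(** At equal means, a larger [kap] gives a more spread out weight: the quotient
    of consecutive likelihood ratios increases with the index. *)
Lemma expect_convex_kap kap kap' x x' f :
  0 <= kap -> kap < kap' -> 0 < x -> 0 < x' -> tame f -> convex_seq f ->
  mean kap' x' = mean kap x ->
  expect (wt kap x) f <= expect (wt kap' x') f.
Proof.
intros Hk Hk' Hx Hx' Tf Cf Hm.
assert (Hw := wt_weight kap x Hk Hx).
assert (Hw' := wt_weight kap' x' ltac:(lra) Hx').
apply expect_convex_order; auto.
- set (q := fun n => (x' / x) * (step kap' n / step kap n)).
  assert (Hr : forall n, wt kap' x' (S n) / wt kap x (S n) =
    (wt kap' x' n / wt kap x n) * q n).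
  { intros n; unfold wt, q; rewrite !coef_S by lra; simpl.
    assert (H1 := coef_pos kap n Hk). assert (H2 := step_pos kap n Hk).
    assert (H3 := pow_lt x n Hx). field; repeat split; lra. }
  intros n.
  assert (Hp : forall n, 0 < wt kap' x' n / wt kap x n).
  { intros i; apply Rdiv_lt_0_compat; [apply Hw' | apply Hw]. }
  assert (Hq : q n < q (S n)).
  { unfold q; apply Rmult_lt_compat_l; [now apply Rdiv_lt_0_compat|].
    unfold step; rewrite S_INR; assert (Hn := pos_INR n); set (a := INR n) in *.
    replace (2 * (2 * a + 3) / ((a + 2) * ((a + 2) ^ 2 + kap'))
      / (2 * (2 * a + 3) / ((a + 2) * ((a + 2) ^ 2 + kap))))
      with (1 - (kap' - kap) * / ((a + 2) ^ 2 + kap')) by (field; repeat split; nra).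
    replace (2 * (2 * (a + 1) + 3) / ((a + 1 + 2) * ((a + 1 + 2) ^ 2 + kap'))
      / (2 * (2 * (a + 1) + 3) / ((a + 1 + 2) * ((a + 1 + 2) ^ 2 + kap))))
      with (1 - (kap' - kap) * / ((a + 1 + 2) ^ 2 + kap')) by (field; repeat split; nra).
    assert (/ ((a + 1 + 2) ^ 2 + kap') < / ((a + 2) ^ 2 + kap')).
    { apply Rinv_lt_contravar; [|nra].
      apply Rmult_lt_0_compat; nra. }
    nra. }
  intros Hlt; rewrite (Hr (S n)).
  assert (H1 := Hp n). assert (H2 := Hp (S n)).
  rewrite (Hr n) in Hlt.
  assert (1 < q n) by nra.
  nra.
- unfold mean in Hm.
  assert (E : forall w, weight w -> expect w (fun n => INR n + 1) = expect w INR + 1).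
  { intros w H; assert (H0 := mass_pos w H); unfold expect.
    rewrite moment_plus; [| apply H | tame | tame]; field; lra. }
  rewrite !E in Hm by auto; lra.
Qed.

Definition on_curve (T k x : R) : Prop := 0 < k /\ k = T * mean (k ^ 2) x.

Lemma pow2_lt a b : 0 <= a -> a < b -> a ^ 2 < b ^ 2.
Proof. intros; nra. Qed.

Lemma curve_increasing T k k' x x' : 0 < T -> 0 <= x -> x < x' ->
  on_curve T k x -> on_curve T k' x' -> k < k'.
Proof.
intros HT Hx Hx' [Hk Ek] [Hk' Ek'].
apply Rnot_le_lt; intros Hle.
assert (k' ^ 2 <= k ^ 2) by (apply pow_incr; lra).
assert (H1 := mean_nonincreasing_kap (k' ^ 2) (k ^ 2) x' (pow2_ge_0 _) H ltac:(lra)).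
assert (H2 := mean_increasing_x (k ^ 2) x x' (pow2_ge_0 _) Hx Hx').
assert (T * mean (k ^ 2) x < T * mean (k' ^ 2) x') by (apply Rmult_lt_compat_l; lra).
lra.
Qed.

Lemma mean_reaches kap x E : 0 <= kap -> 0 <= x -> 1 <= E <= mean kap x ->
  exists z, 0 <= z <= x /\ mean kap z = E.
Proof.
intros Hk Hx HE.
set (phi := fun z => moment (wt kap z) (fun n => INR n + 1 - E)).
assert (Hphi : forall z, 0 <= z ->
  phi z = moment (wt kap z) (fun _ => 1) * (mean kap z - E)).
{ intros z Hz; unfold phi.
  rewrite moment_minus; [| now apply wt_summing | tame | tame].
  rewrite moment_const; unfold mean, expect.
  assert (H := moment_1_pos kap z Hk Hz); field; lra. }
assert (H0 := moment_1_pos kap 0 Hk (Rle_refl 0)).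
assert (H1 := moment_1_pos kap x Hk Hx).
assert (P0 : phi 0 <= 0) by (rewrite Hphi, mean_at_0 by lra; nra).
assert (P1 : 0 <= phi x) by (rewrite Hphi by lra; nra).
destruct (IVT_gen phi 0 x 0) as [z [Hz Ez]].
- intros z; apply continuity_pt_filterlim, moment_continuous; auto; tame.
- rewrite Rmin_left, Rmax_right by lra; lra.
- rewrite Rmin_left, Rmax_right in Hz by lra.
  exists z; split; auto.
  rewrite Hphi in Ez by lra.
  assert (H2 := moment_1_pos kap z Hk ltac:(lra)).
  apply Rmult_integral in Ez; lra.
Qed.

(** Going from [(k, x)] to [(k', x')] in two moves: first to the weight with
    parameter [k'] and the mean of the initial weight, which raises [spread]
    and [drift] by the convex order, then to [x'] at fixed [k']. *)
Lemma stiff_increasing T k k' x x' : 0 < T -> 0 <= x -> x < x' ->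
  on_curve T k x -> on_curve T k' x' -> stiff (k ^ 2) x < stiff (k' ^ 2) x'.
Proof.
intros HT Hx Hx' HC HC'.
assert (Hkk := curve_increasing T k k' x x' HT Hx Hx' HC HC').
destruct HC as [Hk Ek]; destruct HC' as [Hk' Ek'].
rewrite (stiff_on_curve T k x), (stiff_on_curve T k' x') by (auto; lra).
assert (Hsq := pow2_lt k k' ltac:(lra) Hkk).
assert (Hk2 := pow2_ge_0 k). assert (Hk2' := pow2_ge_0 k').
set (kap := k ^ 2) in *. set (kap' := k' ^ 2) in *.
assert (Hm : mean kap x < mean kap' x').
{ apply Rmult_lt_reg_l with T; auto; lra. }
assert (Hm1 := mean_ge_1 kap x Hk2 Hx).
destruct (mean_reaches kap' x' (mean kap x)) as [z [Hz Ez]]; try lra.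
assert (Hz' : z < x').
{ apply Rnot_le_lt; intros H; replace z with x' in Ez by lra; lra. }
assert (A : expect (wt kap x) odd = expect (wt kap' z) odd).
{ rewrite !mean_odd in Ez by lra; lra. }
assert (B : expect (wt kap x) (fun n => odd n ^ 2) <= expect (wt kap' z) (fun n => odd n ^ 2)
  /\ expect (wt kap x) (fun n => / odd n) <= expect (wt kap' z) (fun n => / odd n)).
{ destruct Hx as [Hx|<-].
  - assert (Hz0 : 0 < z).
    { destruct (proj1 Hz) as [H|<-]; auto.
      rewrite mean_at_0 in Ez by auto.
      assert (H := mean_increasing_x kap 0 x Hk2 (Rle_refl 0) Hx).
      rewrite mean_at_0 in H by auto; lra. }
    split; apply expect_convex_kap; auto; try lra; try tame.
    + apply convex_odd_square.
    + apply convex_inv_odd.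
  - assert (z = 0) as ->.
    { destruct (proj1 Hz) as [H|<-]; auto.
      assert (H' := mean_increasing_x kap' 0 z Hk2' (Rle_refl 0) H).
      rewrite mean_at_0 in H', Ez by auto; lra. }
    rewrite !expect_at_0 by auto; lra. }
assert (Hodd : 0 < expect (wt kap' z) odd + 1).
{ rewrite mean_odd in Ez by lra; lra. }
assert (HS : spread (wt kap x) <= spread (wt kap' z)).
{ unfold spread; rewrite A; apply Rmult_le_compat_r; [|lra].
  apply Rlt_le, Rinv_0_lt_compat; lra. }
assert (HD : drift (wt kap x) <= drift (wt kap' z)).
{ unfold drift; rewrite A; apply Rmult_le_compat_l; lra. }
assert (HS' := spread_increasing_x kap' z x' Hk2' (proj1 Hz) Hz').
assert (HD' := drift_nondecreasing_x kap' z x' Hk2' (proj1 Hz) Hz').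
assert (0 < T ^ 2) by (apply pow_lt; auto).
nra.
Qed.

(** * The curve as a graph over the amplitude *)

Lemma mean_filterlim {T : Type} (F : (T -> Prop) -> Prop) {FF : Filter F}
  (kap x : T -> R) (kap0 x0 : R) :
  F (fun t => 0 <= kap t) -> 0 <= kap0 -> 0 <= x0 ->
  filterlim kap F (locally kap0) -> filterlim x F (locally x0) ->
  filterlim (fun t => mean (kap t) (x t)) F (locally (mean kap0 x0)).
Proof. intros; unfold mean; apply expect_filterlim; auto; tame. Qed.

Lemma pow2_continuous x : continuous (fun x : R => x ^ 2) x.
Proof.
apply (ex_derive_continuous (K := R_AbsRing) (V := R_NormedModule)).
auto_derive; auto.
Qed.

(** The equation changes sign between [T] and [T] times the mean at order [T], as the
    mean is at least 1 and decreases with the order. *)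
Lemma curve_exists T x : 0 < T -> 0 <= x -> exists k, on_curve T k x.
Proof.
intros HT Hx.
set (phi := fun k => k * moment (wt (k ^ 2) x) (fun _ => 1)
   - T * moment (wt (k ^ 2) x) (fun n => INR n + 1)).
assert (Hphi : forall k, phi k = moment (wt (k ^ 2) x) (fun _ => 1) * (k - T * mean (k ^ 2) x)).
{ intros k; unfold phi, mean, expect.
  assert (H := moment_1_pos (k ^ 2) x (pow2_ge_0 k) Hx); field; lra. }
assert (Hpos := fun k => moment_1_pos (k ^ 2) x (pow2_ge_0 k) Hx).
set (k1 := T * mean (T ^ 2) x).
assert (Hm := mean_ge_1 (T ^ 2) x (pow2_ge_0 T) Hx).
assert (Hk1 : T <= k1) by (unfold k1; nra).
assert (PT : phi T <= 0).
{ rewrite Hphi; fold k1; rewrite <- (Rmult_0_r (moment (wt (T ^ 2) x) (fun _ => 1))).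
  apply Rmult_le_compat_l; [apply Rlt_le, Hpos | lra]. }
assert (P1 : 0 <= phi k1).
{ rewrite Hphi; apply Rmult_le_pos; [apply Rlt_le, Hpos|].
  assert (H := mean_nonincreasing_kap (T ^ 2) (k1 ^ 2) x (pow2_ge_0 T)
    ltac:(apply pow_incr; lra) Hx).
  assert (H' : T * mean (k1 ^ 2) x <= T * mean (T ^ 2) x)
    by (apply Rmult_le_compat_l; lra).
  fold k1 in H'; lra. }
destruct (IVT_gen phi T k1 0) as [k [Hk Ek]].
- intros k; apply continuity_pt_filterlim; unfold phi.
  assert (C : forall f, tame f -> continuous (fun k => moment (wt (k ^ 2) x) f) k).
  { intros f Tf; apply (moment_filterlim (locally k) (fun k => k ^ 2) (fun _ => x)); auto.
    - apply filter_forall; intros; apply pow2_ge_0.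
    - apply pow2_ge_0.
    - apply pow2_continuous.
    - apply filterlim_const. }
  apply (continuous_minus (V := R_NormedModule)
    (fun k => k * moment (wt (k ^ 2) x) (fun _ => 1))
    (fun k => T * moment (wt (k ^ 2) x) (fun n => INR n + 1))).
  + apply (continuous_mult (K := R_AbsRing) (fun k => k)); [apply continuous_id | apply C; tame].
  + apply (continuous_mult (K := R_AbsRing) (fun _ => T)); [apply continuous_const | apply C; tame].
- rewrite Rmin_left, Rmax_right by lra; lra.
- rewrite Rmin_left, Rmax_right in Hk by lra.
  exists k; split; [lra|].
  rewrite Hphi in Ek; specialize (Hpos k); apply Rmult_integral in Ek; lra.
Qed.

Lemma curve_unique T k k' x : 0 < T -> 0 <= x ->
  on_curve T k x -> on_curve T k' x -> k = k'.
Proof.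
intros HT Hx [Hk Ek] [Hk' Ek'].
assert (W : forall a b, 0 < a -> a < b -> a = T * mean (a ^ 2) x ->
   b = T * mean (b ^ 2) x -> False).
{ intros a b Ha Hab Ea Eb.
  assert (H := mean_nonincreasing_kap (a ^ 2) (b ^ 2) x (pow2_ge_0 _)
    ltac:(apply pow_incr; lra) Hx).
  assert (T * mean (b ^ 2) x <= T * mean (a ^ 2) x) by (apply Rmult_le_compat_l; lra).
  lra. }
destruct (Rtotal_order k k') as [H|[H|H]]; auto; exfalso; eauto.
Qed.

Definition curve (T x : R) : R := epsilon (inhabits 0) (fun k => on_curve T k x).

Lemma curve_spec T x : 0 < T -> 0 <= x -> on_curve T (curve T x) x.
Proof. intros; unfold curve; apply epsilon_spec, curve_exists; auto. Qed.

Lemma curve_0 T : 0 < T -> curve T 0 = T.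
Proof.
intros HT; destruct (curve_spec T 0 HT (Rle_refl 0)) as [_ E].
rewrite mean_at_0 in E by apply pow2_ge_0; lra.
Qed.

Lemma curve_lt T x x' : 0 < T -> 0 <= x -> x < x' -> curve T x < curve T x'.
Proof.
intros HT Hx Hx'; apply (curve_increasing T _ _ x x'); auto;
  apply curve_spec; lra.
Qed.

Lemma curve_ge T x : 0 < T -> 0 <= x -> T <= curve T x.
Proof.
intros HT [Hx|<-]; [|rewrite curve_0; lra].
rewrite <- (curve_0 T HT) at 1; apply Rlt_le, curve_lt; lra.
Qed.

Lemma curve_onto T k : 0 < T -> T < k -> exists x, 0 < x /\ curve T x = k.
Proof.
intros HT Hk.
destruct (mean_unbounded (k ^ 2) (k / T) (pow2_ge_0 k)) as [x1 [Hx1 Hm]].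
assert (HkT : 1 < k / T).
{ apply Rmult_lt_reg_r with T; auto; unfold Rdiv; rewrite Rmult_assoc, Rinv_l; lra. }
destruct (mean_reaches (k ^ 2) x1 (k / T)) as [x [Hx Ex]]; try lra.
{ apply pow2_ge_0. }
exists x; split.
- destruct (proj1 Hx) as [H|<-]; auto.
  rewrite mean_at_0 in Ex by apply pow2_ge_0; lra.
- apply (curve_unique T _ _ x); auto; try lra; [apply curve_spec; lra|].
  split; [lra|]; rewrite Ex; field; lra.
Qed.

(** At a fixed [k] different from [curve T x0], the sign of [k - T * mean] is
    locally constant in [x]. *)
Lemma curve_filterlim {U : Type} (F : (U -> Prop) -> Prop) {FF : Filter F}
  T (x : U -> R) x0 :
  0 < T -> 0 <= x0 -> F (fun t => 0 <= x t) -> filterlim x F (locally x0) ->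
  filterlim (fun t => curve T (x t)) F (locally (curve T x0)).
Proof.
intros HT Hx0 Hp Hlim.
destruct (curve_spec T x0 HT Hx0) as [Hk0 Ek0].
set (k0 := curve T x0) in *.
assert (HL : forall k, filterlim (fun t => T * mean (k ^ 2) (x t)) F
  (locally (T * mean (k ^ 2) x0))).
{ intros k; apply (filterlim_Rmult F (fun _ => T)); [apply filterlim_const|].
  apply (mean_filterlim F (fun _ => k ^ 2)); auto using pow2_ge_0, filterlim_const.
  apply filter_forall; intros; apply pow2_ge_0. }
assert (Hdec : forall a b z, 0 <= a -> a <= b -> 0 <= z ->
  T * mean (b ^ 2) z <= T * mean (a ^ 2) z).
{ intros a b z Ha Hab Hz; apply Rmult_le_compat_l; [lra|].
  apply mean_nonincreasing_kap; auto using pow2_ge_0; apply pow_incr; lra. }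
apply filterlim_locally; intros eps.
set (d := Rmin eps k0 / 2).
assert (Hd : 0 < d < eps /\ d < k0).
{ assert (He := cond_pos eps); unfold d.
  assert (H1 := Rmin_l eps k0); assert (H2 := Rmin_r eps k0).
  assert (0 < Rmin eps k0) by (apply Rmin_pos; auto); lra. }
assert (U1 : F (fun t => T * mean ((k0 + d) ^ 2) (x t) < k0 + d)).
{ apply (HL (k0 + d) (fun y => y < k0 + d)); apply (open_lt (k0 + d)).
  assert (H := Hdec k0 (k0 + d) x0 ltac:(lra) ltac:(lra) Hx0); lra. }
assert (U2 : F (fun t => k0 - d < T * mean ((k0 - d) ^ 2) (x t))).
{ apply (HL (k0 - d) (fun y => k0 - d < y)); apply (open_gt (k0 - d)).
  assert (H := Hdec (k0 - d) k0 x0 ltac:(lra) ltac:(lra) Hx0); lra. }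
generalize (filter_and _ _ Hp (filter_and _ _ U1 U2)).
apply filter_imp; intros t [Ht [H1 H2]].
destruct (curve_spec T (x t) HT Ht) as [Hk Ek].
change (Rabs (curve T (x t) - k0) < eps).
set (k := curve T (x t)) in *.
assert (k < k0 + d).
{ apply Rnot_le_lt; intros H.
  assert (H3 := Hdec (k0 + d) k (x t) ltac:(lra) H Ht); lra. }
assert (k0 - d < k).
{ apply Rnot_le_lt; intros H'.
  assert (H3 := Hdec k (k0 - d) (x t) ltac:(lra) H' Ht); lra. }
apply Rabs_def1; lra.
Qed.

Lemma stiff_filterlim {U : Type} (F : (U -> Prop) -> Prop) {FF : Filter F}
  (kap x : U -> R) (kap0 x0 : R) :
  F (fun t => 0 <= kap t) -> 0 <= kap0 -> 0 <= x0 ->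
  filterlim kap F (locally kap0) -> filterlim x F (locally x0) ->
  filterlim (fun t => stiff (kap t) (x t)) F (locally (stiff kap0 x0)).
Proof.
intros Hp H0 Hx0 Hk Hx.
set (g := fun n => (INR n + 1) * (INR n + 1) ^ 2 * / odd n).
set (h := fun n => (INR n + 1) * / odd n).
assert (E : forall k z, 0 <= k ->
  stiff k z = (moment (wt k z) g + k * moment (wt k z) h)
              * / moment (wt k z) (fun n => INR n + 1)).
{ intros k z Hk'; unfold stiff, stiff_num, Rdiv; f_equal.
  rewrite <- moment_scal, <- moment_plus; [| now apply wt_summing | unfold g; tame | unfold h; tame].
  apply moment_ext; intros n; unfold g, h; ring. }
rewrite E by auto.
apply filterlim_ext_loc with (fun t =>
  (moment (wt (kap t) (x t)) g + kap t * moment (wt (kap t) (x t)) h)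
  * / moment (wt (kap t) (x t)) (fun n => INR n + 1)).
{ apply filter_imp with (2 := Hp); intros t Ht; now rewrite E. }
apply filterlim_Rmult; auto.
- apply (filterlim_comp_2 (G := locally (moment (wt kap0 x0) g))
    (H := locally (kap0 * moment (wt kap0 x0) h)) _ _ Rplus).
  + apply moment_filterlim; auto; unfold g; tame.
  + apply filterlim_Rmult; auto; apply moment_filterlim; auto; unfold h; tame.
  + apply (filterlim_plus (K := R_AbsRing) (V := R_NormedModule)).
- apply (filterlim_comp _ _ _ _ Rinv _ (locally (moment (wt kap0 x0) (fun n => INR n + 1)))).
  + apply moment_filterlim; auto; tame.
  + apply (continuous_Rinv (moment (wt kap0 x0) (fun n => INR n + 1))).
    assert (H1 := mean_ge_1 kap0 x0 H0 Hx0). assert (H2 := moment_1_pos kap0 x0 H0 Hx0).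
    unfold mean, expect in H1.
    intros H; rewrite H in H1; unfold Rdiv in H1; lra.
Qed.

(** The value of [mu / (2 cos alpha)] on the curve with [tan alpha = T], at
    amplitude [r]. *)
Definition gain (T r : R) : R := stiff (curve T (r ^ 2 / 4) ^ 2) (r ^ 2 / 4).

Lemma quarter_pos r : 0 <= r ^ 2 / 4.
Proof. assert (H := pow2_ge_0 r); lra. Qed.

Lemma quarter_lt r r' : 0 <= r -> r < r' -> r ^ 2 / 4 < r' ^ 2 / 4.
Proof. intros H H'; assert (H1 := pow2_lt r r' H H'); lra. Qed.

Lemma gain_0 T : 0 < T -> gain T 0 = 1 + T ^ 2.
Proof.
intros HT; unfold gain; replace (0 ^ 2 / 4) with 0 by field.
destruct (curve_spec T 0 HT (Rle_refl 0)) as [_ E].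
rewrite (stiff_on_curve T) by (auto; lra).
unfold spread, drift; rewrite !expect_at_0 by apply pow2_ge_0.
unfold odd; simpl INR; field.
Qed.

Lemma gain_increasing T r r' : 0 < T -> 0 <= r -> r < r' -> gain T r < gain T r'.
Proof.
intros HT Hr Hr'; unfold gain.
apply stiff_increasing with T; auto using quarter_pos, quarter_lt, curve_spec.
Qed.

Lemma quarter_filterlim (r : R) :
  filterlim (fun r => r ^ 2 / 4) (locally r) (locally (r ^ 2 / 4)).
Proof.
apply (ex_derive_continuous (K := R_AbsRing) (V := R_NormedModule) (fun r => r ^ 2 / 4)).
auto_derive; auto.
Qed.

Lemma curve_quarter_continuous T r : 0 < T ->
  continuous (fun r => curve T (r ^ 2 / 4)) r.
Proof.
intros HT; apply (curve_filterlim (locally r) T (fun r => r ^ 2 / 4)); auto using quarter_pos.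
- apply filter_forall, quarter_pos.
- apply quarter_filterlim.
Qed.

Lemma gain_continuous T r : 0 < T -> continuous (gain T) r.
Proof.
intros HT; unfold gain.
apply (stiff_filterlim (locally r) (fun r => curve T (r ^ 2 / 4) ^ 2) (fun r => r ^ 2 / 4));
  auto using quarter_pos, pow2_ge_0, quarter_filterlim.
- apply filter_forall; intros; apply pow2_ge_0.
- apply (continuous_comp (fun r => curve T (r ^ 2 / 4)) (fun k => k ^ 2)).
  + now apply curve_quarter_continuous.
  + apply pow2_continuous.
Qed.

Lemma spread_nonneg kap x : 0 <= kap -> 0 <= x -> 0 <= spread (wt kap x).
Proof.
intros Hk Hx.
assert (H0 : spread (wt kap 0) = 4).
{ unfold spread; rewrite !expect_at_0 by auto; unfold odd; simpl INR; field. }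
destruct Hx as [Hx|<-]; [|lra].
assert (H := spread_increasing_x kap 0 x Hk (Rle_refl 0) Hx); lra.
Qed.

Lemma expect_inv_odd_bounds kap x : 0 <= kap -> 0 <= x ->
  0 <= expect (wt kap x) (fun n => / odd n) <= 1.
Proof.
intros Hk [Hx|<-].
- assert (Hw := wt_weight kap x Hk Hx).
  rewrite <- (expect_const _ 0 Hw), <- (expect_const _ 1 Hw).
  split; apply expect_le; auto; try tame; intros n; assert (H := odd_ge_1 n).
  + apply Rlt_le, Rinv_0_lt_compat; lra.
  + rewrite <- Rinv_1; apply Rinv_le_contravar; lra.
- rewrite expect_at_0 by auto; unfold odd; simpl INR.
  replace (/ (2 * 0 + 1)) with 1 by field; lra.
Qed.

Lemma gain_ge_curve T r : 0 < T -> T / 2 * curve T (r ^ 2 / 4) <= gain T r.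
Proof.
intros HT; unfold gain; set (x := r ^ 2 / 4).
assert (Hx : 0 <= x) by apply quarter_pos.
destruct (curve_spec T x HT Hx) as [Hk Ek].
set (k := curve T x) in *; assert (Hk2 := pow2_ge_0 k).
rewrite (stiff_on_curve T) by auto.
assert (H1 := spread_nonneg (k ^ 2) x Hk2 Hx).
assert (H2 := expect_inv_odd_bounds (k ^ 2) x Hk2 Hx).
assert (H3 : T / 2 * k = T ^ 2 * (expect (wt (k ^ 2) x) odd + 1) / 4).
{ rewrite Ek at 1; rewrite mean_odd by auto; field. }
assert (H4 : 0 < T ^ 2 * (expect (wt (k ^ 2) x) odd + 1)).
{ assert (0 < T / 2 * k) by (apply Rmult_lt_0_compat; lra). lra. }
unfold drift.
replace (T ^ 2 * ((expect (wt (k ^ 2) x) odd + 1)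
   * (1 + expect (wt (k ^ 2) x) (fun n => / odd n))))
 with (T ^ 2 * (expect (wt (k ^ 2) x) odd + 1)
   * (1 + expect (wt (k ^ 2) x) (fun n => / odd n))) by ring.
nra.
Qed.

Lemma gain_onto T g : 0 < T -> 1 + T ^ 2 <= g -> exists r, 0 <= r /\ gain T r = g.
Proof.
intros HT Hg.
(* [gain] is at least [T / 2] times the order, hence at least [g] at order [k]. *)
set (k := T + 2 * g / T).
assert (Hk : T < k).
{ unfold k; assert (0 < 2 * g / T); [|lra].
  apply Rdiv_lt_0_compat; auto; assert (H := pow2_ge_0 T); lra. }
destruct (curve_onto T k HT Hk) as [x [Hx Ex]].
set (r1 := 2 * sqrt x).
assert (Hr1 : r1 ^ 2 / 4 = x).
{ unfold r1; replace ((2 * sqrt x) ^ 2 / 4) with (sqrt x * sqrt x) by field.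
  apply sqrt_sqrt; lra. }
assert (Hr1p : 0 <= r1) by (unfold r1; assert (H := sqrt_pos x); lra).
assert (Hg1 : g <= gain T r1).
{ apply Rle_trans with (2 := gain_ge_curve T r1 HT).
  rewrite Hr1, Ex; unfold k.
  replace (T / 2 * (T + 2 * g / T)) with (T ^ 2 / 2 + g) by (field; lra).
  assert (H := pow2_ge_0 T); lra. }
destruct (IVT_gen (gain T) 0 r1 g) as [r [Hr Er]].
- intros r; apply continuity_pt_filterlim; now apply gain_continuous.
- assert (H0 := gain_0 T HT). rewrite Rmin_left, Rmax_right by lra; lra.
- rewrite Rmin_left in Hr by lra; exists r; split; auto; lra.
Qed.

Definition amplitude (T g : R) : R :=
  epsilon (inhabits 0) (fun r => 0 <= r /\ gain T r = g).

Lemma amplitude_spec T g : 0 < T -> 1 + T ^ 2 <= g ->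
  0 <= amplitude T g /\ gain T (amplitude T g) = g.
Proof. intros; unfold amplitude; apply epsilon_spec, gain_onto; auto. Qed.

Lemma gain_injective T r r' : 0 < T -> 0 <= r -> 0 <= r' ->
  gain T r = gain T r' -> r = r'.
Proof.
intros HT Hr Hr' E; destruct (Rtotal_order r r') as [H|[H|H]]; auto.
- assert (H1 := gain_increasing T r r' HT Hr H); lra.
- assert (H1 := gain_increasing T r' r HT Hr' H); lra.
Qed.

Lemma amplitude_lt T g r : 0 < T -> 0 <= r -> 1 + T ^ 2 <= g ->
  g < gain T r -> amplitude T g < r.
Proof.
intros HT Hr Hg H; destruct (amplitude_spec T g HT Hg) as [H1 H2].
apply Rnot_le_lt; intros [Hlt|E].
- assert (H3 := gain_increasing T r _ HT Hr Hlt); lra.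
- rewrite E in H; lra.
Qed.

Lemma amplitude_gt T g r : 0 < T -> 0 <= r -> 1 + T ^ 2 <= g ->
  gain T r < g -> r < amplitude T g.
Proof.
intros HT Hr Hg H; destruct (amplitude_spec T g HT Hg) as [H1 H2].
apply Rnot_le_lt; intros [Hlt|E].
- assert (H3 := gain_increasing T _ r HT H1 Hlt); lra.
- rewrite <- E in H; lra.
Qed.

Lemma amplitude_threshold T : 0 < T -> amplitude T (1 + T ^ 2) = 0.
Proof.
intros HT; destruct (amplitude_spec T (1 + T ^ 2) HT (Rle_refl _)) as [H1 H2].
apply (gain_injective T); auto; try lra; rewrite gain_0; auto.
Qed.

Lemma amplitude_filterlim {U : Type} (F : (U -> Prop) -> Prop) {FF : Filter F}
  T (g : U -> R) g0 :
  0 < T -> 1 + T ^ 2 <= g0 -> F (fun t => 1 + T ^ 2 <= g t) ->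
  filterlim g F (locally g0) ->
  filterlim (fun t => amplitude T (g t)) F (locally (amplitude T g0)).
Proof.
intros HT Hg0 Hp Hlim.
destruct (amplitude_spec T g0 HT Hg0) as [Hr0 Er0].
set (r0 := amplitude T g0) in *.
apply filterlim_locally; intros eps; assert (He := cond_pos eps).
assert (U1 : F (fun t => g t < gain T (r0 + eps))).
{ apply (Hlim (fun y => y < gain T (r0 + eps))); apply (open_lt (gain T (r0 + eps))).
  rewrite <- Er0; apply gain_increasing; auto; lra. }
assert (U2 : F (fun t => r0 < eps \/ gain T (r0 - eps) < g t)).
{ destruct (Rlt_le_dec r0 eps) as [H|H].
  - apply filter_forall; auto.
  - apply (filter_imp (fun t => gain T (r0 - eps) < g t)); auto.
    apply (Hlim (fun y => gain T (r0 - eps) < y)); apply (open_gt (gain T (r0 - eps))).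
    rewrite <- Er0; apply gain_increasing; auto; lra. }
generalize (filter_and _ _ Hp (filter_and _ _ U1 U2)).
apply filter_imp; intros t [Ht [H1 H2]].
destruct (amplitude_spec T (g t) HT Ht) as [Hr Er].
change (Rabs (amplitude T (g t) - r0) < eps).
apply Rabs_def1.
- assert (H := amplitude_lt T (g t) (r0 + eps) HT ltac:(lra) Ht H1); lra.
- destruct (Rlt_le_dec r0 eps) as [H|H]; [lra|].
  destruct H2 as [H2|H2]; [lra|].
  assert (H3 := amplitude_gt T (g t) (r0 - eps) HT ltac:(lra) Ht H2); lra.
Qed.

(** * Large order at bounded amplitude *)

(** All coefficients but the first one are smaller than the first one by a factor
    [O(1 / kap)], so a large [kap] concentrates the weight on the index 0. *)
Lemma coef_large_kap kap n : 0 <= kap ->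
  (4 + kap) * (1 + kap) * coef kap (S n) <= 4 * coef 0 (S n).
Proof.
intros Hk; induction n as [|n IH].
- rewrite !coef_S, !coef_0 by lra; unfold step; simpl INR.
  apply Req_le; field; split; lra.
- rewrite (coef_S kap (S n)), (coef_S 0 (S n)) by lra.
  assert (Hs : step kap (S n) <= step 0 (S n)).
  { destruct Hk as [Hk|<-]; [apply Rlt_le, step_decr; lra | lra]. }
  assert (H1 := step_pos kap (S n) Hk).
  assert (H2 := coef_pos 0 (S n) (Rle_refl 0)).
  rewrite <- !Rmult_assoc.
  apply Rmult_le_compat; auto; [|lra].
  assert (H3 := coef_pos kap (S n) Hk).
  apply Rmult_le_pos; [|lra]; apply Rmult_le_pos; lra.
Qed.

Lemma expect_square_large_kap x : 0 <= x -> exists C, 0 <= C /\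
  forall kap, 0 <= kap -> expect (wt kap x) (fun n => odd n ^ 2) <= 1 + C / (4 + kap).
Proof.
intros [Hx|<-].
2:{ exists 0; split; [lra|]; intros kap Hk; rewrite expect_at_0 by auto.
    unfold odd; simpl INR; unfold Rdiv; lra. }
set (A := moment (wt 0 x) (fun n => odd n ^ 2 - 1)).
assert (Hsq : forall n, 0 <= odd n ^ 2 - 1) by (intros n; assert (H := odd_ge_1 n); nra).
assert (HA : 0 <= A) by (apply moment_nonneg; auto; [apply wt_weight; lra | tame]).
exists (2 * A); split; [lra|]; intros kap Hk.
assert (Hw := wt_weight kap x Hk Hx).
assert (Hc0 : 2 / (1 + kap) <= moment (wt kap x) (fun _ => 1)).
{ rewrite <- coef_0 by auto.
  replace (coef kap 0) with (1 * wt kap x 0) by (unfold wt; simpl; ring).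
  apply (Series_ge_term (fun n => 1 * wt kap x n) 0).
  - apply Hw; tame.
  - intros i; assert (H := proj1 Hw i); lra. }
assert (HB : moment (wt kap x) (fun n => odd n ^ 2 - 1) <= 4 / ((4 + kap) * (1 + kap)) * A).
{ unfold A; rewrite <- moment_scal; apply Series_le.
  2:{ apply (wt_summing 0 x (Rle_refl 0)); tame. }
  intros n; split; [apply Rmult_le_pos; auto; apply Rlt_le, Hw|].
  destruct n as [|n].
  - unfold odd; simpl INR; replace ((2 * 0 + 1) ^ 2 - 1) with 0 by ring; lra.
  - unfold wt; assert (H := coef_large_kap kap n Hk).
    assert (coef kap (S n) <= 4 / ((4 + kap) * (1 + kap)) * coef 0 (S n)).
    { apply Rmult_le_reg_l with ((4 + kap) * (1 + kap)); [nra|].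
      replace ((4 + kap) * (1 + kap) * (4 / ((4 + kap) * (1 + kap)) * coef 0 (S n)))
        with (4 * coef 0 (S n)) by (field; split; lra). lra. }
    replace (4 / ((4 + kap) * (1 + kap)) * (odd (S n) ^ 2 - 1) * (coef 0 (S n) * x ^ S n))
      with ((odd (S n) ^ 2 - 1) * ((4 / ((4 + kap) * (1 + kap)) * coef 0 (S n)) * x ^ S n)) by ring.
    apply Rmult_le_compat_l; auto.
    apply Rmult_le_compat_r; auto; apply pow_le; lra. }
rewrite moment_minus in HB; [| apply Hw | tame | tame].
unfold expect; set (S0 := moment (wt kap x) (fun _ => 1)) in *.
assert (H0 : 0 < 2 / (1 + kap)) by (apply Rdiv_lt_0_compat; lra).
apply Rmult_le_reg_r with S0; [lra|].
unfold Rdiv at 1; rewrite Rmult_assoc, Rinv_l, Rmult_1_r by lra.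
assert (2 * A / (4 + kap) * (2 / (1 + kap)) <= 2 * A / (4 + kap) * S0).
{ apply Rmult_le_compat_l; auto; apply Rmult_le_pos; [lra|].
  apply Rlt_le, Rinv_0_lt_compat; lra. }
replace (4 / ((4 + kap) * (1 + kap)) * A) with (2 * A / (4 + kap) * (2 / (1 + kap))) in HB
  by (field; split; lra).
lra.
Qed.

Lemma stiff_le_square T k x : 0 <= x -> k = T * mean (k ^ 2) x ->
  stiff (k ^ 2) x <= (1 + T ^ 2) * expect (wt (k ^ 2) x) (fun n => odd n ^ 2).
Proof.
intros Hx Ek; assert (Hk2 := pow2_ge_0 k).
rewrite (stiff_on_curve T) by auto.
assert (H2 := expect_inv_odd_bounds (k ^ 2) x Hk2 Hx).
assert (H1 := mean_ge_1 (k ^ 2) x Hk2 Hx); rewrite mean_odd in H1 by auto.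
assert (H3 : expect (wt (k ^ 2) x) odd <= expect (wt (k ^ 2) x) (fun n => odd n ^ 2)).
{ destruct Hx as [Hx|<-].
  - apply expect_le; [now apply wt_weight | tame | tame |].
    intros n; assert (H := odd_ge_1 n); nra.
  - rewrite !expect_at_0 by auto; unfold odd; simpl INR; lra. }
unfold spread, drift.
set (m := expect (wt (k ^ 2) x) odd) in *.
set (s := expect (wt (k ^ 2) x) (fun n => odd n ^ 2)) in *.
set (e := expect (wt (k ^ 2) x) (fun n => / odd n)) in *.
assert (A : (s + 3 * m + 3 + e) / (m + 1) <= 4 * s).
{ apply Rmult_le_reg_r with (m + 1); [lra|].
  unfold Rdiv; rewrite Rmult_assoc, Rinv_l by lra; nra. }
assert (B : (m + 1) * (1 + e) <= 4 * s) by nra.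
assert (C := pow2_ge_0 T).
nra.
Qed.

(** * The Gamma function on the line of real part 1 and its right shifts *)

Definition polar (rho theta : R) : C := (rho * cos theta, rho * sin theta).

Lemma polar_mult r s a b : (polar r a * polar s b)%C = polar (r * s) (a + b).
Proof.
unfold polar, Cmult; simpl; rewrite cos_plus, sin_plus; f_equal; ring.
Qed.

Lemma polar_neq_0 r a : r <> 0 -> polar r a <> RtoC 0.
Proof.
intros Hr H; injection H as H1 H2.
assert (H3 := sin2_cos2 a); unfold Rsqr in H3.
apply Rmult_integral in H1; apply Rmult_integral in H2.
destruct H1 as [H1|H1]; [easy|]; destruct H2 as [H2|H2]; [easy|].
rewrite H1, H2 in H3; lra.
Qed.

Lemma polar_inv r a : r <> 0 -> (/ polar r a)%C = polar (/ r) (- a).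
Proof.
intros Hr.
assert (H : (polar r a * polar (/ r) (- a))%C = RtoC 1).
{ rewrite polar_mult, Rplus_opp_r, Rinv_r by auto.
  unfold polar; rewrite cos_0, sin_0; unfold RtoC; f_equal; ring. }
assert (Hn := polar_neq_0 r a Hr).
replace (polar (/ r) (- a)) with (/ polar r a * (polar r a * polar (/ r) (- a)))%C.
- rewrite H; ring.
- field; auto.
Qed.

Lemma sqrt_sum_squares a k : 0 < a ->
  sqrt (a ^ 2 + k ^ 2) = a * sqrt (1 + (k / a) ^ 2).
Proof.
intros Ha.
replace (a ^ 2 + k ^ 2) with (a ^ 2 * (1 + (k / a) ^ 2)) by (field; lra).
assert (H := pow2_ge_0 (k / a)).
rewrite sqrt_mult, sqrt_pow2; try apply pow2_ge_0; lra.
Qed.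

Lemma polar_of_cartesian a k : 0 < a ->
  (a, - k) = polar (sqrt (a ^ 2 + k ^ 2)) (- atan (k / a)).
Proof.
intros Ha; unfold polar; rewrite cos_neg, sin_neg, cos_atan, sin_atan.
rewrite Rsqr_pow2, sqrt_sum_squares by auto.
assert (Hp : 0 < sqrt (1 + (k / a) ^ 2)).
{ apply sqrt_lt_R0; assert (H := pow2_ge_0 (k / a)); lra. }
f_equal; field; lra.
Qed.

(** The argument [1 - ik] of the first Gamma factor in the series of [I_{-ik}]. *)
Definition order_shift (k : R) : C := (RtoC 1 - Ci * RtoC k)%C.

Lemma order_shift_eq k : order_shift k = (1, - k).
Proof.
unfold order_shift, Ci, RtoC, Cminus, Cplus, Copp, Cmult; simpl; f_equal; ring.
Qed.

(** Logarithm of the modulus, relative to [j + 1], and argument, up to sign and the part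
    compensated by [n ^ (- ik)], of the factor [j + 1 - ik] of the Gauss products.  Both
    are [O(1 / j ^ 2)]. *)
Definition mod_factor (k : R) (j : nat) : R := / 2 * ln (1 + (k / (INR j + 1)) ^ 2).

Definition arg_factor (k : R) (j : nat) : R :=
  atan (k / (INR j + 1)) - k * (ln (INR j + 2) - ln (INR j + 1)).

Lemma ratio_sq_pos k j : 0 < 1 + (k / (INR j + 1)) ^ 2.
Proof. assert (H := pow2_ge_0 (k / (INR j + 1))); lra. Qed.

Lemma Crising_polar k n :
  Crising (order_shift k) (S n) =
  polar (INR (fact (S n)) * exp (sum_n (mod_factor k) n))
        (- (sum_n (arg_factor k) n + k * ln (INR n + 2))).
Proof.
assert (Hf : forall j, (order_shift k + RtoC (INR j))%C =
  polar ((INR j + 1) * exp (mod_factor k j))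
    (- (arg_factor k j + k * (ln (INR j + 2) - ln (INR j + 1))))).
{ intros j; assert (Hj := pos_INR j).
  rewrite order_shift_eq.
  replace (Cplus (1, - k) (RtoC (INR j))) with (INR j + 1, - k)
    by (unfold Cplus, RtoC; simpl; f_equal; ring).
  rewrite polar_of_cartesian by lra.
  f_equal; [|unfold arg_factor; ring].
  assert (Hr := ratio_sq_pos k j).
  assert (He : exp (mod_factor k j) = sqrt (1 + (k / (INR j + 1)) ^ 2)).
  { symmetry; apply sqrt_lem_1; [lra | apply Rlt_le, exp_pos |].
    rewrite <- exp_plus; unfold mod_factor.
    replace (/ 2 * ln (1 + (k / (INR j + 1)) ^ 2) + / 2 * ln (1 + (k / (INR j + 1)) ^ 2))
      with (ln (1 + (k / (INR j + 1)) ^ 2)) by field.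
    now rewrite exp_ln. }
  rewrite He; apply sqrt_sum_squares; lra. }
induction n as [|n IH].
- change (Crising (order_shift k) 1)
    with (RtoC 1 * (order_shift k + RtoC (INR 0)))%C.
  rewrite Cmult_1_l, Hf, !sum_O; simpl fact; simpl INR; rewrite !Rplus_0_l.
  rewrite ln_1; f_equal; ring.
- change (Crising (order_shift k) (S (S n)))
    with (Crising (order_shift k) (S n) * (order_shift k + RtoC (INR (S n))))%C.
  rewrite IH, Hf, polar_mult, !sum_Sn; unfold plus; simpl AbelianMonoid.plus.
  rewrite exp_plus, (fact_S_INR (S n)), S_INR.
  replace (INR n + 1 + 1) with (INR n + 2) by ring.
  f_equal; ring.
Qed.

Definition gauss (z : C) (n : nat) : C :=
  (RtoC (INR (fact n)) * Cpower (INR n) z / Crising z (S n))%C.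

Lemma Cpower_order_shift k n : (0 < n)%nat ->
  Cpower (INR n) (order_shift k) = polar (INR n) (- (k * ln (INR n))).
Proof.
intros Hn; assert (H := lt_0_INR n Hn).
unfold Cpower, Cexp, polar; rewrite order_shift_eq.
replace (Re (Cmult (1, - k) (RtoC (ln (INR n))))) with (ln (INR n))
  by (unfold Re, Cmult, RtoC; simpl; ring).
replace (Im (Cmult (1, - k) (RtoC (ln (INR n))))) with (- (k * ln (INR n)))
  by (unfold Im, Cmult, RtoC; simpl; ring).
now rewrite exp_ln.
Qed.

Lemma gauss_polar k n : (0 < n)%nat ->
  gauss (order_shift k) n =
  polar (INR n / (INR n + 1) * exp (- sum_n (mod_factor k) n))
        (sum_n (arg_factor k) n + k * ln (1 + 2 / INR n)).
Proof.
intros Hn; assert (Hp := lt_0_INR n Hn).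
unfold gauss, Cdiv; rewrite Cpower_order_shift, Crising_polar by auto.
assert (Hf := fact_pos (S n)). assert (He := exp_pos (sum_n (mod_factor k) n)).
rewrite polar_inv by (apply Rgt_not_eq, Rmult_lt_0_compat; auto).
replace (RtoC (INR (fact n))) with (polar (INR (fact n)) 0)
  by (unfold polar, RtoC; rewrite cos_0, sin_0; f_equal; ring).
rewrite !polar_mult; f_equal.
- rewrite exp_Ropp, fact_S_INR; assert (H := fact_pos n); field; repeat split; lra.
- replace (1 + 2 / INR n) with ((INR n + 2) / INR n) by (field; lra).
  rewrite ln_div by lra; ring.
Qed.

Lemma ex_series_telescope : ex_series (fun j => / ((INR j + 1) * (INR j + 2))).
Proof.
exists 1.
assert (H : is_lim_seq (sum_n (fun j => / ((INR j + 1) * (INR j + 2)))) 1); [|exact H].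
apply is_lim_seq_ext with (fun n => 1 - / INR (S (S n))).
- intros n; induction n as [|n IH].
  + rewrite sum_O; simpl; field.
  + rewrite sum_Sn, <- IH.
    change (1 - / INR (S (S (S n)))
      = 1 - / INR (S (S n)) + / ((INR (S n) + 1) * (INR (S n) + 2))).
    rewrite !S_INR; assert (Hn := pos_INR n); field; repeat split; lra.
- replace (Finite 1) with (Finite (1 - 0)) by (f_equal; ring).
  apply is_lim_seq_minus'; [apply is_lim_seq_const|].
  apply -> (is_lim_seq_incr_1 (fun n => / INR (S n))).
  apply -> (is_lim_seq_incr_1 (fun n => / INR n)).
  replace (Finite 0) with (Rbar_inv p_infty) by reflexivity.
  apply is_lim_seq_inv; [apply is_lim_seq_INR | discriminate].
Qed.

Lemma ex_series_telescope_le (u : nat -> R) c :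
  (forall j, Rabs (u j) <= c * / ((INR j + 1) * (INR j + 2))) -> ex_series u.
Proof.
intros H; apply (ex_series_le (K := R_AbsRing) (V := R_CompleteNormedModule))
  with (1 := H).
apply (ex_series_scal_l (K := R_AbsRing) (V := R_NormedModule)), ex_series_telescope.
Qed.

Lemma inv_square_le j : / (INR j + 1) ^ 2 <= 2 * / ((INR j + 1) * (INR j + 2)).
Proof.
assert (H := pos_INR j).
apply Rmult_le_reg_r with ((INR j + 1) ^ 2 * (INR j + 2)).
- apply Rmult_lt_0_compat; [apply pow_lt|]; lra.
- field_simplify; lra.
Qed.

Lemma ex_series_mod_factor k : ex_series (mod_factor k).
Proof.
apply ex_series_telescope_le with (k ^ 2); intros j.
assert (H := ratio_sq_pos k j). assert (Hj := pos_INR j).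
assert (Hu := pow2_ge_0 (k / (INR j + 1))).
assert (H1 : 0 <= ln (1 + (k / (INR j + 1)) ^ 2)).
{ rewrite <- ln_1; apply ln_le; lra. }
assert (H2 : ln (1 + (k / (INR j + 1)) ^ 2) <= (k / (INR j + 1)) ^ 2).
{ rewrite <- (ln_exp ((k / (INR j + 1)) ^ 2)) at 2; apply ln_le; auto.
  apply exp_ineq1_le. }
assert (H3 := inv_square_le j).
unfold mod_factor; rewrite Rabs_pos_eq by lra.
replace ((k / (INR j + 1)) ^ 2) with (k ^ 2 * / (INR j + 1) ^ 2) in * by (field; lra).
assert (H4 := pow2_ge_0 k).
assert (k ^ 2 * / (INR j + 1) ^ 2 <= k ^ 2 * (2 * / ((INR j + 1) * (INR j + 2))))
  by (apply Rmult_le_compat_l; auto).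
lra.
Qed.

Lemma atan_near_0 s : Rabs (atan s - s) <= s ^ 2.
Proof.
assert (D : forall x : R, is_derive (fun x => atan x - x) x (/ (1 + x²) - 1)).
{ intros x; apply (is_derive_minus (K := R_AbsRing) (V := R_NormedModule) atan (fun x => x)).
  - apply is_derive_atan.
  - apply (is_derive_id (K := R_AbsRing)). }
destruct (MVT_gen (fun x => atan x - x) 0 s (fun x => / (1 + x²) - 1)) as [c [Hc E]].
- intros x _; apply D.
- intros x _; apply continuity_pt_filterlim.
  apply (ex_derive_continuous (K := R_AbsRing) (V := R_NormedModule) (fun x => atan x - x)).
  exists (/ (1 + x²) - 1); apply D.
- rewrite atan_0 in E.
  replace (atan s - s) with ((/ (1 + c²) - 1) * s) by lra.
  assert (Hcs : Rabs c <= Rabs s).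
  { unfold Rmin, Rmax in Hc; destruct (Rle_dec 0 s).
    - rewrite !Rabs_pos_eq; lra.
    - rewrite !Rabs_left1; lra. }
  replace (/ (1 + c²) - 1) with (- (c ^ 2 / (1 + c ^ 2)))
    by (unfold Rsqr; field; assert (H := pow2_ge_0 c); lra).
  rewrite Rabs_mult, Rabs_Ropp, <- (pow2_abs s).
  assert (H := pow2_ge_0 c).
  rewrite (Rabs_pos_eq (c ^ 2 / (1 + c ^ 2))).
  2:{ apply Rmult_le_pos; auto; apply Rlt_le, Rinv_0_lt_compat; lra. }
  assert (H1 : c ^ 2 / (1 + c ^ 2) <= Rabs c).
  { rewrite <- (pow2_abs c); set (a := Rabs c); assert (Ha : 0 <= a) by apply Rabs_pos.
    apply Rmult_le_reg_r with (1 + a ^ 2); [nra|].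
    unfold Rdiv; rewrite Rmult_assoc, Rinv_l by nra; nra. }
  assert (H2 := Rabs_pos s); replace (Rabs s ^ 2) with (Rabs s * Rabs s) by ring.
  apply Rmult_le_compat_r; lra.
Qed.

Lemma ln_step_bounds a : 0 < a ->
  0 <= / a - (ln (a + 1) - ln a) <= / (a * (a + 1)).
Proof.
intros Ha.
assert (H1 : ln ((a + 1) / a) <= / a).
{ rewrite <- (ln_exp (/ a)); apply ln_le; [apply Rdiv_lt_0_compat; lra|].
  replace ((a + 1) / a) with (1 + / a) by (field; lra); apply exp_ineq1_le. }
assert (H2 : ln (a / (a + 1)) <= - / (a + 1)).
{ rewrite <- (ln_exp (- / (a + 1))); apply ln_le; [apply Rdiv_lt_0_compat; lra|].
  replace (a / (a + 1)) with (1 + - / (a + 1)) by (field; lra); apply exp_ineq1_le. }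
rewrite ln_div in H1, H2 by lra.
replace (/ (a * (a + 1))) with (/ a - / (a + 1)) by (field; lra); lra.
Qed.

Lemma ex_series_arg_factor k : ex_series (arg_factor k).
Proof.
apply ex_series_telescope_le with (2 * k ^ 2 + Rabs k); intros j.
assert (Hj := pos_INR j).
assert (H1 := atan_near_0 (k / (INR j + 1))).
assert (H2 := ln_step_bounds (INR j + 1) ltac:(lra)).
replace (INR j + 1 + 1) with (INR j + 2) in H2 by ring.
unfold arg_factor.
replace (atan (k / (INR j + 1)) - k * (ln (INR j + 2) - ln (INR j + 1)))
  with ((atan (k / (INR j + 1)) - k / (INR j + 1))
    + k * (/ (INR j + 1) - (ln (INR j + 2) - ln (INR j + 1)))) by (field; lra).
eapply Rle_trans; [apply Rabs_triang|].
rewrite Rmult_plus_distr_r; apply Rplus_le_compat.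
- apply Rle_trans with (1 := H1).
  replace ((k / (INR j + 1)) ^ 2) with (k ^ 2 * / (INR j + 1) ^ 2) by (field; lra).
  rewrite (Rmult_comm 2), Rmult_assoc.
  apply Rmult_le_compat_l; [apply pow2_ge_0 | apply inv_square_le].
- rewrite Rabs_mult; apply Rmult_le_compat_l; [apply Rabs_pos|].
  rewrite Rabs_pos_eq; lra.
Qed.

Definition Clim (u : nat -> C) (l : C) : Prop :=
  is_lim_seq (fun n => Re (u n)) (Re l) /\ is_lim_seq (fun n => Im (u n)) (Im l).

Lemma CLim_seq_Clim u l : Clim u l -> CLim_seq u = l.
Proof.
intros [H1 H2]; unfold CLim_seq.
rewrite (is_lim_seq_unique _ _ H1), (is_lim_seq_unique _ _ H2).
now destruct l.
Qed.

Lemma Clim_mult u v a b : Clim u a -> Clim v b -> Clim (fun n => (u n * v n)%C) (a * b)%C.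
Proof.
intros [H1 H2] [H3 H4]; split; unfold Cmult; simpl.
- apply is_lim_seq_minus'; apply is_lim_seq_mult'; auto.
- apply is_lim_seq_plus'; apply is_lim_seq_mult'; auto.
Qed.

Lemma Clim_ext_pos u v l : (forall n, (0 < n)%nat -> u n = v n) -> Clim u l -> Clim v l.
Proof.
intros H [H1 H2]; split; eapply is_lim_seq_ext_loc; try eassumption;
  exists 1%nat; intros n Hn; now rewrite H.
Qed.

Lemma Clim_bound u l (e : nat -> R) :
  (forall n, Cmod (u n - l) <= e n) -> is_lim_seq e 0 -> Clim u l.
Proof.
intros H He.
assert (W : forall p : C -> R, (forall x y, p (x - y)%C = p x - p y) ->
  (forall x, Rabs (p x) <= Cmod x) -> is_lim_seq (fun n => p (u n)) (p l)).
{ intros p Hp Hb.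
  apply is_lim_seq_ext with (fun n => p (u n - l)%C + p l).
  { intros n; rewrite Hp; ring. }
  replace (Finite (p l)) with (Finite (0 + p l)) by (f_equal; ring).
  apply is_lim_seq_plus'; [|apply is_lim_seq_const].
  apply (proj2 (is_lim_seq_abs_0 _)).
  apply is_lim_seq_le_le with (u := fun _ => 0) (w := e); auto; [|apply is_lim_seq_const].
  intros n; split; [apply Rabs_pos|].
  apply Rle_trans with (2 := H n), Hb. }
split; apply W; try (intros [? ?] [? ?]; simpl; ring).
- apply re_le_Cmod.
- intros x; apply Rle_trans with (2 := Rmax_Cmod x), Rmax_r.
Qed.

(** In polar form both the modulus and the argument of the Gauss products are
    partial sums of absolutely convergent series; the modulus being an
    exponential, its limit is positive. *)
Lemma gauss_limit k : exists G, G <> RtoC 0 /\ Clim (gauss (order_shift k)) G.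
Proof.
set (s := Series (mod_factor k)). set (t := Series (arg_factor k)).
assert (Hs : is_lim_seq (sum_n (mod_factor k)) s)
  by exact (Series_correct _ (ex_series_mod_factor k)).
assert (Ht : is_lim_seq (sum_n (arg_factor k)) t)
  by exact (Series_correct _ (ex_series_arg_factor k)).
assert (Hinv : is_lim_seq (fun n => / INR n) 0).
{ replace (Finite 0) with (Rbar_inv p_infty) by reflexivity.
  apply is_lim_seq_inv; [apply is_lim_seq_INR | discriminate]. }
set (rho := fun n => INR n / (INR n + 1) * exp (- sum_n (mod_factor k) n)).
set (theta := fun n => sum_n (arg_factor k) n + k * ln (1 + 2 / INR n)).
assert (Hrho : is_lim_seq rho (exp (- s))).
{ unfold rho; replace (Finite (exp (- s))) with (Finite (/ (1 + 0) * exp (- s)))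
    by (f_equal; field).
  apply is_lim_seq_mult'.
  - apply is_lim_seq_ext_loc with (fun n => / (1 + / INR n)).
    { exists 1%nat; intros n Hn; assert (H := lt_0_INR n Hn); field; lra. }
    apply (is_lim_seq_inv _ (Finite (1 + 0))).
    + apply is_lim_seq_plus'; [apply is_lim_seq_const | exact Hinv].
    + intros H; injection H; lra.
  - apply (is_lim_seq_continuous exp (fun n => - sum_n (mod_factor k) n) (- s)).
    + apply derivable_continuous_pt, derivable_pt_exp.
    + apply (is_lim_seq_opp _ (Finite s)) in Hs; exact Hs. }
assert (Htheta : is_lim_seq theta t).
{ unfold theta; replace (Finite t) with (Finite (t + k * ln (1 + 2 * 0)))
    by (f_equal; rewrite Rmult_0_r, Rplus_0_r, ln_1; ring).
  apply is_lim_seq_plus'; auto.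
  apply (is_lim_seq_scal_l _ k (Finite (ln (1 + 2 * 0)))).
  apply (is_lim_seq_continuous ln (fun n => 1 + 2 / INR n) (1 + 2 * 0)).
  - apply continuity_pt_filterlim; apply continuous_ln; lra.
  - apply is_lim_seq_plus'; [apply is_lim_seq_const|].
    apply (is_lim_seq_scal_l _ 2 (Finite 0)); exact Hinv. }
exists (polar (exp (- s)) t); split.
- apply polar_neq_0, Rgt_not_eq, exp_pos.
- apply Clim_ext_pos with (fun n => polar (rho n) (theta n)).
  { intros n Hn; now rewrite gauss_polar. }
  split; simpl; apply is_lim_seq_mult'; auto;
    [apply (is_lim_seq_continuous cos theta t) | apply (is_lim_seq_continuous sin theta t)]; auto.
  + apply continuity_cos.
  + apply continuity_sin.
Qed.

Lemma Crising_shift z n : Crising z (S n) = (z * Crising (z + RtoC 1) n)%C.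
Proof.
induction n as [|n IH].
- change (RtoC 1 * (z + RtoC 0) = z * RtoC 1)%C; ring.
- change (Crising z (S (S n))) with (Crising z (S n) * (z + RtoC (INR (S n))))%C.
  change (Crising (z + RtoC 1) (S n))
    with (Crising (z + RtoC 1) n * (z + RtoC 1 + RtoC (INR n)))%C.
  rewrite IH, S_INR, RtoC_plus; ring.
Qed.

Lemma Re_pos_neq_0 (z : C) : 0 < Re z -> z <> RtoC 0.
Proof. intros H E; rewrite E in H; simpl in H; lra. Qed.

Lemma Crising_neq_0 z n : 0 < Re z -> Crising z n <> RtoC 0.
Proof.
intros Hz; induction n as [|n IH]; simpl.
- intros H; injection H; lra.
- apply Cmult_neq_0; auto.
  apply Re_pos_neq_0; rewrite re_plus, re_RtoC; assert (H := pos_INR n); lra.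
Qed.

Lemma Cexp_plus a b : Cexp (a + b)%C = (Cexp a * Cexp b)%C.
Proof.
unfold Cexp; rewrite re_plus, im_plus, exp_plus, cos_plus, sin_plus.
unfold Cmult; simpl; f_equal; ring.
Qed.

Lemma Cexp_RtoC a : Cexp (RtoC a) = RtoC (exp a).
Proof. unfold Cexp, RtoC; simpl; rewrite cos_0, sin_0; f_equal; ring. Qed.

Lemma Cexp_neq_0 a : Cexp a <> RtoC 0.
Proof. apply (polar_neq_0 (exp (Re a)) (Im a)), Rgt_not_eq, exp_pos. Qed.

Lemma Cpower_plus x a b : Cpower x (a + b)%C = (Cpower x a * Cpower x b)%C.
Proof. unfold Cpower; rewrite <- Cexp_plus; f_equal; ring. Qed.

Lemma Cpower_1 x : 0 < x -> Cpower x (RtoC 1) = RtoC x.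
Proof.
intros Hx; unfold Cpower; rewrite <- RtoC_mult, Cexp_RtoC, Rmult_1_l.
now rewrite exp_ln.
Qed.

Lemma gauss_shift z n : 0 < Re z -> (0 < n)%nat ->
  gauss (z + RtoC 1) n =
  (gauss z n * (z * (RtoC (INR n) / (z + RtoC 1 + RtoC (INR n)))))%C.
Proof.
intros Hz Hn; assert (Hp := lt_0_INR n Hn); unfold gauss.
rewrite Cpower_plus, Cpower_1, (Crising_shift z) by auto.
change (Crising (z + RtoC 1) (S n))
  with (Crising (z + RtoC 1) n * (z + RtoC 1 + RtoC (INR n)))%C.
assert (Hz1 : 0 < Re (z + RtoC 1)%C) by (rewrite re_plus, re_RtoC; lra).
assert (H1 := Crising_neq_0 _ n Hz1). assert (H2 := Re_pos_neq_0 z Hz).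
assert (H3 : (z + RtoC 1 + RtoC (INR n))%C <> RtoC 0).
{ apply Re_pos_neq_0; rewrite re_plus, re_RtoC; lra. }
field; auto.
Qed.

Lemma shift_factor_limit z : 0 < Re z ->
  Clim (fun n => (RtoC (INR n) / (z + RtoC 1 + RtoC (INR n)))%C) (RtoC 1).
Proof.
intros Hz.
apply Clim_bound with (fun n => Cmod (z + RtoC 1) * / (INR n + 1)).
- intros n; assert (Hn := pos_INR n).
  assert (Hre : INR n + 1 <= Re (z + RtoC 1 + RtoC (INR n))%C)
    by (rewrite !re_plus, !re_RtoC; lra).
  assert (H3 : (z + RtoC 1 + RtoC (INR n))%C <> RtoC 0) by (apply Re_pos_neq_0; lra).
  replace (RtoC (INR n) / (z + RtoC 1 + RtoC (INR n)) - RtoC 1)%C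
    with (- (z + RtoC 1) / (z + RtoC 1 + RtoC (INR n)))%C by (field; auto).
  rewrite Cmod_div, Cmod_opp by auto.
  apply Rmult_le_compat_l; [apply Cmod_ge_0|].
  apply Rinv_le_contravar; [lra|].
  apply Rle_trans with (1 := Hre).
  apply Rle_trans with (2 := re_le_Cmod _), Rle_abs.
- replace (Finite 0) with (Rbar_mult (Cmod (z + RtoC 1)) 0) by (simpl; f_equal; ring).
  apply is_lim_seq_scal_l.
  apply is_lim_seq_ext with (fun n => / INR (S n)); [intros; now rewrite S_INR|].
  apply -> (is_lim_seq_incr_1 (fun n => / INR n)).
  replace (Finite 0) with (Rbar_inv p_infty) by reflexivity.
  apply is_lim_seq_inv; [apply is_lim_seq_INR | discriminate].
Qed.

Lemma Clim_const c : Clim (fun _ => c) c.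
Proof. split; apply is_lim_seq_const. Qed.

(** The functional equation propagates the limit of the Gauss products from [1 - ik]
    to its right shifts. *)
Lemma Gamma_rising k : exists G, G <> RtoC 0 /\
  forall p, Gamma (order_shift k + RtoC (INR p))%C = (G * Crising (order_shift k) p)%C.
Proof.
destruct (gauss_limit k) as [G [HG HL]]; exists G; split; auto.
intros p; apply CLim_seq_Clim.
change (Clim (gauss (order_shift k + RtoC (INR p))%C) (G * Crising (order_shift k) p)%C).
assert (Hre : Re (order_shift k) = 1) by now rewrite order_shift_eq.
induction p as [|p IH].
- simpl Crising; simpl INR; rewrite Cplus_0_r, Cmult_1_r; exact HL.
- rewrite S_INR, RtoC_plus, Cplus_assoc.
  set (z := (order_shift k + RtoC (INR p))%C) in *.
  assert (Hz : 0 < Re z).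
  { unfold z; rewrite re_plus, re_RtoC; assert (H := pos_INR p); lra. }
  apply Clim_ext_pos with (fun n =>
    (gauss z n * (z * (RtoC (INR n) / (z + RtoC 1 + RtoC (INR n)))))%C).
  { intros n Hn; now rewrite gauss_shift. }
  change (Crising (order_shift k) (S p)) with (Crising (order_shift k) p * z)%C.
  replace (G * (Crising (order_shift k) p * z))%C
    with ((G * Crising (order_shift k) p) * (z * RtoC 1))%C by ring.
  apply Clim_mult; auto; apply Clim_mult; [apply Clim_const|].
  now apply shift_factor_limit.
Qed.

(** * Products of Bessel series *)

Fixpoint Csum (u : nat -> C) (n : nat) : C :=
  match n with
  | O => u O
  | S m => (Csum u m + u (S m))%C
  end.

Lemma Csum_ext u v n : (forall i, (i <= n)%nat -> u i = v i) -> Csum u n = Csum v n.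
Proof.
induction n as [|n IH]; intros H; simpl; [apply H; lia|].
rewrite IH by (intros; apply H; lia); now rewrite H by lia.
Qed.

Lemma Csum_plus u v n : Csum (fun i => u i + v i)%C n = (Csum u n + Csum v n)%C.
Proof. induction n as [|n IH]; simpl; [ring | rewrite IH; ring]. Qed.

Lemma Csum_scal c u n : Csum (fun i => c * u i)%C n = (c * Csum u n)%C.
Proof. induction n as [|n IH]; simpl; [ring | rewrite IH; ring]. Qed.

Lemma Csum_last u n : Csum u (S n) = (Csum u n + u (S n))%C.
Proof. reflexivity. Qed.

Lemma Csum_first u n : Csum u (S n) = (u O + Csum (fun i => u (S i)) n)%C.
Proof.
induction n as [|n IH]; [simpl; ring|].
change (Csum u (S (S n))) with (Csum u (S n) + u (S (S n)))%C; rewrite IH; simpl; ring.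
Qed.

Lemma Re_Csum u n : Re (Csum u n) = sum_f_R0 (fun i => Re (u i)) n.
Proof. induction n as [|n IH]; simpl; [easy|]. now rewrite <- IH. Qed.

Lemma Im_Csum u n : Im (Csum u n) = sum_f_R0 (fun i => Im (u i)) n.
Proof. induction n as [|n IH]; simpl; [easy|]. now rewrite <- IH. Qed.

Fixpoint Cfalling (a : C) (n : nat) : C :=
  match n with
  | O => RtoC 1
  | S m => (Cfalling a m * (a - RtoC (INR m)))%C
  end.

Definition Cbinom (a : C) (n : nat) : C := (Cfalling a n / RtoC (INR (fact n)))%C.

Lemma RtoC_neq_0 x : x <> 0 -> RtoC x <> RtoC 0.
Proof. intros H E; apply H, RtoC_inj, E. Qed.

Lemma fact_RtoC_neq_0 n : RtoC (INR (fact n)) <> RtoC 0.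
Proof. apply RtoC_neq_0, Rgt_not_eq, fact_pos. Qed.

Lemma INR_S_RtoC_neq_0 n : RtoC (INR (S n)) <> RtoC 0.
Proof. apply RtoC_neq_0, not_0_INR; lia. Qed.

Lemma Cbinom_S a n :
  (RtoC (INR (S n)) * Cbinom a (S n))%C = ((a - RtoC (INR n)) * Cbinom a n)%C.
Proof.
unfold Cbinom; rewrite fact_simpl, mult_INR, RtoC_mult; simpl Cfalling.
field; split; [apply fact_RtoC_neq_0 | apply INR_S_RtoC_neq_0].
Qed.

(** Splitting the factor [n + 1] of the convolution as [i + (n + 1 - i)] lets
    the recurrence of either binomial coefficient absorb one of the parts. *)
Lemma Cbinom_vandermonde a b n :
  Csum (fun i => Cbinom a i * Cbinom b (n - i))%C n = Cbinom (a + b) n.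
Proof.
induction n as [|n IH].
- simpl; unfold Cbinom; simpl; field; apply RtoC_neq_0; lra.
- assert (Hn := INR_S_RtoC_neq_0 n).
  assert (E : (RtoC (INR (S n)) * Csum (fun i => Cbinom a i * Cbinom b (S n - i)) (S n)
     = RtoC (INR (S n)) * Cbinom (a + b) (S n))%C).
  { rewrite Cbinom_S, <- IH, <- !Csum_scal.
    rewrite (Csum_ext _ (fun i =>
      RtoC (INR i) * Cbinom a i * Cbinom b (S n - i)
      + Cbinom a i * (RtoC (INR (S n - i)) * Cbinom b (S n - i)))%C).
    2:{ intros i Hi; rewrite minus_INR, RtoC_minus by auto; ring. }
    rewrite Csum_plus, Csum_first, (Csum_last (fun i => Cbinom a i * _)%C).
    rewrite Nat.sub_diag; simpl (INR 0).
    replace (Csum (fun i => RtoC (INR (S i)) * Cbinom a (S i) * Cbinom b (S n - S i))%C n)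
      with (Csum (fun i => (a - RtoC (INR i)) * (Cbinom a i * Cbinom b (n - i)))%C n).
    2:{ apply Csum_ext; intros i Hi; rewrite Cbinom_S; simpl; ring. }
    replace (Csum (fun i => Cbinom a i * (RtoC (INR (S n - i)) * Cbinom b (S n - i)))%C n)
      with (Csum (fun i => (b - RtoC (INR (n - i))) * (Cbinom a i * Cbinom b (n - i)))%C n).
    2:{ apply Csum_ext; intros i Hi; rewrite (Nat.sub_succ_l i n) by auto.
        rewrite Cbinom_S; ring. }
    rewrite (Csum_ext (fun i => (a + b - RtoC (INR n)) * (Cbinom a i * Cbinom b (n - i)))%C
      (fun i => (a - RtoC (INR i)) * (Cbinom a i * Cbinom b (n - i))
              + (b - RtoC (INR (n - i))) * (Cbinom a i * Cbinom b (n - i)))%C).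
    2:{ intros i Hi; rewrite minus_INR, RtoC_minus by auto; ring. }
    rewrite Csum_plus; ring. }
  set (X := Csum (fun i => Cbinom a i * Cbinom b (S n - i))%C (S n)) in *.
  replace X with (/ RtoC (INR (S n)) * (RtoC (INR (S n)) * X))%C by (field; auto).
  rewrite E; field; auto.
Qed.

Lemma Crising_falling z n j : (j <= n)%nat ->
  Crising z n = (Crising z (n - j) * Cfalling (z + RtoC (INR n) - RtoC 1) j)%C.
Proof.
induction j as [|j IH]; intros Hj.
- rewrite Nat.sub_0_r; simpl; ring.
- rewrite IH by lia.
  replace (n - j)%nat with (S (n - S j)) by lia.
  simpl Crising; simpl Cfalling.
  replace (INR (n - S j)) with (INR n - INR j - 1).
  { rewrite !RtoC_minus; ring. }
  rewrite minus_INR, S_INR by lia; ring.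
Qed.

(** At [z = 1 - ik], the coefficients of [I_{-ik}] without the common factor
    [(r / 2) ^ (- ik) / Gamma (1 - ik)]; [bessel_coef_next] below does the same for
    [I_{1-ik}]. *)
Definition bessel_coef (z : C) (n : nat) : C :=
  (/ (RtoC (INR (fact n)) * Crising z n))%C.

(** Chu-Vandermonde with an order depending on [n]:
    [(z)_n / ((n - i)! (z)_i)] is a binomial coefficient of [z + n - 1]. *)
Lemma bessel_coef_product z w n : 0 < Re z -> 0 < Re w ->
  Csum (fun i => bessel_coef z i * bessel_coef w (n - i))%C n =
  (Crising (z + w + RtoC (INR n) - RtoC 1) n
   / (RtoC (INR (fact n)) * Crising z n * Crising w n))%C.
Proof.
intros Hz Hw.
assert (Zz := fun m => Crising_neq_0 z m Hz). assert (Zw := fun m => Crising_neq_0 w m Hw).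
set (a := (w + RtoC (INR n) - RtoC 1)%C). set (b := (z + RtoC (INR n) - RtoC 1)%C).
rewrite (Csum_ext _ (fun i => / (Crising z n * Crising w n) * (Cbinom a i * Cbinom b (n - i)))%C).
2:{ intros i Hi.
    assert (Ez := Crising_falling z n (n - i) ltac:(lia)).
    assert (Ew := Crising_falling w n i Hi).
    replace (n - (n - i))%nat with i in Ez by lia.
    assert (Nz := Zz n); assert (Nw := Zw n); rewrite Ez in Nz; rewrite Ew in Nw.
    rewrite Ez, Ew; unfold bessel_coef, Cbinom; fold a b.
    fold b in Nz; fold a in Nw.
    assert (F1 := fact_RtoC_neq_0 i). assert (F2 := fact_RtoC_neq_0 (n - i)).
    assert (Cfalling a i <> RtoC 0) by (intros E; apply Nw; rewrite E; ring).
    assert (Cfalling b (n - i) <> RtoC 0) by (intros E; apply Nz; rewrite E; ring).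
    field; repeat split; auto. }
rewrite Csum_scal, Cbinom_vandermonde; unfold Cbinom.
rewrite (Crising_falling (z + w + RtoC (INR n) - RtoC 1) n n) by auto.
rewrite Nat.sub_diag; simpl Crising at 3.
replace (z + w + RtoC (INR n) - RtoC 1 + RtoC (INR n) - RtoC 1)%C with (a + b)%C
  by (unfold a, b; ring).
field; repeat split; auto; apply fact_RtoC_neq_0.
Qed.

Lemma Crising_conj z n : Cconj (Crising z n) = Crising (Cconj z) n.
Proof.
induction n as [|n IH].
- unfold Crising, Cconj, RtoC; simpl; f_equal; ring.
- simpl Crising; rewrite Cmult_conj, IH, Cplus_conj; f_equal; f_equal.
  unfold Cconj, RtoC; simpl; f_equal; ring.
Qed.

Lemma Cconj_RtoC x : Cconj (RtoC x) = RtoC x.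
Proof. unfold Cconj, RtoC; simpl; f_equal; ring. Qed.

Lemma bessel_coef_conj z n : 0 < Re z ->
  Cconj (bessel_coef z n) = bessel_coef (Cconj z) n.
Proof.
intros Hz; unfold bessel_coef.
rewrite Cinv_conj, Cmult_conj, Crising_conj, Cconj_RtoC; auto.
apply Cmult_neq_0; [apply fact_RtoC_neq_0 | now apply Crising_neq_0].
Qed.

Lemma Crising_INR m n :
  Crising (RtoC (INR m + 1)) n = RtoC (INR (fact (m + n)) / INR (fact m)).
Proof.
assert (Hm := fact_pos m).
induction n as [|n IH].
- simpl Crising; rewrite Nat.add_0_r; f_equal; field; lra.
- simpl Crising; rewrite IH, <- RtoC_plus, <- RtoC_mult; f_equal.
  rewrite Nat.add_succ_r, fact_S_INR, plus_INR; field; lra.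
Qed.

Lemma Crising_quad_prod k n :
  (Crising (order_shift k) n * Crising (Cconj (order_shift k)) n)%C
  = RtoC (quad_prod (k ^ 2) n).
Proof.
induction n as [|n IH]; [simpl; ring|].
change (quad_prod (k ^ 2) (S n)) with (quad_prod (k ^ 2) n * ((INR n + 1) ^ 2 + k ^ 2)).
rewrite RtoC_mult, <- IH; simpl Crising.
replace (RtoC ((INR n + 1) ^ 2 + k ^ 2)) with
  ((order_shift k + RtoC (INR n)) * (Cconj (order_shift k) + RtoC (INR n)))%C.
- ring.
- rewrite order_shift_eq; unfold Cconj, Cplus, Cmult, RtoC; simpl; f_equal; ring.
Qed.

Lemma Re_order_shift k : Re (order_shift k) = 1.
Proof. now rewrite order_shift_eq. Qed.

Lemma order_shift_plus_conj k : (order_shift k + Cconj (order_shift k))%C = RtoC 2.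
Proof. rewrite order_shift_eq; unfold Cconj, Cplus, RtoC; simpl; f_equal; ring. Qed.

(** Here the two orders add up to 2 and the numerator [(n + 1)_n] is a quotient of
    factorials. *)
Lemma bessel_square_coef k n :
  Csum (fun i => bessel_coef (order_shift k) i
                 * Cconj (bessel_coef (order_shift k) (n - i)))%C n
  = RtoC (/ 2 * ((INR n + 1) * ((INR n + 1) ^ 2 + k ^ 2) / odd n) * coef (k ^ 2) n).
Proof.
assert (Hz : 0 < Re (order_shift k)) by (rewrite Re_order_shift; lra).
assert (Hc : 0 < Re (Cconj (order_shift k))) by (rewrite re_conj, Re_order_shift; lra).
rewrite (Csum_ext _ (fun i => bessel_coef (order_shift k) i
    * bessel_coef (Cconj (order_shift k)) (n - i))%C).
2:{ intros i Hi; now rewrite bessel_coef_conj. }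
rewrite bessel_coef_product, order_shift_plus_conj by auto.
replace (RtoC 2 + RtoC (INR n) - RtoC 1)%C with (RtoC (INR n + 1))
  by (rewrite <- RtoC_plus, <- RtoC_minus; f_equal; ring).
rewrite Crising_INR, <- Cmult_assoc, Crising_quad_prod, <- RtoC_mult.
assert (Hk := pow2_ge_0 k).
assert (Hq := quad_prod_pos (k ^ 2) n Hk). assert (Hf := fact_pos n).
assert (Hn := pos_INR n).
rewrite <- RtoC_div by (apply Rgt_not_eq, Rmult_lt_0_compat; auto); f_equal.
unfold coef, odd.
replace (2 * n + 2)%nat with (S (S (n + n))) by lia.
replace (n + 1)%nat with (S n) by lia.
change (quad_prod (k ^ 2) (S n)) with (quad_prod (k ^ 2) n * ((INR n + 1) ^ 2 + k ^ 2)).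
rewrite !fact_S_INR, S_INR, plus_INR.
assert (H := quad_pos n (k ^ 2) Hk).
field; repeat split; lra.
Qed.

Definition bessel_coef_next (z : C) (n : nat) : C :=
  (/ (RtoC (INR (fact n)) * Crising z (S n)))%C.

(** Taking [1 - ik] out of the rising factorial leaves a convolution of orders
    [2 - ik] and [1 + ik]; its missing factor [n + 1 + ik] in the denominator is
    what separates real and imaginary parts. *)
Lemma bessel_cross_coef k n :
  Csum (fun i => bessel_coef_next (order_shift k) i
                 * Cconj (bessel_coef (order_shift k) (n - i)))%C n
  = (/ 2 * ((INR n + 1) * coef (k ^ 2) n), / 2 * (k * coef (k ^ 2) n)).
Proof.
assert (Hz : 0 < Re (order_shift k)) by (rewrite Re_order_shift; lra).
assert (Hz1 : 0 < Re (order_shift k + RtoC 1)%C)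
  by (rewrite re_plus, Re_order_shift, re_RtoC; lra).
assert (Hc : 0 < Re (Cconj (order_shift k))) by (rewrite re_conj, Re_order_shift; lra).
assert (N0 := Re_pos_neq_0 _ Hz).
rewrite (Csum_ext _ (fun i => / order_shift k * (bessel_coef (order_shift k + RtoC 1) i
    * bessel_coef (Cconj (order_shift k)) (n - i)))%C).
2:{ intros i Hi; rewrite bessel_coef_conj by auto.
    unfold bessel_coef_next; rewrite Crising_shift; unfold bessel_coef.
    assert (F1 := fact_RtoC_neq_0 i). assert (F2 := fact_RtoC_neq_0 (n - i)).
    assert (C1 := Crising_neq_0 _ i Hz1). assert (C2 := Crising_neq_0 _ (n - i) Hc).
    field; repeat split; auto. }
rewrite Csum_scal, bessel_coef_product by auto.
replace (order_shift k + RtoC 1 + Cconj (order_shift k) + RtoC (INR n) - RtoC 1)%C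
  with (RtoC (INR (S n) + 1)).
2:{ rewrite S_INR, !RtoC_plus.
    replace (order_shift k + RtoC 1 + Cconj (order_shift k) + RtoC (INR n) - RtoC 1)%C
      with ((order_shift k + Cconj (order_shift k)) + RtoC (INR n))%C by ring.
    rewrite order_shift_plus_conj; unfold RtoC, Cplus; simpl; f_equal; ring. }
rewrite Crising_INR.
assert (Hk := pow2_ge_0 k).
assert (Hq := quad_prod_pos (k ^ 2) (S n) Hk). assert (Hf := fact_pos n).
assert (Hf' := fact_pos (S n)). assert (Hn := pos_INR n).
assert (C1 := Crising_neq_0 _ n Hz1). assert (C2 := Crising_neq_0 _ n Hc).
set (X := INR (fact (S n + n)) / INR (fact (S n))).
assert (E : (/ order_shift k * (RtoC X / (RtoC (INR (fact n))
    * Crising (order_shift k + RtoC 1) n * Crising (Cconj (order_shift k)) n)))%C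
  = (RtoC (X / (INR (fact n) * quad_prod (k ^ 2) (S n)))
    * (Cconj (order_shift k) + RtoC (INR n)))%C).
{ rewrite RtoC_div by (apply Rgt_not_eq, Rmult_lt_0_compat; auto).
  rewrite RtoC_mult, <- Crising_quad_prod, (Crising_shift (order_shift k)).
  change (Crising (Cconj (order_shift k)) (S n))
    with (Crising (Cconj (order_shift k)) n * (Cconj (order_shift k) + RtoC (INR n)))%C.
  assert ((Cconj (order_shift k) + RtoC (INR n))%C <> RtoC 0).
  { apply Re_pos_neq_0; rewrite re_plus, re_conj, Re_order_shift, re_RtoC; lra. }
  field; repeat split; auto; apply fact_RtoC_neq_0. }
rewrite E.
replace (Cconj (order_shift k) + RtoC (INR n))%C with ((INR n + 1, k) : C).
2:{ rewrite order_shift_eq; unfold Cconj, Cplus, RtoC; simpl; f_equal; ring. }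
assert (EX : X / (INR (fact n) * quad_prod (k ^ 2) (S n)) = / 2 * coef (k ^ 2) n).
{ unfold X, coef.
  replace (2 * n + 2)%nat with (S (S n + n)) by lia.
  replace (n + 1)%nat with (S n) by lia.
  rewrite (fact_S_INR (S n + n)), (fact_S_INR n), plus_INR, S_INR.
  field; repeat split; lra. }
rewrite EX; unfold Cmult, RtoC; simpl; f_equal; ring.
Qed.

Definition Cabs_summable (u : nat -> C) : Prop := ex_series (fun n => Cmod (u n)).

Lemma Cabs_summable_Re u : Cabs_summable u -> ex_series (fun n => Rabs (Re (u n))).
Proof.
apply (ex_series_le (K := R_AbsRing) (V := R_CompleteNormedModule)); intros n.
change norm with Rabs; simpl; rewrite Rabs_Rabsolu; apply re_le_Cmod.
Qed.

Lemma Cabs_summable_Im u : Cabs_summable u -> ex_series (fun n => Rabs (Im (u n))).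
Proof.
apply (ex_series_le (K := R_AbsRing) (V := R_CompleteNormedModule)); intros n.
change norm with Rabs; simpl; rewrite Rabs_Rabsolu.
apply Rle_trans with (2 := Rmax_Cmod (u n)), Rmax_r.
Qed.

Lemma CSeries_scal c u : Cabs_summable u ->
  CSeries (fun n => c * u n)%C = (c * CSeries u)%C.
Proof.
intros Hu.
assert (H1 := ex_series_Rabs _ (Cabs_summable_Re u Hu)).
assert (H2 := ex_series_Rabs _ (Cabs_summable_Im u Hu)).
unfold CSeries, Cmult; simpl.
assert (S1 : forall a, ex_series (fun n => a * Re (u n)))
  by (intros a; apply (ex_series_scal_l (K := R_AbsRing) (V := R_NormedModule)); auto).
assert (S2 : forall a, ex_series (fun n => a * Im (u n)))
  by (intros a; apply (ex_series_scal_l (K := R_AbsRing) (V := R_NormedModule)); auto).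
unfold Re, Im in *.
rewrite Series_minus, Series_plus, !Series_scal_l; auto.
Qed.

Lemma CSeries_mult u v : Cabs_summable u -> Cabs_summable v ->
  (CSeries u * CSeries v)%C = CSeries (fun n => Csum (fun i => u i * v (n - i)%nat)%C n).
Proof.
intros Hu Hv.
assert (P : forall f g, ex_series (fun n => Rabs (f n)) -> ex_series (fun n => Rabs (g n)) ->
  is_series (fun n => sum_f_R0 (fun i => f i * g (n - i)%nat) n) (Series f * Series g)).
{ intros f g Hf Hg; apply is_series_mult; auto; apply Series_correct, ex_series_Rabs; auto. }
assert (Ru := Cabs_summable_Re u Hu). assert (Iu := Cabs_summable_Im u Hu).
assert (Rv := Cabs_summable_Re v Hv). assert (Iv := Cabs_summable_Im v Hv).
symmetry; apply injective_projections.
- change (Series (fun n => Re (Csum (fun i => u i * v (n - i)%nat)%C n))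
    = Series (fun n => Re (u n)) * Series (fun n => Re (v n))
      - Series (fun n => Im (u n)) * Series (fun n => Im (v n))).
  apply is_series_unique.
  apply is_series_ext with (fun n =>
    sum_f_R0 (fun i => Re (u i) * Re (v (n - i)%nat)) n
    + - sum_f_R0 (fun i => Im (u i) * Im (v (n - i)%nat)) n).
  { intros n; rewrite Re_Csum.
    symmetry; apply (minus_sum (fun i => Re (u i) * Re (v (n - i)%nat))). }
  apply (is_series_plus (K := R_AbsRing) (V := R_NormedModule)); [now apply P|].
  apply (is_series_opp (K := R_AbsRing) (V := R_NormedModule)); now apply P.
- change (Series (fun n => Im (Csum (fun i => u i * v (n - i)%nat)%C n))
    = Series (fun n => Re (u n)) * Series (fun n => Im (v n))
      + Series (fun n => Im (u n)) * Series (fun n => Re (v n))).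
  apply is_series_unique.
  apply is_series_ext with (fun n =>
    sum_f_R0 (fun i => Re (u i) * Im (v (n - i)%nat)) n
    + sum_f_R0 (fun i => Im (u i) * Re (v (n - i)%nat)) n).
  { intros n; rewrite Im_Csum.
    symmetry; apply (plus_sum (fun i => Re (u i) * Im (v (n - i)%nat))). }
  apply (is_series_plus (K := R_AbsRing) (V := R_NormedModule)); now apply P.
Qed.

Lemma CSeries_ext u v : (forall n, u n = v n) -> CSeries u = CSeries v.
Proof.
intros H; unfold CSeries; f_equal; apply Series_ext; intros n; now rewrite H.
Qed.

Lemma CSeries_conj u : Cconj (CSeries u) = CSeries (fun n => Cconj (u n)).
Proof.
unfold CSeries, Cconj; simpl; f_equal.
rewrite <- Series_opp; reflexivity.
Qed.

Lemma Crising_Cmod_ge_1 z n : 1 <= Re z -> 1 <= Cmod (Crising z n).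
Proof.
intros Hz; induction n as [|n IH]; simpl Crising.
- rewrite Cmod_1; lra.
- rewrite Cmod_mult.
  assert (1 <= Cmod (z + RtoC (INR n))).
  { apply Rle_trans with (2 := re_le_Cmod _).
    apply Rle_trans with (2 := Rle_abs _).
    rewrite re_plus, re_RtoC; assert (H := pos_INR n); lra. }
  nra.
Qed.

Lemma exp_series_summable x (u : nat -> C) : 0 <= x ->
  (forall n, Cmod (u n) <= / INR (fact n)) ->
  Cabs_summable (fun n => u n * RtoC (x ^ n))%C.
Proof.
intros Hx Hu.
apply (ex_series_le (K := R_AbsRing) (V := R_CompleteNormedModule))
  with (fun n => / INR (fact n) * x ^ n).
- intros n; change norm with Rabs; simpl.
  rewrite (Rabs_pos_eq _ (Cmod_ge_0 _)), Cmod_mult, Cmod_R.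
  assert (H := pow_le x n Hx); rewrite (Rabs_pos_eq (x ^ n)) by auto.
  apply Rmult_le_compat_r; auto.
- exists (exp x); assert (H := is_exp_Reals x).
  apply is_series_ext with (2 := H); intros n.
  rewrite pow_n_pow; change (scal (x ^ n) (/ INR (fact n))) with (x ^ n * / INR (fact n)).
  apply Rmult_comm.
Qed.

Lemma fact_Crising_inv_bound z n m : 1 <= Re z ->
  Cmod (/ (RtoC (INR (fact n)) * Crising z m)) <= / INR (fact n).
Proof.
intros Hz; assert (Hf := fact_pos n).
assert (H := Crising_Cmod_ge_1 z m Hz).
rewrite Cmod_inv.
2:{ apply Cmult_neq_0; [apply fact_RtoC_neq_0 | apply Crising_neq_0; lra]. }
rewrite Cmod_mult, Cmod_R, Rabs_pos_eq by lra.
apply Rinv_le_contravar; auto; nra.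
Qed.

Definition bessel_series (k x : R) : C :=
  CSeries (fun n => bessel_coef (order_shift k) n * RtoC (x ^ n))%C.

Definition bessel_series_next (k x : R) : C :=
  CSeries (fun n => bessel_coef_next (order_shift k) n * RtoC (x ^ n))%C.

Lemma bessel_series_summable k x : 0 <= x ->
  Cabs_summable (fun n => bessel_coef (order_shift k) n * RtoC (x ^ n))%C.
Proof.
intros Hx; apply exp_series_summable; auto; intros n.
apply fact_Crising_inv_bound; rewrite Re_order_shift; lra.
Qed.

Lemma bessel_series_next_summable k x : 0 <= x ->
  Cabs_summable (fun n => bessel_coef_next (order_shift k) n * RtoC (x ^ n))%C.
Proof.
intros Hx; apply exp_series_summable; auto; intros n.
apply fact_Crising_inv_bound; rewrite Re_order_shift; lra.
Qed.

Lemma Cabs_summable_conj u : Cabs_summable u -> Cabs_summable (fun n => Cconj (u n)).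
Proof.
intros H; apply ex_series_ext with (2 := H); intros n; now rewrite Cmod_conj.
Qed.

Lemma pow_convolution (u v : nat -> C) x n :
  Csum (fun i => (u i * RtoC (x ^ i)) * Cconj (v (n - i)%nat * RtoC (x ^ (n - i))))%C n
  = (RtoC (x ^ n) * Csum (fun i => u i * Cconj (v (n - i)%nat))%C n)%C.
Proof.
rewrite <- Csum_scal; apply Csum_ext; intros i Hi.
rewrite Cmult_conj, Cconj_RtoC.
replace (x ^ n) with (x ^ i * x ^ (n - i)) by (rewrite <- pow_add; f_equal; lia).
rewrite RtoC_mult; ring.
Qed.

Lemma bessel_series_square k x : 0 <= x ->
  (bessel_series k x * Cconj (bessel_series k x))%C = RtoC (stiff_num (k ^ 2) x / 2).
Proof.
intros Hx; unfold bessel_series; rewrite CSeries_conj, CSeries_mult;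
  auto using Cabs_summable_conj, bessel_series_summable.
rewrite (CSeries_ext _ (fun n => RtoC (x ^ n * (/ 2 *
   ((INR n + 1) * ((INR n + 1) ^ 2 + k ^ 2) / odd n) * coef (k ^ 2) n)))).
2:{ intros n; rewrite (pow_convolution (bessel_coef (order_shift k)) (bessel_coef (order_shift k))).
    now rewrite bessel_square_coef, <- RtoC_mult. }
set (kap := k ^ 2); unfold CSeries, RtoC; simpl; f_equal.
- replace (stiff_num kap x / 2) with (/ 2 * stiff_num kap x) by field.
  unfold stiff_num, moment; rewrite <- Series_scal_l.
  apply Series_ext; intros n; unfold wt, Re; simpl; field.
  assert (H := odd_pos n); lra.
- rewrite (Series_ext _ (fun n => 0 * 0)) by (intros; ring).
  rewrite (Series_scal_l 0 (fun _ => 0)); ring.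
Qed.

Lemma bessel_series_cross k x : 0 <= x ->
  (bessel_series_next k x * Cconj (bessel_series k x))%C =
  (moment (wt (k ^ 2) x) (fun n => INR n + 1) / 2,
   k * moment (wt (k ^ 2) x) (fun _ => 1) / 2).
Proof.
intros Hx; unfold bessel_series, bessel_series_next; rewrite CSeries_conj, CSeries_mult;
  auto using Cabs_summable_conj, bessel_series_summable, bessel_series_next_summable.
rewrite (CSeries_ext _ (fun n => Cmult (RtoC (x ^ n))
  (/ 2 * ((INR n + 1) * coef (k ^ 2) n), / 2 * (k * coef (k ^ 2) n)))).
2:{ intros n; rewrite (pow_convolution (bessel_coef_next (order_shift k)) (bessel_coef (order_shift k))).
    now rewrite bessel_cross_coef. }
unfold CSeries; apply (f_equal2 pair).
- replace (moment (wt (k ^ 2) x) (fun n => INR n + 1) / 2)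
    with (/ 2 * moment (wt (k ^ 2) x) (fun n => INR n + 1)) by field.
  unfold moment; rewrite <- Series_scal_l; apply Series_ext; intros n; unfold wt, Re, Cmult, RtoC; simpl; ring.
- replace (k * moment (wt (k ^ 2) x) (fun _ => 1) / 2)
    with (/ 2 * (k * moment (wt (k ^ 2) x) (fun _ => 1))) by field.
  unfold moment; rewrite <- !Series_scal_l; apply Series_ext; intros n; unfold wt, Im, Cmult, RtoC; simpl; ring.
Qed.

Lemma stiff_num_pos kap x : 0 <= kap -> 0 < x -> 0 < stiff_num kap x.
Proof.
intros Hk Hx; apply moment_pos.
- now apply wt_weight.
- unfold Rdiv; tame.
- intros n; apply Rlt_le; assert (H := odd_pos n); assert (Hn := pos_INR n).
  apply Rdiv_lt_0_compat; auto; apply Rmult_lt_0_compat; nra.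
- exists 0%nat; unfold odd; simpl INR; apply Rdiv_lt_0_compat; [|lra].
  apply Rmult_lt_0_compat; nra.
Qed.

Lemma Cpower_even_part r n : 0 < r ->
  Cpower (r / 2) (RtoC (2 * INR n)) = RtoC ((r ^ 2 / 4) ^ n).
Proof.
intros Hr; unfold Cpower; rewrite <- RtoC_mult, Cexp_RtoC; f_equal.
replace (r ^ 2 / 4) with (r / 2 * (r / 2)) by field.
rewrite <- (exp_ln (r / 2)) at 2 3 by lra; rewrite <- exp_plus.
induction n as [|n IH]; [simpl; rewrite Rmult_0_r, Rmult_0_l, exp_0; reflexivity|].
simpl pow; rewrite <- IH, <- exp_plus, S_INR; f_equal; ring.
Qed.

Lemma bessel_ratio k r : 0 < r -> bessel_series k (r ^ 2 / 4) <> RtoC 0 ->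
  (BesselI (RtoC 1 - Ci * RtoC k) r / BesselI (- (Ci * RtoC k)) r)%C =
  (RtoC (r / 2) * bessel_series_next k (r ^ 2 / 4) / bessel_series k (r ^ 2 / 4))%C.
Proof.
intros Hr HF; destruct (Gamma_rising k) as [G [HG HGam]].
assert (Hx : 0 <= r ^ 2 / 4) by apply quarter_pos.
assert (Hz : 0 < Re (order_shift k)) by (rewrite Re_order_shift; lra).
set (P := Cpower (r / 2) (- (Ci * RtoC k))).
assert (HP : P <> RtoC 0) by apply Cexp_neq_0.
assert (E0 : BesselI (- (Ci * RtoC k)) r = (P / G * bessel_series k (r ^ 2 / 4))%C).
{ unfold BesselI, bessel_series; rewrite <- CSeries_scal by now apply bessel_series_summable.
  apply CSeries_ext; intros n.
  replace (- (Ci * RtoC k) + RtoC (INR n) + RtoC 1)%C with (order_shift k + RtoC (INR n))%C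
    by (unfold order_shift; ring).
  rewrite HGam, Cpower_plus, Cpower_even_part by auto; fold P.
  unfold bessel_coef.
  assert (C1 := Crising_neq_0 _ n Hz). assert (F1 := fact_RtoC_neq_0 n).
  field; repeat split; auto. }
assert (E1 : BesselI (RtoC 1 - Ci * RtoC k) r =
  (P * RtoC (r / 2) / G * bessel_series_next k (r ^ 2 / 4))%C).
{ unfold BesselI, bessel_series_next; rewrite <- CSeries_scal by now apply bessel_series_next_summable.
  apply CSeries_ext; intros n.
  replace (RtoC 1 - Ci * RtoC k + RtoC (INR n) + RtoC 1)%C
    with (order_shift k + RtoC (INR (S n)))%C
    by (rewrite S_INR, RtoC_plus; unfold order_shift; ring).
  replace (RtoC 1 - Ci * RtoC k + RtoC (2 * INR n))%C
    with (- (Ci * RtoC k) + RtoC 1 + RtoC (2 * INR n))%C by ring.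
  rewrite HGam, !Cpower_plus, Cpower_even_part, Cpower_1 by lra; fold P.
  unfold bessel_coef_next.
  assert (C1 := Crising_neq_0 _ (S n) Hz). assert (F1 := fact_RtoC_neq_0 n).
  field; repeat split; auto. }
rewrite E0, E1; field; repeat split; auto.
Qed.

(** Multiplying numerator and denominator by the conjugate of the denominator
    makes real and imaginary parts of the mean resultant explicit moments. *)
Lemma mean_resultant_moments k r : 0 < r ->
  mean_resultant k r =
  (r / (2 * stiff_num (k ^ 2) (r ^ 2 / 4))
     * moment (wt (k ^ 2) (r ^ 2 / 4)) (fun n => INR n + 1),
   r / (2 * stiff_num (k ^ 2) (r ^ 2 / 4))
     * (k * moment (wt (k ^ 2) (r ^ 2 / 4)) (fun _ => 1))).
Proof.
intros Hr; unfold mean_resultant; destruct (Req_EM_T r 0) as [E|_]; [lra|].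
set (x := r ^ 2 / 4).
assert (Hx : 0 < x) by (assert (H := quarter_lt 0 r (Rle_refl 0) Hr); unfold x; lra).
assert (Hsq := bessel_series_square k x ltac:(lra)).
assert (Hcr := bessel_series_cross k x ltac:(lra)).
assert (HN := stiff_num_pos (k ^ 2) x (pow2_ge_0 k) Hx).
assert (HF : bessel_series k x <> RtoC 0).
{ intros E; rewrite E, Cmult_0_l in Hsq; apply RtoC_inj in Hsq; lra. }
rewrite bessel_ratio by auto; fold x.
set (F := bessel_series k x) in *. set (F1 := bessel_series_next k x) in *.
assert (HFc : Cconj F <> RtoC 0).
{ intros E; apply HF; rewrite <- (Cconj_conj F), E; apply Cconj_RtoC. }
replace (RtoC (r / 2) * F1 / F)%C
  with (RtoC (r / 2) * (F1 * Cconj F) / (F * Cconj F))%C by (field; auto).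
rewrite Hcr, Hsq; set (N := stiff_num (k ^ 2) x) in *.
unfold Cdiv; rewrite <- RtoC_inv by lra.
unfold Cmult, RtoC; simpl; f_equal; field; lra.
Qed.

(** * Solutions of the self-consistency condition *)

Lemma Cexp_Ci alpha : Cexp (Ci * RtoC alpha)%C = (cos alpha, sin alpha).
Proof.
unfold Cexp.
replace (Re (Ci * RtoC alpha)%C) with 0 by (unfold Ci, RtoC, Cmult; simpl; ring).
replace (Im (Ci * RtoC alpha)%C) with alpha by (unfold Ci, RtoC, Cmult; simpl; ring).
rewrite exp_0; f_equal; ring.
Qed.

Lemma self_consistent_0 alpha mu k : self_consistent alpha mu k 0.
Proof.
split; [lra|]; unfold mean_resultant; destruct (Req_EM_T 0 0) as [_|H]; [|easy].
now rewrite !Cmult_0_r.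
Qed.

Lemma self_consistent_moments alpha mu k r : 0 < r ->
  self_consistent alpha mu k r <->
  mu * moment (wt (k ^ 2) (r ^ 2 / 4)) (fun n => INR n + 1)
    = 2 * stiff_num (k ^ 2) (r ^ 2 / 4) * cos alpha /\
  mu * (k * moment (wt (k ^ 2) (r ^ 2 / 4)) (fun _ => 1))
    = 2 * stiff_num (k ^ 2) (r ^ 2 / 4) * sin alpha.
Proof.
intros Hr.
assert (Hx : 0 < r ^ 2 / 4) by (assert (H := quarter_lt 0 r (Rle_refl 0) Hr); lra).
assert (HN := stiff_num_pos (k ^ 2) _ (pow2_ge_0 k) Hx).
unfold self_consistent; rewrite mean_resultant_moments, Cexp_Ci by auto.
set (N := stiff_num _ _) in *. set (Sn := moment _ (fun n => INR n + 1)).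
set (S1 := moment _ (fun _ => 1)).
unfold Cmult, RtoC; simpl; split.
- intros [_ E]; injection E as E1 E2; split;
  apply Rmult_eq_reg_l with (r / (2 * N));
  try (apply Rgt_not_eq, Rdiv_lt_0_compat; lra).
  + replace (r / (2 * N) * (2 * N * cos alpha)) with (cos alpha * r) by (field; lra); lra.
  + replace (r / (2 * N) * (2 * N * sin alpha)) with (sin alpha * r) by (field; lra); lra.
- intros [E1 E2]; split; [lra|]; f_equal.
  + replace (mu * (r / (2 * N) * Sn) - 0 * (r / (2 * N) * (k * S1)))
      with (r / (2 * N) * (mu * Sn)) by ring.
    rewrite E1; field; lra.
  + replace (mu * (r / (2 * N) * (k * S1)) + 0 * (r / (2 * N) * Sn))
      with (r / (2 * N) * (mu * (k * S1))) by ring.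
    rewrite E2; field; lra.
Qed.

Lemma self_consistent_opp alpha mu k r :
  self_consistent alpha mu k r <-> self_consistent (- alpha) mu (- k) r.
Proof.
destruct (Rlt_le_dec 0 r) as [Hr|[Hr| ->]].
- rewrite !self_consistent_moments by auto.
  replace ((- k) ^ 2) with (k ^ 2) by ring.
  rewrite cos_neg, sin_neg; split; intros [E1 E2]; split; auto; lra.
- split; intros [H _]; lra.
- split; intros _; apply self_consistent_0.
Qed.

Lemma moment_succ_pos kap x : 0 <= kap -> 0 <= x ->
  0 < moment (wt kap x) (fun n => INR n + 1).
Proof.
intros Hk Hx; assert (H := mean_ge_1 kap x Hk Hx).
assert (H1 := moment_1_pos kap x Hk Hx).
replace (moment (wt kap x) (fun n => INR n + 1))
  with (mean kap x * moment (wt kap x) (fun _ => 1)) by (unfold mean, expect; field; lra).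
apply Rmult_lt_0_compat; lra.
Qed.

Lemma acute_trig alpha : 0 < alpha < PI / 2 ->
  0 < cos alpha /\ 0 < tan alpha /\ sin alpha = tan alpha * cos alpha
  /\ 1 + tan alpha ^ 2 = / cos alpha ^ 2.
Proof.
intros Ha; assert (Hc : 0 < cos alpha) by (apply cos_gt_0; lra).
assert (Hs : 0 < sin alpha) by (apply sin_gt_0; lra).
repeat split; auto.
- apply Rdiv_lt_0_compat; auto.
- unfold tan; field; lra.
- assert (H := sin2_cos2 alpha); unfold Rsqr in H; unfold tan.
  replace (1 + (sin alpha / cos alpha) ^ 2)
    with ((sin alpha * sin alpha + cos alpha * cos alpha) / cos alpha ^ 2) by (field; lra).
  rewrite H; field; lra.
Qed.

(** The quotient of the two real equations gives the curve, the first one alone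
    gives [mu]. *)
Lemma nontrivial_solution alpha mu k r : 0 < alpha < PI / 2 -> 0 < r ->
  self_consistent alpha mu k r <->
  k = curve (tan alpha) (r ^ 2 / 4) /\ mu = 2 * cos alpha * gain (tan alpha) r.
Proof.
intros Ha Hr; destruct (acute_trig alpha Ha) as [Hc [HT [Hsin _]]].
rewrite self_consistent_moments by auto.
assert (Hx : 0 < r ^ 2 / 4) by (assert (H := quarter_lt 0 r (Rle_refl 0) Hr); lra).
set (x := r ^ 2 / 4) in *; set (T := tan alpha) in *.
assert (Hk2 := pow2_ge_0 k).
assert (HN := stiff_num_pos (k ^ 2) x Hk2 Hx).
assert (HS1 := moment_1_pos (k ^ 2) x Hk2 ltac:(lra)).
assert (HSn := moment_succ_pos (k ^ 2) x Hk2 ltac:(lra)).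
assert (Hm : mean (k ^ 2) x * moment (wt (k ^ 2) x) (fun _ => 1)
  = moment (wt (k ^ 2) x) (fun n => INR n + 1)) by (unfold mean, expect; field; lra).
assert (Hst : stiff (k ^ 2) x * moment (wt (k ^ 2) x) (fun n => INR n + 1)
  = stiff_num (k ^ 2) x) by (unfold stiff; field; lra).
assert (Hm1 := mean_ge_1 (k ^ 2) x Hk2 ltac:(lra)).
rewrite Hsin.
set (S1 := moment _ (fun _ => 1)) in *. set (Sn := moment _ (fun n => INR n + 1)) in *.
set (N := stiff_num _ _) in *.
split.
- intros [E1 E2].
  assert (Hmu : mu <> 0).
  { intros ->; assert (0 < 2 * N * cos alpha) by (apply Rmult_lt_0_compat; lra); lra. }
  assert (Ek : k = T * mean (k ^ 2) x).
  { apply Rmult_eq_reg_r with S1; [|lra]; rewrite Rmult_assoc, Hm.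
    apply Rmult_eq_reg_l with mu; auto.
    rewrite E2; replace (mu * (T * Sn)) with (T * (mu * Sn)) by ring; rewrite E1; ring. }
  assert (HC : on_curve T k x).
  { split; auto; rewrite Ek; apply Rmult_lt_0_compat; lra. }
  assert (Ekc : k = curve T x) by (apply (curve_unique T _ _ x); auto; [lra | apply curve_spec; lra]).
  split; auto.
  unfold gain; fold x; rewrite <- Ekc.
  apply Rmult_eq_reg_r with Sn; [|lra]; rewrite E1, <- Hst; ring.
- intros [Ek Em]; unfold gain in Em; fold x in Em; rewrite <- Ek in Em.
  assert (HC := curve_spec T x HT ltac:(lra)); rewrite <- Ek in HC; destruct HC as [_ HC].
  rewrite Em; split.
  + rewrite <- Hst; ring.
  + replace (k * S1) with (T * Sn) by (rewrite <- Hm, <- Rmult_assoc, <- HC; ring).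
    rewrite <- Hst; ring.
Qed.

Definition amplitude_of (alpha mu : R) : R := amplitude (tan alpha) (mu / (2 * cos alpha)).

Definition order_at (alpha r : R) : R := curve (tan alpha) (r ^ 2 / 4).

Definition order_of (alpha mu : R) : R := order_at alpha (amplitude_of alpha mu).

Lemma mu_crit_gain alpha mu : 0 < alpha < PI / 2 -> mu_crit alpha <= mu ->
  1 + tan alpha ^ 2 <= mu / (2 * cos alpha).
Proof.
intros Ha Hmu; destruct (acute_trig alpha Ha) as [Hc [_ [_ E]]].
rewrite E; apply Rmult_le_reg_r with (2 * cos alpha); [lra|].
replace (mu / (2 * cos alpha) * (2 * cos alpha)) with mu by (field; lra).
replace (/ cos alpha ^ 2 * (2 * cos alpha)) with (mu_crit alpha); auto.
unfold mu_crit; field; lra.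
Qed.

Lemma mu_crit_threshold alpha : 0 < alpha < PI / 2 ->
  mu_crit alpha = 2 * cos alpha * (1 + tan alpha ^ 2).
Proof.
intros Ha; destruct (acute_trig alpha Ha) as [Hc [_ [_ E]]].
rewrite E; unfold mu_crit; field; lra.
Qed.

Lemma amplitude_of_spec alpha mu : 0 < alpha < PI / 2 -> mu_crit alpha <= mu ->
  0 <= amplitude_of alpha mu /\
  mu = 2 * cos alpha * gain (tan alpha) (amplitude_of alpha mu).
Proof.
intros Ha Hmu; destruct (acute_trig alpha Ha) as [Hc [HT _]].
destruct (amplitude_spec (tan alpha) (mu / (2 * cos alpha)) HT (mu_crit_gain _ _ Ha Hmu))
  as [H1 H2].
split; auto; unfold amplitude_of; rewrite H2; field; lra.
Qed.

Lemma amplitude_of_crit alpha : 0 < alpha < PI / 2 ->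
  amplitude_of alpha (mu_crit alpha) = 0.
Proof.
intros Ha; destruct (acute_trig alpha Ha) as [Hc [HT _]]; unfold amplitude_of.
rewrite mu_crit_threshold by auto.
replace (2 * cos alpha * (1 + tan alpha ^ 2) / (2 * cos alpha)) with (1 + tan alpha ^ 2)
  by (field; lra).
now apply amplitude_threshold.
Qed.

Lemma amplitude_of_gt alpha mu r : 0 < alpha < PI / 2 -> mu_crit alpha <= mu -> 0 <= r ->
  2 * cos alpha * gain (tan alpha) r < mu -> r < amplitude_of alpha mu.
Proof.
intros Ha Hmu Hr H; destruct (acute_trig alpha Ha) as [Hc [HT _]].
apply amplitude_gt; auto; [now apply mu_crit_gain|].
apply Rmult_lt_reg_r with (2 * cos alpha); [lra|].
replace (mu / (2 * cos alpha) * (2 * cos alpha)) with mu by (field; lra); lra.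
Qed.

Lemma amplitude_of_pos alpha mu : 0 < alpha < PI / 2 -> mu_crit alpha < mu ->
  0 < amplitude_of alpha mu.
Proof.
intros Ha Hmu; destruct (acute_trig alpha Ha) as [Hc [HT _]].
apply amplitude_of_gt; auto; try lra.
rewrite gain_0 by auto; now rewrite <- mu_crit_threshold.
Qed.

Lemma mu_crit_pos alpha : 0 < alpha < PI / 2 -> 0 < mu_crit alpha.
Proof.
intros Ha; apply Rdiv_lt_0_compat; [lra | now apply acute_trig].
Qed.

Lemma solution_above_crit alpha mu k r : 0 < alpha < PI / 2 -> 0 < r ->
  self_consistent alpha mu k r -> mu_crit alpha < mu.
Proof.
intros Ha Hr HS; destruct (acute_trig alpha Ha) as [Hc [HT _]].
apply nontrivial_solution in HS; auto; destruct HS as [_ ->].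
rewrite mu_crit_threshold, <- gain_0 by auto.
apply Rmult_lt_compat_l; [lra|]; apply gain_increasing; auto; lra.
Qed.

Lemma amplitude_of_unique alpha mu r : 0 < alpha < PI / 2 -> mu_crit alpha < mu -> 0 <= r ->
  mu = 2 * cos alpha * gain (tan alpha) r -> r = amplitude_of alpha mu.
Proof.
intros Ha Hmu Hr E; destruct (acute_trig alpha Ha) as [Hc [HT _]].
destruct (amplitude_of_spec alpha mu Ha ltac:(lra)) as [H1 H2].
apply (gain_injective (tan alpha)); auto.
apply Rmult_eq_reg_l with (2 * cos alpha); lra.
Qed.

Lemma amplitude_of_continuous alpha : 0 < alpha < PI / 2 ->
  continuous_on (fun mu => mu_crit alpha <= mu) (amplitude_of alpha).
Proof.
intros Ha mu Hmu; destruct (acute_trig alpha Ha) as [Hc [HT _]].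
apply (amplitude_filterlim (within (fun mu => mu_crit alpha <= mu) (locally mu))
  (tan alpha) (fun mu => mu / (2 * cos alpha))); auto.
- now apply mu_crit_gain.
- unfold within; apply filter_forall; intros z Hz; now apply mu_crit_gain.
- apply (filterlim_filter_le_1 (F := locally mu));
    [apply filter_le_within|].
  apply (ex_derive_continuous (K := R_AbsRing) (V := R_NormedModule)
    (fun mu => mu / (2 * cos alpha))).
  auto_derive; auto.
Qed.

Lemma order_of_continuous alpha : 0 < alpha < PI / 2 ->
  continuous_on (fun mu => mu_crit alpha <= mu) (order_of alpha).
Proof.
intros Ha mu Hmu; destruct (acute_trig alpha Ha) as [Hc [HT _]].
apply (filterlim_comp _ _ _ (amplitude_of alpha) (order_at alpha) _
  (locally (amplitude_of alpha mu))).
- now apply amplitude_of_continuous.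
- now apply curve_quarter_continuous.
Qed.

Lemma pitchfork_acute alpha : 0 < alpha < PI / 2 ->
  supercritical_pitchfork (self_consistent alpha)
    (mu_crit alpha) (tan alpha) (order_of alpha) (amplitude_of alpha).
Proof.
intros Ha; destruct (acute_trig alpha Ha) as [Hc [HT _]].
repeat split.
- lra.
- apply (proj2 (self_consistent_0 alpha mu k)).
- intros mu k r Hmu HS.
  destruct (proj1 HS) as [Hr|E]; auto.
  assert (H := solution_above_crit alpha mu k r Ha Hr HS); lra.
- now apply amplitude_of_pos.
- apply nontrivial_solution in H1; auto; destruct H1 as [-> E].
  unfold order_of, order_at; now rewrite <- (amplitude_of_unique alpha mu r) by (auto; lra).
- apply nontrivial_solution in H1; auto; destruct H1 as [_ E].
  apply amplitude_of_unique; auto; lra.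
- lra.
- destruct H1 as [-> ->].
  destruct (amplitude_of_spec alpha mu Ha ltac:(lra)) as [_ E].
  apply (nontrivial_solution alpha mu); auto.
- unfold order_of; rewrite amplitude_of_crit by auto; unfold order_at.
  replace (0 ^ 2 / 4) with 0 by field; now apply curve_0.
- now apply amplitude_of_crit.
- now apply order_of_continuous.
- now apply amplitude_of_continuous.
Qed.

Lemma global_curve_acute alpha : 0 < alpha < PI / 2 ->
  global_curve (self_consistent alpha)
    (mu_crit alpha) (order_of alpha) (amplitude_of alpha) (order_at alpha).
Proof.
intros Ha; destruct (acute_trig alpha Ha) as [Hc [HT _]]; split.
- intros k r; split.
  + intros [mu [Hmu [-> ->]]]; split; [now apply amplitude_of_pos | easy].
  + intros [Hr ->].
    set (mu := 2 * cos alpha * gain (tan alpha) r).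
    assert (HS : self_consistent alpha mu (order_at alpha r) r)
      by (apply nontrivial_solution; auto).
    assert (Hmu := solution_above_crit _ _ _ _ Ha Hr HS).
    assert (E := amplitude_of_unique alpha mu r Ha Hmu ltac:(lra) eq_refl).
    exists mu; unfold order_of; rewrite <- E; auto.
- intros mu k r _ Hr HS.
  assert (Hmu := solution_above_crit _ _ _ _ Ha Hr HS).
  apply nontrivial_solution in HS; auto; destruct HS as [-> E].
  assert (Er := amplitude_of_unique alpha mu r Ha Hmu ltac:(lra) E).
  exists mu; unfold order_of, order_at; rewrite <- Er; auto.
Qed.

Lemma order_at_increasing alpha : 0 < alpha < PI / 2 ->
  increasing_on (fun r => 0 < r) (order_at alpha).
Proof.
intros Ha r r' Hr _ Hlt; destruct (acute_trig alpha Ha) as [_ [HT _]].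
apply curve_lt; auto using quarter_pos; apply quarter_lt; lra.
Qed.

Lemma order_at_bijection alpha : 0 < alpha < PI / 2 ->
  bijection_on (fun r => 0 < r) (fun k => tan alpha < k) (order_at alpha).
Proof.
intros Ha; destruct (acute_trig alpha Ha) as [_ [HT _]]; repeat split.
- intros r Hr; rewrite <- (curve_0 (tan alpha) HT) at 1.
  apply curve_lt; auto; try lra.
  assert (H := quarter_lt 0 r (Rle_refl 0) Hr); lra.
- intros r r' Hr Hr' E; destruct (Rtotal_order r r') as [H|[H|H]]; auto.
  + assert (H1 := order_at_increasing alpha Ha r r' Hr Hr' H); lra.
  + assert (H1 := order_at_increasing alpha Ha r' r Hr' Hr H); lra.
- intros k Hk; destruct (curve_onto (tan alpha) k HT Hk) as [x [Hx Ex]].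
  exists (2 * sqrt x); assert (H := sqrt_lt_R0 x Hx); split; [lra|].
  unfold order_at; replace ((2 * sqrt x) ^ 2 / 4) with (sqrt x * sqrt x) by field.
  rewrite sqrt_sqrt by lra; exact Ex.
Qed.

Lemma order_of_gt_tan alpha mu : 0 < alpha < PI / 2 -> mu_crit alpha < mu ->
  tan alpha < order_of alpha mu.
Proof.
intros Ha Hmu; apply (order_at_bijection alpha Ha); now apply amplitude_of_pos.
Qed.

Lemma order_of_limit_crit alpha : 0 < alpha < PI / 2 ->
  filterlim (order_of alpha) (at_right (mu_crit alpha)) (locally (tan alpha)).
Proof.
intros Ha; destruct (pitchfork_acute alpha Ha) as [_ [_ [_ [E _]]]]; rewrite <- E.
apply (filterlim_filter_le_1
  (F := within (fun mu => mu_crit alpha <= mu) (locally (mu_crit alpha)))).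
- intros P HP; unfold at_right, within in *.
  apply filter_imp with (2 := HP); intros z Hz Hlt; apply Hz; lra.
- apply order_of_continuous; auto; lra.
Qed.

Lemma amplitude_of_limit_infty alpha : 0 < alpha < PI / 2 ->
  filterlim (amplitude_of alpha) (Rbar_locally p_infty) (Rbar_locally p_infty).
Proof.
intros Ha P [M HM].
set (r := Rmax M 0).
exists (Rmax (mu_crit alpha) (2 * cos alpha * gain (tan alpha) r)); intros mu Hmu.
assert (H1 := Rmax_l (mu_crit alpha) (2 * cos alpha * gain (tan alpha) r)).
assert (H2 := Rmax_r (mu_crit alpha) (2 * cos alpha * gain (tan alpha) r)).
assert (H3 := Rmax_l M 0). assert (H4 := Rmax_r M 0). fold r in H3, H4.
apply HM; apply Rle_lt_trans with r; auto.
apply amplitude_of_gt; auto; lra.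
Qed.

Lemma order_at_limit_infty alpha : 0 < alpha < PI / 2 ->
  filterlim (order_at alpha) (Rbar_locally p_infty) (Rbar_locally p_infty).
Proof.
intros Ha P [M HM].
destruct (order_at_bijection alpha Ha) as [_ [_ Honto]].
assert (H1 := Rmax_l M (tan alpha)). assert (H2 := Rmax_r M (tan alpha)).
destruct (Honto (Rmax M (tan alpha) + 1)) as [r [Hr Er]]; [lra|].
exists r; intros r' Hr'; apply HM.
assert (H := order_at_increasing alpha Ha r r' Hr ltac:(lra) Hr'); lra.
Qed.

Lemma order_of_limit_infty alpha : 0 < alpha < PI / 2 ->
  filterlim (order_of alpha) (Rbar_locally p_infty) (Rbar_locally p_infty).
Proof.
intros Ha; apply (filterlim_comp _ _ _ (amplitude_of alpha) (order_at alpha) _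
  (Rbar_locally p_infty)).
- now apply amplitude_of_limit_infty.
- now apply order_at_limit_infty.
Qed.

(** * Behaviour at a right angle *)

Lemma tan_large (M : R) :
  at_left (PI / 2) (fun alpha => 0 < alpha < PI / 2 /\ M < tan alpha).
Proof.
assert (HP := PI_RGT_0). assert (HA := atan_bound M).
assert (HL : locally (PI / 2) (fun alpha => Rmax 0 (atan M) < alpha)).
{ apply (open_gt (Rmax 0 (atan M))); apply Rmax_lub_lt; lra. }
unfold at_left, within; apply filter_imp with (2 := HL); intros alpha H1 H2.
assert (H3 := Rmax_l 0 (atan M)). assert (H4 := Rmax_r 0 (atan M)).
split; [lra|].
rewrite <- (tan_atan M); apply tan_increasing; lra.
Qed.

Lemma mu_crit_ge_tan alpha : 0 < alpha < PI / 2 -> tan alpha <= mu_crit alpha.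
Proof.
intros Ha; destruct (acute_trig alpha Ha) as [Hc _]; unfold tan, mu_crit, Rdiv.
apply Rmult_le_compat_r; [apply Rlt_le, Rinv_0_lt_compat; auto|].
assert (H := SIN_bound alpha); lra.
Qed.

(** At amplitude [r], [mu / mu_crit alpha] is at most [1 + C / (4 + k ^ 2)], where
    [k >= tan alpha]: it takes amplitudes beyond any bound to keep this ratio
    above [c > 1]. *)
Lemma amplitude_of_large c r : 1 < c -> 0 <= r ->
  at_left (PI / 2) (fun alpha => 0 < alpha < PI / 2 /\
    forall mu, c * mu_crit alpha <= mu -> r < amplitude_of alpha mu).
Proof.
intros Hc1 Hr.
destruct (expect_square_large_kap (r ^ 2 / 4) (quarter_pos r)) as [C [HC Hb]].
apply filter_imp with (2 := tan_large (1 + C / (c - 1))).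
intros alpha [Ha HT]; split; auto; intros mu Hmu.
destruct (acute_trig alpha Ha) as [Hc [HT0 [_ HE]]].
assert (Hcr := mu_crit_pos alpha Ha).
assert (Hmu' : mu_crit alpha <= mu) by nra.
apply amplitude_of_gt; auto.
apply Rlt_le_trans with (2 := Hmu).
rewrite mu_crit_threshold by auto.
set (T := tan alpha) in *; set (x := r ^ 2 / 4) in *.
assert (Hx : 0 <= x) by apply quarter_pos.
destruct (curve_spec T x HT0 Hx) as [Hk Ek].
assert (HkT := curve_ge T x HT0 Hx).
assert (Hst := stiff_le_square T (curve T x) x Hx Ek).
unfold gain; fold x; set (k := curve T x) in *.
assert (Hbk := Hb (k ^ 2) (pow2_ge_0 k)).
assert (HCc : 0 <= C / (c - 1)).
{ apply Rmult_le_pos; auto; apply Rlt_le, Rinv_0_lt_compat; lra. }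
assert (HCk : C / (4 + k ^ 2) < c - 1).
{ assert (Hk2 := pow2_ge_0 k).
  apply Rmult_lt_reg_r with (4 + k ^ 2); [lra|].
  unfold Rdiv; rewrite Rmult_assoc, Rinv_l, Rmult_1_r by lra.
  replace C with ((c - 1) * (C / (c - 1))) by (field; lra).
  apply Rmult_lt_compat_l; [lra|].
  assert (k <= k ^ 2) by nra. lra. }
assert (HT2 : 0 < 1 + T ^ 2) by (assert (H := pow2_ge_0 T); lra).
assert (stiff (k ^ 2) x < (1 + T ^ 2) * c).
{ apply Rle_lt_trans with (1 := Hst); apply Rmult_lt_compat_l; auto; lra. }
replace (c * (2 * cos alpha * (1 + T ^ 2))) with (2 * cos alpha * ((1 + T ^ 2) * c)) by ring.
apply Rmult_lt_compat_l; [lra | auto].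
Qed.

(** * Negative angles by conjugation *)

Lemma pitchfork_opp (sol sol' : R -> R -> R -> Prop) mu0 k0 kb rb :
  (forall mu k r, sol' mu k r <-> sol mu (- k) r) ->
  supercritical_pitchfork sol mu0 k0 kb rb ->
  supercritical_pitchfork sol' mu0 (- k0) (fun mu => - kb mu) rb.
Proof.
intros E (H1 & H2 & H3 & H4 & H5 & H6 & H7).
split; [|split; [|split; [|split; [|split; [|split]]]]]; auto.
- intros mu k Hmu; apply E; auto.
- intros mu k r Hmu HS; apply E in HS; eauto.
- intros mu Hmu; destruct (H3 mu Hmu) as [Hr Hiff]; split; auto.
  intros k r Hr'; rewrite E, Hiff by auto; split; intros [Ek Er]; split; auto; lra.
- now rewrite H4.
- intros mu Hmu; apply (filterlim_comp _ _ _ kb Ropp _ (locally (kb mu))); auto.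
  apply (filterlim_opp (K := R_AbsRing) (V := R_NormedModule)).
Qed.

Lemma global_curve_opp (sol sol' : R -> R -> R -> Prop) mu0 kb rb K :
  (forall mu k r, sol' mu k r <-> sol mu (- k) r) ->
  global_curve sol mu0 kb rb K ->
  global_curve sol' mu0 (fun mu => - kb mu) rb (fun r => - K r).
Proof.
intros E [H1 H2].
assert (EN : forall k r, nontrivial_curve mu0 (fun mu => - kb mu) rb k r
  <-> nontrivial_curve mu0 kb rb (- k) r).
{ intros k r; split; intros [mu [Hmu [Ek Er]]]; exists mu; repeat split; auto; lra. }
split.
- intros k r; rewrite EN, H1; split; intros [Hr Ek]; split; auto; lra.
- intros mu k r Hmu Hr HS; apply EN, (H2 mu); auto; now apply E.
Qed.

Lemma bijection_opp (A : R -> Prop) b K :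
  bijection_on A (fun k => b < k) K ->
  bijection_on A (fun k => k < - b) (fun r => - K r).
Proof.
intros [H1 [H2 H3]]; split; [|split].
- intros x Hx; specialize (H1 x Hx); lra.
- intros x y Hx Hy Exy; apply H2; auto; lra.
- intros z Hz; destruct (H3 (- z)) as [x [Hx Ex]]; [lra|]; exists x; split; auto; lra.
Qed.

Definition branch_order (alpha : R) : R -> R :=
  if Rle_dec 0 alpha then order_of alpha else fun mu => - order_of (- alpha) mu.

Definition branch_amplitude (alpha : R) : R -> R :=
  if Rle_dec 0 alpha then amplitude_of alpha else amplitude_of (- alpha).

Definition branch_graph (alpha : R) : R -> R :=
  if Rle_dec 0 alpha then order_at alpha else fun r => - order_at (- alpha) r.

Theorem theorem5p2 :
  exists kb rb K : R -> R -> R,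
    (forall alpha, 0 < alpha < PI / 2 ->
       supercritical_pitchfork (self_consistent alpha)
         (mu_crit alpha) (tan alpha) (kb alpha) (rb alpha) /\
       global_curve (self_consistent alpha)
         (mu_crit alpha) (kb alpha) (rb alpha) (K alpha) /\
       bijection_on (fun r => 0 < r) (fun k => tan alpha < k) (K alpha) /\
       increasing_on (fun r => 0 < r) (K alpha)) /\
    (forall alpha, - (PI / 2) < alpha < 0 ->
       supercritical_pitchfork (self_consistent alpha)
         (mu_crit alpha) (tan alpha) (kb alpha) (rb alpha) /\
       global_curve (self_consistent alpha)
         (mu_crit alpha) (kb alpha) (rb alpha) (K alpha) /\
       bijection_on (fun r => 0 < r) (fun k => k < tan alpha) (K alpha) /\
       decreasing_on (fun r => 0 < r) (K alpha)) /\
    (forall alpha, 0 < alpha < PI / 2 ->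
       filterlim (kb alpha) (at_right (mu_crit alpha)) (locally (tan alpha)) /\
       filterlim (kb alpha) (Rbar_locally p_infty) (Rbar_locally p_infty) /\
       filterlim (rb alpha) (Rbar_locally p_infty) (Rbar_locally p_infty)) /\
    (* limits alpha -> PI/2^- at fixed mu, along the alpha where the branch exists *)
    (forall mu, 0 < mu ->
       filterlim (fun alpha => kb alpha mu)
         (within (fun alpha => mu_crit alpha < mu) (at_left (PI / 2)))
         (Rbar_locally p_infty) /\
       filterlim (fun alpha => rb alpha mu)
         (within (fun alpha => mu_crit alpha < mu) (at_left (PI / 2)))
         (Rbar_locally p_infty)) /\
    (* the same limits when mu > mu_crit alpha moves with alpha; for the
       amplitude, mu must stay away from mu_crit alpha in ratio *)
    (forall m : R -> R,
       (forall alpha, 0 < alpha < PI / 2 -> mu_crit alpha < m alpha) ->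
       filterlim (fun alpha => kb alpha (m alpha)) (at_left (PI / 2))
         (Rbar_locally p_infty)) /\
    (forall (c : R) (m : R -> R), 1 < c ->
       (forall alpha, 0 < alpha < PI / 2 -> c * mu_crit alpha <= m alpha) ->
       filterlim (fun alpha => rb alpha (m alpha)) (at_left (PI / 2))
         (Rbar_locally p_infty)) /\
    (forall alpha, alpha = PI / 2 \/ alpha = - (PI / 2) ->
       forall mu, 0 < mu ->
         (forall k, self_consistent alpha mu k 0) /\
         (forall k r, self_consistent alpha mu k r -> r = 0)).
Proof.
exists branch_order, branch_amplitude, branch_graph.
split; [|split; [|split; [|split; [|split; [|split]]]]].
- intros alpha Ha; unfold branch_order, branch_amplitude, branch_graph.
  destruct (Rle_dec 0 alpha) as [_|H]; [|lra].
  auto using pitchfork_acute, global_curve_acute, order_at_bijection, order_at_increasing.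
- intros alpha Ha; unfold branch_order, branch_amplitude, branch_graph.
  destruct (Rle_dec 0 alpha) as [H|_]; [lra|].
  assert (Ha' : 0 < - alpha < PI / 2) by lra.
  assert (Et : tan alpha = - tan (- alpha)) by (rewrite tan_neg; ring).
  assert (Em : mu_crit alpha = mu_crit (- alpha)) by (unfold mu_crit; now rewrite cos_neg).
  assert (ES := fun mu k r => self_consistent_opp alpha mu k r).
  rewrite Et, Em; split; [|split; [|split]].
  + now apply (pitchfork_opp _ _ _ _ _ _ ES), pitchfork_acute.
  + now apply (global_curve_opp _ _ _ _ _ _ ES), global_curve_acute.
  + now apply bijection_opp, order_at_bijection.
  + intros x y Hx Hy Hxy.
    assert (H := order_at_increasing (- alpha) Ha' x y Hx Hy Hxy); lra.
- intros alpha Ha; unfold branch_order, branch_amplitude.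
  destruct (Rle_dec 0 alpha) as [_|H]; [|lra].
  auto using order_of_limit_crit, order_of_limit_infty, amplitude_of_limit_infty.
- intros mu Hmu.
  (* [mu_crit] tends to infinity, so that [mu_crit alpha < mu] fails near [PI / 2]. *)
  assert (Hempty : within (fun alpha => mu_crit alpha < mu) (at_left (PI / 2))
    (fun _ => False)).
  { unfold within at 1; apply filter_imp with (2 := tan_large mu).
    intros alpha [Ha HT] Hlt; assert (H := mu_crit_ge_tan alpha Ha); lra. }
  split; intros P _; apply filter_imp with (2 := Hempty); easy.
- intros m Hm P [M HM].
  unfold filtermap; apply filter_imp with (2 := tan_large M).
  intros alpha [Ha HT]; apply HM; unfold branch_order.
  destruct (Rle_dec 0 alpha) as [_|H]; [|lra].
  apply Rlt_trans with (1 := HT); auto using order_of_gt_tan.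
- intros c m Hc Hm P [M HM].
  unfold filtermap; apply filter_imp with (2 := amplitude_of_large c (Rmax M 0) Hc (Rmax_r M 0)).
  intros alpha [Ha Hlarge]; apply HM; unfold branch_amplitude.
  destruct (Rle_dec 0 alpha) as [_|H]; [|lra].
  apply Rle_lt_trans with (1 := Rmax_l M 0); auto.
- intros alpha Ha mu Hmu; split; [intros; apply self_consistent_0|].
  intros k r HS; destruct (proj1 HS) as [Hr|E]; auto; exfalso.
  apply self_consistent_moments in HS; auto; destruct HS as [E _].
  assert (Hcos : cos alpha = 0).
  { destruct Ha as [-> | ->]; rewrite ?cos_neg; apply cos_PI2. }
  assert (H := moment_succ_pos (k ^ 2) (r ^ 2 / 4) (pow2_ge_0 k) (quarter_pos r)).
  rewrite Hcos, Rmult_0_r in E; apply Rmult_integral in E; lra.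
Qed.
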